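(* Let $k$ be a commutative ring with unity and $q\in k$ invertible. There is a commuting diagram of $q$-Hopf algebras in the following sense: there is an injective homomorphism of $q$-Hopf algebras $j:\mathsf{NSym}\to\mathsf{PR}'_q$ whose composition with the inclusion $\mathsf{PR}'_q\hookrightarrow\mathsf{MR}'_q$ equals $\theta_q\circ\iota_q$ (where $\iota_q:\mathsf{NSym}\to\mathsf{MR}_q$ is injective and $\theta_q:\mathsf{MR}_q\to\mathsf{MR}'_q$ is an isomorphism), and the composition $\pi'_q\circ\theta_q\circ\iota_q:\mathsf{NSym}\to\mathsf{QSym}_q$ (with $\pi'_q:\mathsf{MR}'_q\to\mathsf{QSym}_q$ surjective) equals the forgetful map $\phi:\mathsf{NSym}\to\mathsf{Sym}_q$ followed by the inclusion $\mathsf{Sym}_q\hookrightarrow\mathsf{QSym}_q$.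
   Context: **Graded $q$-Hopf algebras.** A graded $q$-Hopf algebra is a connected $\mathbb{N}$-graded unital associative $k$-algebra with a graded coassociative counital coproduct $\Delta$ such that $\Delta(xy)=\Delta(x)\Delta(y)$, where $H\otimes H$ carries the product $(a\otimes b)(c\otimes d)=q^{|b||c|}ac\otimes bd$ for homogeneous elements. **Compositions.** $C$ is the set of compositions (finite tuples of positive integers, including the empty one). For $\alpha=(\alpha_1,\dots,\alpha_r)\vDash n$ (sum $n$), $\mathrm{des}(\alpha)=\{\alpha_1,\dots,\alpha_1+\cdots+\alpha_{r-1}\}$; for $S\subseteq[n-1]$, $c(S)\vDash n$ is the composition with descent set $S$. $\alpha\preceq\beta$ means $\beta$ refines $\alpha$, i.e. they have equal sums and $\mathrm{des}(\alpha)\subseteq\mathrm{des}(\beta)$. **$\mathsf{QSym}_q$, $\mathsf{Sym}_q$, $\mathsf{NSym}$.** Let $A_q=k\langle\langle x_1,x_2,\dots\rangle\rangle/(x_ix_j-qx_jx_i,\ i>j)$; $M_\alpha=\sum_{i_1<\cdots<i_r}x_{i_1}^{\alpha_1}\cdots x_{i_r}^{\alpha_r}$; $F_\alpha=\sum_{\beta\succeq\alpha}M_\beta$. $\mathsf{QSym}_q\subset A_q$ is the subalgebra with basis $\{M_\alpha\}_{\alpha\in C}$, with coproduct $\Delta'(M_\alpha)=\sum_{\beta\gamma=\alpha}M_\beta\otimes M_\gamma$ (concatenation). $\mathsf{Sym}_q$ is the subalgebra generated by $h_n=\sum_{i_1\le\cdots\le i_n}x_{i_1}\cdots x_{i_n}$,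 $n\ge1$. $\mathsf{NSym}$ is the free associative $k$-algebra on $H_1,H_2,\dots$ ($H_0=1$), $H_\alpha=H_{\alpha_1}\cdots H_{\alpha_r}$, with $q$-Hopf structure $\Delta_q(H_n)=\sum_{i=0}^nH_i\otimes H_{n-i}$. The forgetful map $\phi$ is the algebra homomorphism with $\phi(H_n)=h_n$; its image is $\mathsf{Sym}_q$. **$\mathsf{MR}_q$, $\mathsf{MR}'_q$.** $k\mathfrak{S}=\bigoplus_{n\ge0}k\mathfrak{S}_n$, $w\in\mathfrak{S}_n$ viewed as a word $w_1\cdots w_n$; $\ell(w)$ is the number of inversions; $c(w)=c(\{i:w(i)>w(i+1)\})\vDash n$. For a word $u$, $\mathrm{st}(u)$ is its standardization (the permutation with $\mathrm{st}(u)(i)<\mathrm{st}(u)(j)$ iff $u_i<u_j$, or $u_i=u_j$ and $i<j$), $\mathrm{alph}(u)$ its set of letters, $u|_I$ the subword of letters in $I$. For $w\in\mathfrak{S}_n$, $w'\in\mathfrak{S}_m$: $w*w'=\sum uv$ over words $u,v$ with $\mathrm{alph}(u)\cup\mathrm{alph}(v)=[n+m]$, $\mathrm{st}(u)=w$, $\mathrm{st}(v)=w'$; $\Delta_q(w)=\sum_{i=0}^nq^{\mathrm{inv}(i,w)}w|_{\{1,\dots,i\}}\otimes\mathrm{st}(w|_{\{i+1,\dots,n\}})$, where $\mathrm{inv}(i,w)$ is the number of pairs $a>b$ with $w_a\le i<w_b$; $w*'_qw'$ is the $q$-shuffle of $w$ with the word obtained by adding $n$ to each letter of $w'$, where $\emptyset\sqcup_q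 u=u\sqcup_q\emptyset=u$, $(au)\sqcup_q(bv)=a(u\sqcup_q bv)+q^{|au|}b(au\sqcup_q v)$; $\Delta'(w)=\sum_{i=0}^n\mathrm{st}(w_1\cdots w_i)\otimes\mathrm{st}(w_{i+1}\cdots w_n)$. $\mathsf{MR}_q=(k\mathfrak{S},*,\Delta_q)$, $\mathsf{MR}'_q=(k\mathfrak{S},*'_q,\Delta')$. **Maps.** $\theta_q(w)=q^{\ell(w)}w^{-1}$; $\pi'_q(w)=F_{c(w)}$; $\iota_q(H_\alpha)=\sum_{c(w)\preceq\alpha}w$. All three are $q$-Hopf algebra homomorphisms. **$\mathsf{PR}'_q$.** The $q$-Hopf subalgebra $\bigoplus_Tk\cdot c_q(T)$ of $\mathsf{MR}'_q$, $T$ over all standard Young tableaux, $c_q(T)=\sum_{P(w)=T}q^{\ell(w)}w$, with $P(w)$ the Schensted row-insertion tableau of $w$. *)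

(* Defs.v *)
From HB Require Import structures.
From mathcomp Require Import all_boot all_order all_algebra.
From mathcomp Require Import finmap.
From mathcomp.multinomials Require Import monalg.

Set Implicit Arguments.
Unset Strict Implicit.
Unset Printing Implicit Defensive.

Import GRing.Theory.
Local Open Scope nat_scope.

Definition is_comp (a : seq nat) : bool := all (fun i => 0 < i) a.
Definition composition : Type := {a : seq nat | is_comp a}.
HB.instance Definition _ := SubChoice.copy composition {a : seq nat | is_comp a}.

Fact is_comp_nil : is_comp [::]. Proof. by []. Qed.
Definition comp0 : composition := Sub [::] is_comp_nil.

Fact is_comp_cat (a b : composition) : is_comp (val a ++ val b).
Proof. by rewrite /is_comp all_cat; apply/andP; split; apply: valP. Qed.
Definition comp_cat (a b : composition) : composition :=
  Sub (val a ++ val b) (is_comp_cat a b).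

Fact is_comp_take i (a : composition) : is_comp (take i (val a)).
Proof. by apply/allP => x /mem_take; apply/allP/(valP a). Qed.
Definition comp_take i (a : composition) : composition :=
  Sub (take i (val a)) (is_comp_take i a).

Fact is_comp_drop i (a : composition) : is_comp (drop i (val a)).
Proof. by apply/allP => x /mem_drop; apply/allP/(valP a). Qed.
Definition comp_drop i (a : composition) : composition :=
  Sub (drop i (val a)) (is_comp_drop i a).

(* the one-part composition [(n)], or the empty one when [n = 0] *)
Fact is_comp_part n : is_comp (nseq (0 < n) n).
Proof. by case: n. Qed.
Definition comp_part n : composition := Sub (nseq (0 < n) n) (is_comp_part n).

Definition des (a : seq nat) : seq nat :=
  [seq sumn (take i a) | i <- iota 1 (size a).-1].

(* the lengths of the intervals into which [D] cuts {1, ..., n} *)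
Definition cdes_seq (n : nat) (D : seq nat) : seq nat :=
  if n == 0 then [::]
  else pairmap (fun a b => b - a) 0
         (rcons [seq i <- iota 1 n.-1 | i \in D] n).

Fact is_comp_cdes n D : is_comp (cdes_seq n D).
Proof.
rewrite /cdes_seq /is_comp; case: n => // n /=.
have: path ltn 0 (rcons [seq i <- iota 1 n | i \in D] n.+1).
  rewrite rcons_path path_min_sorted; last first.
    by apply/allP => i; rewrite mem_filter mem_iota => /andP[_ /andP[]].
  rewrite sorted_filter ?iota_ltn_sorted //=; last exact: ltn_trans.
  have := mem_last 0 [seq i <- iota 1 n | i \in D].
  rewrite inE mem_filter mem_iota add1n => /predU1P[-> //|].
  by case/andP=> _ /andP[].
elim: (rcons _ _) {1 4}0 => //= b s IHs a /andP[ab bs].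
by rewrite subn_gt0 ab IHs.
Qed.
Definition cdes (n : nat) (D : seq nat) : composition :=
  Sub (cdes_seq n D) (is_comp_cdes n D).

Fixpoint sublists (s : seq nat) : seq (seq nat) :=
  if s is i :: s' then [seq i :: t | t <- sublists s'] ++ sublists s'
  else [:: [::]].

Definition comps (n : nat) : seq composition :=
  [seq cdes n D | D <- sublists (iota 1 n.-1)].

Definition refine (a b : composition) : bool :=
  (sumn (val a) == sumn (val b)) && all (mem (des (val b))) (des (val a)).

(* A permutation of 1, ..., n is the word of its values. *)

Definition is_perm (w : seq nat) : bool := perm_eq w (iota 1 (size w)).
Definition permword : Type := {w : seq nat | is_perm w}.
HB.instance Definition _ := SubChoice.copy permword {w : seq nat | is_perm w}.

Definition permwords (n : nat) : seq permword :=
  pmap insub (permutations (iota 1 n)).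

Fact is_perm_nil : is_perm [::]. Proof. by []. Qed.
Definition perm0 : permword := Sub [::] is_perm_nil.

Fact is_permP (w : seq nat) :
  uniq w -> (forall x, x \in w -> 0 < x <= size w) -> is_perm w.
Proof.
move=> uw bw; apply: uniq_perm => //; first exact: iota_uniq.
have sub : {subset w <= iota 1 (size w)}.
  by move=> x /bw; rewrite mem_iota add1n ltnS.
by case: (uniq_min_size uw sub) => //; rewrite size_iota.
Qed.

(* One plus the rank of position [i] when positions are ordered by
   (letter, position). *)
Definition st_at (u : seq nat) (i : nat) : nat :=
  (count (ltn^~ (nth 0 u i)) u + count_mem (nth 0 u i) (take i u)).+1.
Definition st_seq (u : seq nat) : seq nat :=
  [seq st_at u i | i <- iota 0 (size u)].

Fact st_at_aux u i j : i < j <= size u ->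
  count_mem (nth 0 u i) (take i u) < count_mem (nth 0 u i) (take j u).
Proof.
case/andP=> ij ju.
have -> : take j u = rcons (take i u) (nth 0 u i) ++ drop i.+1 (take j u).
  rewrite -take_nth; last exact: leq_trans ij ju.
  by rewrite -{1}(cat_take_drop i.+1 (take j u)) take_takel.
by rewrite count_cat -cats1 count_cat /= eqxx !addn0 addn1 addSn ltnS leq_addr.
Qed.

Fact st_at_le u i : i < size u ->
  st_at u i <= count (leq^~ (nth 0 u i)) u.
Proof.
move=> iu; have := @st_at_aux u i (size u); rewrite iu leqnn take_size => /(_ isT).
rewrite -(ltn_add2l (count (ltn^~ (nth 0 u i)) u)) => /leq_trans-> //.
rewrite -count_predUI [X in _ + X](_ : _ = 0) ?addn0.
  by apply: sub_count => x /= /orP[/ltnW|/eqP->].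
rewrite (eq_count (a2 := pred0)) ?count_pred0 // => x /=.
by case: eqP => [->|]; rewrite ?ltnn ?andbF.
Qed.

Fact st_at_lt u i j : i < size u -> j < size u ->
  (nth 0 u i < nth 0 u j) || (nth 0 u i == nth 0 u j) && (i < j) ->
  st_at u i < st_at u j.
Proof.
move=> iu ju /orP[lt_ij|/andP[/eqP eq_ij lt_ij]].
  apply: leq_ltn_trans (st_at_le iu) _; rewrite ltnS.
  apply: leq_trans (leq_addr _ _).
  by apply: sub_count => x /= /leq_ltn_trans; apply.
by rewrite /st_at -eq_ij ltnS ltn_add2l st_at_aux // lt_ij ltnW.
Qed.

Fact is_perm_st u : is_perm (st_seq u).
Proof.
apply: is_permP.
  rewrite map_inj_in_uniq ?iota_uniq // => i j.
  rewrite !mem_iota /= !add0n => iu ju eq_st.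
  have [lt_ij|lt_ij|//] := ltngtP i j; move: (ltnn (st_at u i)).
    case: (ltngtP (nth 0 u i) (nth 0 u j)) => nij.
    - by rewrite {2}eq_st st_at_lt // nij.
    - by rewrite {1}eq_st st_at_lt // nij.
    - by rewrite {2}eq_st st_at_lt // nij eqxx lt_ij orbT.
  case: (ltngtP (nth 0 u i) (nth 0 u j)) => nij.
  - by rewrite {2}eq_st st_at_lt // nij.
  - by rewrite {1}eq_st st_at_lt // nij.
  - by rewrite {1}eq_st st_at_lt // nij eqxx lt_ij orbT.
move=> x /mapP[i]; rewrite mem_iota add0n => /= iu ->{x}.
by rewrite size_map size_iota (leq_trans (st_at_le iu)) ?count_size.
Qed.
Definition st (u : seq nat) : permword := Sub (st_seq u) (is_perm_st u).

Fact is_perm_inv (w : permword) :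
  is_perm [seq (index i (val w)).+1 | i <- iota 1 (size (val w))].
Proof.
have pw := valP w; apply: is_permP.
  rewrite map_inj_in_uniq ?iota_uniq // => i j.
  by rewrite -!(perm_mem pw) => iw jw [/(index_inj 0 iw jw)].
move=> x /mapP[i iw ->]; rewrite size_map size_iota /=.
by rewrite index_mem (perm_mem pw).
Qed.
Definition perm_inv (w : permword) : permword := Sub _ (is_perm_inv w).

Fact is_perm_restr i (w : permword) : is_perm [seq x <- val w | x <= i].
Proof.
have pw := valP w.
have uw : uniq (val w) by rewrite (perm_uniq pw) iota_uniq.
apply: is_permP => [|x]; first exact: filter_uniq.
rewrite mem_filter (perm_mem pw) mem_iota add1n ltnS => /andP[xi /andP[x0 xw]].
rewrite x0 -[leqLHS](size_iota 1 x); apply: uniq_leq_size => [|y].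
  exact: iota_uniq.
rewrite mem_iota add1n ltnS mem_filter (perm_mem pw) mem_iota add1n ltnS.
by case/andP=> -> yx; rewrite (leq_trans yx xi) (leq_trans yx xw).
Qed.
Definition perm_restr i (w : permword) : permword := Sub _ (is_perm_restr i w).

Fixpoint inversions (u : seq nat) : nat :=
  if u is x :: v then count (fun y => y < x) v + inversions v else 0.

(* the number of inversions between a letter [> i] and a later letter [<= i] *)
Fixpoint inv_at (i : nat) (u : seq nat) : nat :=
  if u is x :: v then (i < x) * count (fun y => y <= i) v + inv_at i v else 0.

Definition perm_comp (w : permword) : composition :=
  cdes (size (val w))
    [seq i <- iota 1 (size (val w)).-1 | nth 0 (val w) i < nth 0 (val w) i.-1].

Fixpoint insert (t : seq (seq nat)) (x : nat) : seq (seq nat) :=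
  if t is r :: t' then
    let p := find (fun y => x < y) r in
    if p == size r then rcons r x :: t'
    else set_nth 0 r p x :: insert t' (nth 0 r p)
  else [:: [:: x]].

Definition Ptab (w : seq nat) : seq (seq nat) := foldl insert [::] w.

(* tableaux are listed row by row, the longest row first *)
Definition is_syt (t : seq (seq nat)) : bool :=
  [&& is_perm (flatten t),
      all (fun r => (r != [::]) && sorted ltn r) t &
      sorted (fun r s => (size s <= size r) && all2 ltn (take (size s) r) s) t].
Definition syt : Type := {t : seq (seq nat) | is_syt t}.
HB.instance Definition _ := SubChoice.copy syt {t : seq (seq nat) | is_syt t}.

Local Open Scope ring_scope.

(* The scaling is built here because the module structure of [{malg k[X]}]
   requires a nonzero ring, whereas [k] may be the zero ring. *)

Definition freemod (k : comPzRingType) (X : choiceType) : Type := {malg k[X]}.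

HB.instance Definition _ (k : comPzRingType) (X : choiceType) :=
  GRing.Zmodule.copy (freemod k X) {malg k[X]}.

Section FreeModule.
Variables (k : comPzRingType) (X : choiceType).
Implicit Types (x y : freemod k X) (c : k).

Definition fscale c x : freemod k X := [malg i in msupp x => c * x@_i].

Lemma fscaleE c x i : (fscale c x)@_i = c * x@_i.
Proof.
rewrite mcoeffE; case: ifP => // /negbT ix.
by rewrite (mcoeff_outdom ix) mulr0.
Qed.

Fact fscaleA a b x : fscale a (fscale b x) = fscale (a * b) x.
Proof. by apply/malgP => i; rewrite !fscaleE mulrA. Qed.

Fact fscale1 : left_id 1 fscale.
Proof. by move=> x; apply/malgP => i; rewrite fscaleE mul1r. Qed.

Fact fscaleDr : right_distributive fscale +%R.
Proof. by move=> c x y; apply/malgP => i; rewrite !(fscaleE, mcoeffD) mulrDr. Qed.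

Fact fscaleDl x : {morph fscale^~ x : a b / a + b}.
Proof. by move=> a b; apply/malgP => i; rewrite !(fscaleE, mcoeffD) mulrDl. Qed.

HB.instance Definition _ := GRing.Zmodule_isLmodule.Build k (freemod k X)
  fscaleA fscale1 fscaleDr fscaleDl.

Definition bas (i : X) : freemod k X := << 1 *g i >>.

Definition lext (V : lmodType k) (f : X -> V) (x : freemod k X) : V :=
  \sum_(i <- msupp x) x@_i *: f i.

End FreeModule.

(* The tensor product of [freemod k X] and [freemod k Y] is
   [freemod k (X * Y)], the pair [(i, j)] standing for [i (x) j]. *)

Section Tensor.
Variable k : comPzRingType.

Definition tens (X Y : choiceType) (x : freemod k X) (y : freemod k Y) :
    freemod k (X * Y)%type :=
  lext (fun i => lext (fun j => bas k (i, j)) y) x.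

Definition tmap (X X' Y Y' : choiceType)
    (f : freemod k X -> freemod k X') (g : freemod k Y -> freemod k Y')
    (z : freemod k (X * Y)%type) : freemod k (X' * Y')%type :=
  lext (fun p : X * Y => tens (f (bas k p.1)) (g (bas k p.2))) z.

Definition tassoc (X Y Z : choiceType)
    (z : freemod k ((X * Y) * Z)%type) : freemod k (X * (Y * Z))%type :=
  lext (fun p : (X * Y) * Z => bas k (p.1.1, (p.1.2, p.2))) z.

End Tensor.

(* The operations are given by their values on a homogeneous basis [X] and
   are extended (bi)linearly; the axioms are collected in [graded_qHopf]. *)

Record galg (k : comPzRingType) (X : choiceType) := GAlg {
  bdeg : X -> nat;
  bmul : X -> X -> freemod k X;
  gone : freemod k X
}.

Record qhopf (k : comPzRingType) (X : choiceType) := QHopf {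
  qalg :> galg k X;
  bcopr : X -> freemod k (X * X)%type;
  bcoun : X -> k
}.

Section QHopfTheory.
Variables (k : comPzRingType) (q : k).

Definition hmul (X : choiceType) (A : galg k X) (x y : freemod k X) :
    freemod k X :=
  lext (fun i => lext (fun j => bmul A i j) y) x.

(* (a (x) b)(c (x) d) = q^(|b||c|) ac (x) bd *)
Definition tmul (X : choiceType) (A : galg k X)
    (y z : freemod k (X * X)%type) : freemod k (X * X)%type :=
  lext (fun p : X * X => lext (fun r : X * X =>
    q ^+ (bdeg A p.2 * bdeg A r.1) *:
      tens (bmul A p.1 r.1) (bmul A p.2 r.2)) z) y.

Definition copr (X : choiceType) (H : qhopf k X) (x : freemod k X) :
    freemod k (X * X)%type :=
  lext (bcopr H) x.

Definition coun (X : choiceType) (H : qhopf k X) (x : freemod k X) : k :=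
  \sum_(i <- msupp x) x@_i * bcoun H i.

Definition homog (X : choiceType) (A : galg k X) (n : nat)
    (x : freemod k X) : Prop :=
  forall i, i \in msupp x -> bdeg A i = n.

Definition homog2 (X : choiceType) (A : galg k X) (n : nat)
    (z : freemod k (X * X)%type) : Prop :=
  forall p : X * X, p \in msupp z -> (bdeg A p.1 + bdeg A p.2)%N = n.

Record graded_qHopf (X : choiceType) (H : qhopf k X) : Prop := {
  qh_mul_graded : forall m n x y,
    homog H m x -> homog H n y -> homog H (m + n) (hmul H x y);
  qh_one_graded : homog H 0 (gone H);
  qh_copr_graded : forall n x, homog H n x -> homog2 H n (copr H x);
  qh_coun_graded : forall n x, homog H n x -> (0 < n)%N -> coun H x = 0;
  qh_connected : forall x, homog H 0 x -> exists! c : k, x = c *: gone H;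
  qh_mulA : forall x y z, hmul H x (hmul H y z) = hmul H (hmul H x y) z;
  qh_mul1x : forall x, hmul H (gone H) x = x;
  qh_mulx1 : forall x, hmul H x (gone H) = x;
  qh_coprA : forall x,
    tassoc (tmap (copr H) id (copr H x)) = tmap id (copr H) (copr H x);
  qh_counl : forall x,
    lext (fun p : X * X => bcoun H p.1 *: bas k p.2) (copr H x) = x;
  qh_counr : forall x,
    lext (fun p : X * X => bcoun H p.2 *: bas k p.1) (copr H x) = x;
  qh_copr_mul : forall x y,
    copr H (hmul H x y) = tmul H (copr H x) (copr H y)
}.

End QHopfTheory.

Record qhopf_morph (k : comPzRingType) (X Y : choiceType)
    (H : qhopf k X) (K : qhopf k Y)
    (f : freemod k X -> freemod k Y) : Prop := {
  qm_linear : linear f;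
  qm_graded : forall n x, homog H n x -> homog K n (f x);
  qm_mul : forall x y, f (hmul H x y) = hmul K (f x) (f y);
  qm_one : f (gone H) = gone K;
  qm_copr : forall x, copr K (f x) = tmap f f (copr H x);
  qm_coun : forall x, coun K (f x) = coun H x
}.

Definition qhopf_iso (k : comPzRingType) (X Y : choiceType)
    (H : qhopf k X) (K : qhopf k Y)
    (f : freemod k X -> freemod k Y) : Prop :=
  qhopf_morph H K f /\
  exists g, [/\ qhopf_morph K H g, cancel f g & cancel g f].

Section NSym.
Variables (k : comPzRingType) (q : k).

(* the basis vector [a] stands for H_a, and multiplication is concatenation *)
Definition NSym_alg : galg k composition := {|
  bdeg := fun a => sumn (val a);
  bmul := fun a b => bas k (comp_cat a b);
  gone := bas k comp0
|}.

Definition NSym_copr_gen (n : nat) : freemod k (composition * composition)%type :=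
  \sum_(i < n.+1) bas k (comp_part i, comp_part (n - i)).

Definition NSym : qhopf k composition := {|
  qalg := NSym_alg;
  bcopr := fun a => foldr (fun n z => tmul q NSym_alg (NSym_copr_gen n) z)
                          (bas k (comp0, comp0)) (val a);
  bcoun := fun a => (a == comp0)%:R
|}.

End NSym.

Section MR.
Variables (k : comPzRingType) (q : k).

Definition MR : qhopf k permword := {|
  qalg := {|
    bdeg := fun w => size (val w);
    bmul := fun w w' =>
      \sum_(x <- permwords (size (val w) + size (val w'))
           | (st (take (size (val w)) (val x)) == w) &&
             (st (drop (size (val w)) (val x)) == w')) bas k x;
    gone := bas k perm0
  |};
  bcopr := fun w => \sum_(i < (size (val w)).+1)
    q ^+ inv_at i (val w) *:
      bas k (perm_restr i w, st [seq x <- val w | (i < x)%N]);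
  bcoun := fun w => (w == perm0)%:R
|}.

Definition lcons (a : nat) : freemod k (seq nat) -> freemod k (seq nat) :=
  lext (fun u => bas k (a :: u)).

Fixpoint qshuffle (u : seq nat) : seq nat -> freemod k (seq nat) :=
  fix qshuffle_u (v : seq nat) : freemod k (seq nat) :=
    match u, v with
    | [::], _ => bas k v
    | _, [::] => bas k u
    | a :: u', b :: v' =>
        lcons a (qshuffle u' v) + q ^+ size u *: lcons b (qshuffle_u v')
    end.

(* In [bmul] all words of the q-shuffle are permutations of 1, ..., n + m, and
   the sum merely retypes it. *)
Definition MR' : qhopf k permword := {|
  qalg := {|
    bdeg := fun w => size (val w);
    bmul := fun w w' =>
      \sum_(x <- permwords (size (val w) + size (val w')))
        (qshuffle (val w) [seq (size (val w) + i)%N | i <- val w'])@_(val x)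
          *: bas k x;
    gone := bas k perm0
  |};
  bcopr := fun w => \sum_(i < (size (val w)).+1)
    bas k (st (take i (val w)), st (drop i (val w)));
  bcoun := fun w => (w == perm0)%:R
|}.

Definition c_tab (T : syt) : freemod k permword :=
  \sum_(w <- permwords (size (flatten (val T))) | Ptab (val w) == val T)
    q ^+ inversions (val w) *: bas k w.

(* The basis vector [T] of PR'_q stands for c_q(T). *)
Definition PR'_incl : freemod k syt -> freemod k permword := lext c_tab.

(* [PR] is the q-Hopf subalgebra of MR'_q spanned by the c_q(T); as the
   inclusion is injective, its operations are determined by those of MR'_q. *)
Definition is_PR' (PR : qhopf k syt) : Prop :=
  [/\ graded_qHopf q PR, qhopf_morph PR MR' PR'_incl & injective PR'_incl].

Definition theta : freemod k permword -> freemod k permword :=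
  lext (fun w => q ^+ inversions (val w) *: bas k (perm_inv w)).

Definition iota_map : freemod k composition -> freemod k permword :=
  lext (fun a =>
    \sum_(w <- permwords (sumn (val a)) | refine (perm_comp w) a) bas k w).

End MR.

Section QSym.
Variables (k : comPzRingType) (q : k).

(* A series in the noncommuting variables x_1, x_2, ... is given by its
   coefficients on words; the letter [i] of a word stands for x_(i+1). *)
Definition ncseries : Type := seq nat -> k.

Definition series_mul (f g : ncseries) : ncseries := fun u =>
  \sum_(i < (size u).+1) f (take i u) * g (drop i u).

(* Equality in A_q.  The relations x_i x_j = q x_j x_i preserve the multiset of
   letters of a word, so a series vanishes in A_q iff each of its
   multihomogeneous components, which are polynomials, is a combination of the
   u (x_i x_j - q x_j x_i) v. *)
Inductive Aq_rel : freemod k (seq nat) -> Prop :=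
| Aq_rel0 : Aq_rel 0
| Aq_relD (c : k) (i j : nat) (u v : seq nat) (x : freemod k (seq nat)) :
    (j < i)%N -> Aq_rel x ->
    Aq_rel (c *: (bas k (u ++ [:: i; j] ++ v) -
                  q *: bas k (u ++ [:: j; i] ++ v)) + x).

Definition component (f : ncseries) (s : seq nat) : freemod k (seq nat) :=
  \sum_(u <- permutations s) f u *: bas k u.

Definition Aq_eq (f g : ncseries) : Prop :=
  forall s, Aq_rel (component (fun u => f u - g u) s).

Definition block_word (a idx : seq nat) : seq nat :=
  flatten [seq nseq p.1 p.2 | p <- zip a idx].

Definition M_series (a : composition) : ncseries := fun u =>
  [&& size (undup u) == size (val a), sorted ltn (undup u)
    & u == block_word (val a) (undup u)]%:R.

Definition h_series (n : nat) : ncseries := fun u =>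
  ((size u == n) && sorted leq u)%:R.

(* the coefficient in A_q of the monomial with weakly increasing word [s]:
   a word u equals q^inversions(u) times its sorted rearrangement *)
Definition normal_coef (f : ncseries) (s : seq nat) : k :=
  \sum_(u <- permutations s) q ^+ inversions u * f u.

(* the expansion on the basis (M_a) of a homogeneous element of QSym_q of
   degree [n]: M_a is the only basis element containing x_1^(a_1)...x_r^(a_r) *)
Definition M_expand (n : nat) (f : ncseries) : freemod k composition :=
  \sum_(a <- comps n)
    normal_coef f (block_word (val a) (iota 0 (size (val a)))) *: bas k a.

(* the basis vector [a] stands for M_a *)
Definition QSym : qhopf k composition := {|
  qalg := {|
    bdeg := fun a => sumn (val a);
    bmul := fun a b => M_expand (sumn (val a) + sumn (val b))
                         (series_mul (M_series a) (M_series b));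
    gone := bas k comp0
  |};
  bcopr := fun a => \sum_(i < (size (val a)).+1)
    bas k (comp_take i a, comp_drop i a);
  bcoun := fun a => (a == comp0)%:R
|}.

Definition QSym_series (x : freemod k composition) : ncseries := fun u =>
  \sum_(a <- msupp x) x@_a * M_series a u.

Definition h_elt (n : nat) : freemod k composition := M_expand n (h_series n).

(* [QSym] is the subalgebra of A_q with basis (M_a), and [h_elt n] is h_n. *)
Definition QSym_in_Aq : Prop :=
  [/\ forall x y, Aq_eq (QSym_series x) (QSym_series y) -> x = y,
      Aq_eq (QSym_series (gone QSym)) (fun u => (u == [::])%:R),
      forall x y, Aq_eq (QSym_series (hmul QSym x y))
                        (series_mul (QSym_series x) (QSym_series y))
    & forall n, Aq_eq (QSym_series (h_elt n)) (h_series n)].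

Definition F_elt (a : composition) : freemod k composition :=
  \sum_(b <- comps (sumn (val a)) | refine a b) bas k b.

Definition pi' : freemod k permword -> freemod k composition :=
  lext (fun w => F_elt (perm_comp w)).

Inductive in_Sym : freemod k composition -> Prop :=
| in_Sym_h n : (0 < n)%N -> in_Sym (h_elt n)
| in_Sym_1 : in_Sym (gone QSym)
| in_Sym_lin c x y : in_Sym x -> in_Sym y -> in_Sym (c *: x + y)
| in_Sym_mul x y : in_Sym x -> in_Sym y -> in_Sym (hmul QSym x y).

Definition Sym : Type := {x : freemod k composition | in_Sym x}.

(* the algebra homomorphism mapping H_n to h_n *)
Definition phi_val : freemod k composition -> freemod k composition :=
  lext (fun a => foldr (fun n x => hmul QSym (h_elt n) x) (gone QSym) (val a)).

Fact in_Sym_phi x : in_Sym (phi_val x).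
Proof.
rewrite /phi_val /lext; elim: (enum_fset _) => [|a s IHs].
  rewrite big_nil -[0](addNr (gone QSym)) -scaleN1r.
  by apply: in_Sym_lin; apply: in_Sym_1.
rewrite big_cons; apply: in_Sym_lin IHs.
have := valP a; elim: (val a) => [|n t IHt] /=; first by move=> _; apply: in_Sym_1.
by case/andP=> n0 /IHt; apply: in_Sym_mul; apply: in_Sym_h.
Qed.

Definition phi (x : freemod k composition) : Sym := exist _ _ (in_Sym_phi x).
Definition Sym_incl (x : Sym) : freemod k composition := proj1_sig x.

End QSym.

(* Main.v *)
Require Import Defs.
From HB Require Import structures.
From mathcomp Require Import all_boot all_order all_algebra.
From mathcomp Require Import finmap.
From mathcomp.multinomials Require Import monalg.
From mathcomp Require Import zify.

(** Every structure is read off coefficients; [x@_w] is the coefficient of the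
    basis vector [w] in [x].

    In these terms the product of MR_q is the convolution
      (x * y)@_w = sum_i x@_(st (w_1 ... w_i)) y@_(st (w_(i+1) ... w_n)),
    the dual of the coproduct Delta', and the product of MR'_q is dual in the
    same way to Delta_q ([hmul_MR_coef], [hmul_MR'_coef]).  Inverting a
    permutation exchanges restriction to positions and restriction to letters,
    and the length is additive up to inv(i, w); hence theta_q is an isomorphism
    ([theta_morph]), and an axiom shared by MR_q and MR'_q may be checked on the
    side where it is easy.  Associativity is checked in MR_q and coassociativity
    in MR'_q.  The compatibility of product and coproduct is checked in MR'_q:
    standardization carries the q-shuffle of words to the product of MR'_q
    ([std_qshuffle]), and on words the compatibility is an induction
    ([deconcat_qshuffle]).

    The condition c(w) <= alpha says that w increases along each block of
    alpha ([refine_perm_comp]), and such conditions can be cut into a prefix and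
    a suffix; this makes iota_q multiplicative.  It is unitriangular for the
    permutations of [run_perm], so that its tensor powers are injective too, and
    NSym inherits all axioms from MR_q ([qHopf_of_injective]).

    In A_q a word u equals q^inversions(u) times its sorted rearrangement, so
    series are equal in A_q iff their normal coefficients agree ([Aq_eqP]).  The
    map sending x to the series with coefficients x@_(st u) turns the product of
    MR_q into the product of series, and in A_q the series of x is
    pi'_q (theta_q x) ([nc_pi'_theta]).  Therefore pi'_q is multiplicative, its
    surjectivity gives QSym_q all axioms, and the diagram of the forgetful map
    commutes because the series of the identity permutation is h_n.

    After division of the coefficient at w by q^l(w), the products of MR'_q no
    longer involve q, and the span of the c_q(T) consists of the elements whose
    rescaled coefficients are constant on the classes of P.  These are the Knuth
    classes ([PtabP]), which are stable under concatenation, monotone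
    relabelling and restriction to an interval of letters; so products and
    coproducts of the c_q(T) stay in the span ([plactic_mul], [plactic_copr]).
    The identity permutations are alone in their classes and generate the image
    of NSym, which gives j. *)

Set Implicit Arguments.
Unset Strict Implicit.
Unset Printing Implicit Defensive.

Import GRing.Theory.
Local Open Scope ring_scope.

(** * Free modules and their tensor products *)

Section FreeModuleTheory.
Variable k : comPzRingType.
Implicit Types (X Y Z : choiceType) (U V W : lmodType k).

Lemma fcoefD X (x y : freemod k X) i : (x + y)@_i = x@_i + y@_i.
Proof. exact: mcoeffD. Qed.

Lemma fcoef0 X i : (0 : freemod k X)@_i = 0.
Proof. exact: mcoeff0. Qed.

Lemma fcoefZ X c (x : freemod k X) i : (c *: x)@_i = c * x@_i.
Proof. exact: fscaleE. Qed.

Lemma fcoef_sum X I (s : seq I) (P : pred I) (F : I -> freemod k X) i :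
  (\sum_(j <- s | P j) F j)@_i = \sum_(j <- s | P j) (F j)@_i.
Proof. by apply: (big_morph (mcoeff i)); [exact: mcoeffD | exact: mcoeff0]. Qed.

Lemma fcoef_bas X (i j : X) : (bas k i)@_j = (i == j)%:R.
Proof. exact: mcoeffU. Qed.

Lemma fcoefP X (x y : freemod k X) : (forall i, x@_i = y@_i) -> x = y.
Proof. by move=> h; apply/malgP. Qed.

Lemma big_supp X V (x : freemod k X) (F : X -> V) (s : seq X) :
    uniq s -> {subset msupp x <= s} ->
  \sum_(i <- msupp x) x@_i *: F i = \sum_(i <- s) x@_i *: F i.
Proof.
move=> us sub; rewrite [RHS](bigID [in msupp x]) /= [X in _ + X]big1_seq ?addr0.
  rewrite -[RHS]big_filter; apply: perm_big; apply: uniq_perm => [||i].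
  - exact: fset_uniq.
  - exact: filter_uniq.
  rewrite mem_filter; case: (boolP (i \in msupp x)) => //= /sub.
  by move->.
by move=> i /andP[/mcoeff_outdom-> _]; rewrite scale0r.
Qed.

Lemma lextE X V (f : X -> V) (x : freemod k X) (s : seq X) :
    uniq s -> {subset msupp x <= s} ->
  lext f x = \sum_(i <- s) x@_i *: f i.
Proof. exact: big_supp. Qed.

Lemma lext_linear X V (f : X -> V) : linear (lext f).
Proof.
move=> c x y; pose s := undup (msupp (c *: x + y) ++ msupp x ++ msupp y).
have us : uniq s by apply: undup_uniq.
rewrite !(@lextE _ _ _ _ s us); do ?by move=> i; rewrite mem_undup !mem_cat => ->; rewrite ?orbT.
rewrite scaler_sumr -big_split /=; apply: eq_bigr => i _.
by rewrite fcoefD fcoefZ scalerDl scalerA.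
Qed.

Lemma lext_bas X V (f : X -> V) i : lext f (bas k i) = f i.
Proof.
rewrite (@lextE _ _ _ _ [:: i]) //.
  by rewrite big_seq1 fcoef_bas eqxx scale1r.
move=> j; rewrite -mcoeff_neq0 fcoef_bas inE (eq_sym j).
by case: (i =P j) => // _; rewrite eqxx.
Qed.

Section LinearFacts.
Variables (U V : lmodType k) (f : U -> V).
Hypothesis lf : linear f.

Lemma linD x y : f (x + y) = f x + f y.
Proof. by have := lf 1 x y; rewrite !scale1r. Qed.

Lemma lin0 : f 0 = 0.
Proof. by apply: (addrI (f 0)); rewrite addr0 -linD addr0. Qed.

Lemma linZ c x : f (c *: x) = c *: f x.
Proof. by have := lf c x 0; rewrite !addr0 lin0 addr0. Qed.

Lemma lin_sum I (s : seq I) (P : pred I) (F : I -> U) :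
  f (\sum_(i <- s | P i) F i) = \sum_(i <- s | P i) f (F i).
Proof. by apply: (big_morph f); [exact: linD | exact: lin0]. Qed.

End LinearFacts.

Lemma lin_lext X V (f : freemod k X -> V) : linear f ->
  forall x, f x = lext (fun i => f (bas k i)) x.
Proof.
move=> lf x; rewrite /lext -[RHS]/(\sum_(i <- msupp x) _).
have {1}-> : x = \sum_(i <- msupp x) x@_i *: bas k i.
  apply: fcoefP => j; rewrite fcoef_sum.
  have [jx|jx] := boolP (j \in msupp x).
    rewrite (big_rem j) //= fcoefZ fcoef_bas eqxx mulr1 big1_seq ?addr0 // => i.
    rewrite mem_rem_uniq ?fset_uniq // inE => /andP[_ /andP[ij _]].
    by rewrite fcoefZ fcoef_bas (negPf ij) mulr0.
  rewrite (mcoeff_outdom jx) big1_seq // => i /andP[_ ix].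
  rewrite fcoefZ fcoef_bas; case: eqP => [ij|_]; last by rewrite mulr0.
  by rewrite -ij ix in jx.
by rewrite (lin_sum lf); apply: eq_bigr => i _; rewrite (linZ lf).
Qed.

Lemma lin_eq X V (f g : freemod k X -> V) : linear f -> linear g ->
  (forall i, f (bas k i) = g (bas k i)) -> f =1 g.
Proof.
move=> lf lg fg x; rewrite (lin_lext lf) (lin_lext lg).
by apply: eq_bigr => i _; rewrite fg.
Qed.

(** Agreement is needed only on the support, so homogeneity of [x] can be used
    for the basis vectors. *)
Lemma lin_eq_supp X V (f g : freemod k X -> V) x : linear f -> linear g ->
  (forall i, i \in msupp x -> f (bas k i) = g (bas k i)) -> f x = g x.
Proof.
move=> lf lg fg; rewrite (lin_lext lf) (lin_lext lg).
by apply: eq_big_seq => i /fg->.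
Qed.

Lemma eq_lext X V (f g : X -> V) : f =1 g -> lext f =1 lext g.
Proof. by move=> fg x; apply: eq_bigr => i _; rewrite fg. Qed.

Lemma lext_coef X Y (f : X -> freemod k Y) x j :
  (lext f x)@_j = \sum_(i <- msupp x) x@_i * (f i)@_j.
Proof. by rewrite /lext fcoef_sum; apply: eq_bigr => i _; rewrite fcoefZ. Qed.

(** Evaluating a coefficient as a sum over the support lets every product and
    map below be compared term by term with its definition by [lext]. *)
Lemma sum_pick X (x : freemod k X) a (c : X -> k) :
  \sum_(i <- msupp x) x@_i * ((i == a)%:R * c i) = x@_a * c a.
Proof.
have [ax|ax] := boolP (a \in msupp x).
  rewrite (big_rem a) //= eqxx mul1r big1_seq ?addr0 // => i.
  rewrite mem_rem_uniq ?fset_uniq // inE => /andP[_ /andP[/negPf-> _]].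
  by rewrite mul0r mulr0.
rewrite (mcoeff_outdom ax) mul0r big1_seq // => i /andP[_ ix].
case: eqP => [ij|_]; last by rewrite mul0r mulr0.
by rewrite -ij ix in ax.
Qed.

Lemma lin_id U : linear (@id U).
Proof. by []. Qed.

Lemma lin_comp U V W (f : V -> W) (g : U -> V) :
  linear f -> linear g -> linear (fun x => f (g x)).
Proof. by move=> lf lg c x y; rewrite lg lf. Qed.

Lemma lin_scale U V (f : U -> V) c : linear f -> linear (fun x => c *: f x).
Proof. by move=> lf a x y; rewrite lf scalerDr !scalerA mulrC. Qed.

Lemma lin_add U V (f g : U -> V) :
  linear f -> linear g -> linear (fun x => f x + g x).
Proof. by move=> lf lg a x y; rewrite lf lg scalerDr addrACA. Qed.

Lemma lin_sumf U V I (s : seq I) (f : I -> U -> V) :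
  (forall i, linear (f i)) -> linear (fun x => \sum_(i <- s) f i x).
Proof.
move=> lf a x y; rewrite scaler_sumr -big_split /=.
by apply: eq_bigr => i _; rewrite lf.
Qed.

Lemma lext_linear_r X U V (f : X -> U -> V) (x : freemod k X) :
  (forall i, linear (f i)) -> linear (fun y => lext (fun i => f i y) x).
Proof. by move=> lf; apply: lin_sumf => i; apply: lin_scale. Qed.

Section Tensors.
Variables X Y : choiceType.
Implicit Types (x : freemod k X) (y : freemod k Y).

Lemma tens_coef x y p : (tens x y)@_p = x@_p.1 * y@_p.2.
Proof.
case: p => a b /=; rewrite lext_coef -[y@_b]mulr1.
rewrite -(sum_pick x a (fun=> y@_b * 1)); apply: eq_bigr => i _; congr (_ * _).
rewrite lext_coef -(sum_pick y b (fun=> 1)) big_distrr /=; apply: eq_bigr => j _.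
by rewrite fcoef_bas xpair_eqE mulr1; case: eqP; case: eqP; rewrite ?(mul0r, mul1r, mulr0, mulr1).
Qed.

Lemma tens_bas (i : X) (j : Y) : tens (bas k i) (bas k j) = bas k (i, j).
Proof.
by apply: fcoefP => -[a b]; rewrite tens_coef !fcoef_bas xpair_eqE -natrM mulnb.
Qed.

Lemma tens_linl y : linear (fun x : freemod k X => tens x y).
Proof. exact: lext_linear. Qed.

Lemma tens_linr x : linear (fun y : freemod k Y => tens x y).
Proof. by apply: lext_linear_r => i; apply: lext_linear. Qed.

End Tensors.

Section TensorMaps.
Variables X X' Y Y' : choiceType.
Variables (f : freemod k X -> freemod k X') (g : freemod k Y -> freemod k Y').

Lemma tmap_linear : linear (tmap f g).
Proof. exact: lext_linear. Qed.

Lemma tmap_bas p : tmap f g (bas k p) = tens (f (bas k p.1)) (g (bas k p.2)).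
Proof. exact: lext_bas. Qed.

Hypotheses (lf : linear f) (lg : linear g).

Lemma tmap_tens x y : tmap f g (tens x y) = tens (f x) (g y).
Proof.
move: x; apply: lin_eq => [||i].
- by apply: lin_comp tmap_linear _; apply: tens_linl.
- by apply: (lin_comp (tens_linl _)).
move: y; apply: lin_eq => [||j].
- by apply: lin_comp tmap_linear _; apply: tens_linr.
- by apply: (lin_comp (@tens_linr _ _ _)).
by rewrite tens_bas tmap_bas.
Qed.

End TensorMaps.

Lemma tmap_comp X X' X'' Y Y' Y''
    (f : freemod k X -> freemod k X') (g : freemod k Y -> freemod k Y')
    (f' : freemod k X' -> freemod k X'') (g' : freemod k Y' -> freemod k Y'') z :
  linear f' -> linear g' ->
  tmap f' g' (tmap f g z) = tmap (fun x => f' (f x)) (fun y => g' (g y)) z.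
Proof.
move=> lf' lg'; move: z; apply: lin_eq => [||p].
- by apply: lin_comp; apply: tmap_linear.
- exact: tmap_linear.
by rewrite !tmap_bas tmap_tens.
Qed.

Lemma eq_tmap X X' Y Y'
    (f f' : freemod k X -> freemod k X') (g g' : freemod k Y -> freemod k Y') z :
  f =1 f' -> g =1 g' -> tmap f g z = tmap f' g' z.
Proof. by move=> ff gg; apply: eq_lext => p; rewrite ff gg. Qed.

Lemma tmap_id X Y (z : freemod k (X * Y)%type) : tmap id id z = z.
Proof.
move: z; apply: lin_eq => [||[i j]]; [exact: tmap_linear | exact: lin_id |].
by rewrite tmap_bas tens_bas.
Qed.

Lemma tassoc_linear X Y Z : linear (@tassoc k X Y Z).
Proof. exact: lext_linear. Qed.

Lemma tassoc_tens X Y Z (x : freemod k X) (y : freemod k Y) (z : freemod k Z) :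
  tassoc (tens (tens x y) z) = tens x (tens y z).
Proof.
move: x; apply: lin_eq => [||i].
- apply: lin_comp (@tassoc_linear _ _ _) _.
  by apply: (lin_comp (tens_linl _)); apply: tens_linl.
- exact: tens_linl.
move: y; apply: lin_eq => [||j].
- apply: lin_comp (@tassoc_linear _ _ _) _.
  by apply: (lin_comp (tens_linl _)); apply: tens_linr.
- by apply: (lin_comp (@tens_linr _ _ _)); apply: tens_linl.
move: z; apply: lin_eq => [||l].
- by apply: lin_comp (@tassoc_linear _ _ _) _; apply: tens_linr.
- by apply: (lin_comp (@tens_linr _ _ _)); apply: tens_linr.
by rewrite !tens_bas /tassoc lext_bas.
Qed.

Lemma tassoc_tmap X Y Z X' Y' Z' (f : freemod k X -> freemod k X')
    (g : freemod k Y -> freemod k Y') (h : freemod k Z -> freemod k Z') z :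
  linear f -> linear g -> linear h ->
  tassoc (tmap (tmap f g) h z) = tmap f (tmap g h) (tassoc z).
Proof.
move=> lf lg lh; move: z; apply: lin_eq => [||[[a b] c]].
- by apply: (lin_comp (@tassoc_linear _ _ _)); apply: tmap_linear.
- by apply: (lin_comp (@tmap_linear _ _ _ _ _ _)); apply: tassoc_linear.
rewrite tmap_bas /= -[bas k (a, b)]tens_bas tmap_tens // tassoc_tens.
by rewrite [tassoc _]lext_bas tmap_bas /= -[bas k (b, c)]tens_bas tmap_tens.
Qed.

End FreeModuleTheory.

(** * Gradings, triangular maps and transport of the q-Hopf axioms *)

Section Grading.
Variable k : comPzRingType.
Implicit Types (X Y : choiceType).

Definition in_degree X (d : X -> nat) n (x : freemod k X) : Prop :=
  forall i, i \in msupp x -> d i = n.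

Lemma in_degreeP X (d : X -> nat) n (x : freemod k X) :
  in_degree d n x <-> forall i, d i <> n -> x@_i = 0.
Proof.
split=> [dx i di|dx i ix].
  by apply: mcoeff_outdom; apply/negP => /dx.
case: (eqVneq (d i) n) => // /eqP /dx /eqP.
by rewrite mcoeff_eq0 ix.
Qed.

Lemma in_degree0 X (d : X -> nat) n : in_degree d n (0 : freemod k X).
Proof. by apply/in_degreeP => i _; rewrite fcoef0. Qed.

Lemma in_degreeD X (d : X -> nat) n (x y : freemod k X) :
  in_degree d n x -> in_degree d n y -> in_degree d n (x + y).
Proof.
move/in_degreeP=> dx /in_degreeP dy; apply/in_degreeP => i di.
by rewrite fcoefD dx ?dy ?addr0.
Qed.

Lemma in_degreeZ X (d : X -> nat) n c (x : freemod k X) :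
  in_degree d n x -> in_degree d n (c *: x).
Proof.
by move/in_degreeP=> dx; apply/in_degreeP => i di; rewrite fcoefZ dx ?mulr0.
Qed.

Lemma in_degree_sum X (d : X -> nat) n (I : eqType) (s : seq I) (P : pred I)
    (F : I -> freemod k X) :
  (forall i, i \in s -> P i -> in_degree d n (F i)) ->
  in_degree d n (\sum_(i <- s | P i) F i).
Proof.
move=> dF; rewrite big_seq_cond; apply: big_ind => [|x y|i /andP[]].
- exact: in_degree0.
- exact: in_degreeD.
- exact: dF.
Qed.

Lemma in_degree_bas X (d : X -> nat) i : in_degree d (d i) (bas k i).
Proof.
apply/in_degreeP => j dj; rewrite fcoef_bas.
by case: eqP => // ij; rewrite ij in dj.
Qed.

Lemma in_degree_lext X Y (d : X -> nat) (e : Y -> nat) m n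
    (f : X -> freemod k Y) (x : freemod k X) :
  (forall i, d i = m -> in_degree e n (f i)) ->
  in_degree d m x -> in_degree e n (lext f x).
Proof.
move=> df dx; apply: in_degree_sum => i ix _.
by apply: in_degreeZ; apply/df/dx.
Qed.

Lemma in_degree_tens X Y (d : X -> nat) (e : Y -> nat) m n
    (x : freemod k X) (y : freemod k Y) :
  in_degree d m x -> in_degree e n y ->
  in_degree (fun p : X * Y => (d p.1 + e p.2)%N) (m + n) (tens x y).
Proof.
move/in_degreeP=> dx /in_degreeP dy; apply/in_degreeP => -[i j] /= dij.
rewrite tens_coef /=; case: (eqVneq (d i) m) => [di|/eqP/dx->]; last exact: mul0r.
by rewrite dy ?mulr0 // => ej; case: dij; rewrite di ej.
Qed.

(** [f] commutes with the projections on the homogeneous components, so an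
    injective [f] also reflects the degree. *)
Lemma in_degree_inj X Y (d : X -> nat) (e : Y -> nat) n
    (f : freemod k X -> freemod k Y) x :
  linear f -> (forall i, in_degree e (d i) (f (bas k i))) -> injective f ->
  in_degree e n (f x) -> in_degree d n x.
Proof.
move=> lf df injf efx.
pose pr (Z : choiceType) (g : Z -> nat) := lext (fun i : Z => (g i == n)%:R *: bas k i).
have prE (Z : choiceType) (g : Z -> nat) z i : (pr Z g z)@_i = (g i == n)%:R * z@_i.
  rewrite lext_coef [RHS]mulrC -(sum_pick z i (fun i => (g i == n)%:R)).
  by apply: eq_bigr => j _; rewrite fcoefZ fcoef_bas [_%:R * _]mulrC.
have fpr y : f (pr X d y) = pr Y e (f y).
  move: y; apply: lin_eq => [||i].
  - by apply: (lin_comp lf); apply: lext_linear.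
  - by apply: lin_comp lf; apply: lext_linear.
  rewrite /pr lext_bas (linZ lf); apply: fcoefP => j; rewrite prE fcoefZ.
  have [->|/eqP ij] := eqVneq (e j) (d i); first by [].
  have /in_degreeP dfi := df i.
  by rewrite (dfi _ ij) !mulr0.
have: pr X d x = x.
  apply: injf; rewrite fpr; apply: fcoefP => j; rewrite prE.
  case: (eqVneq (e j) n) => [_|/eqP ej]; first by rewrite mul1r.
  by move/in_degreeP: efx => /(_ _ ej) ->; rewrite mulr0.
move=> <-; apply/in_degreeP => i /eqP/negPf di.
by rewrite prE di mul0r.
Qed.

End Grading.

Section Triangular.
Variable k : comPzRingType.

(** An injectivity criterion that is stable under tensor products, unlike
    injectivity itself over an arbitrary ring. *)
Definition triangular (X Y : choiceType) (f : X -> freemod k Y)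
    (lead : X -> Y) (rk : X -> nat) : Prop :=
  (forall i, exists p, p * (f i)@_(lead i) = 1) /\
  (forall i j, (f i)@_(lead j) != 0 -> i = j \/ (rk j < rk i)%N).

(** In a nonzero kernel element, the coefficient at the leading term of a basis
    vector of maximal rank has a single contribution, and it is a unit multiple
    of a nonzero coefficient. *)
Lemma triangular_inj (X Y : choiceType) (f : X -> freemod k Y) lead rk :
  triangular f lead rk -> injective (lext f).
Proof.
case=> unit_f tri_f x y fxy; apply/eqP; rewrite -subr_eq0; apply/negPn/negP.
have: lext f (x - y) = 0.
  by rewrite -scaleN1r addrC (lext_linear f) scaleN1r fxy addNr.
move: (x - y) => z fz nz.
have [i0 iz0] : exists i, i \in msupp z.
  case: (fset_0Vmem (msupp z)) => [z0|[i iz]]; last by exists i.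
  by case/eqP: nz; apply: fcoefP => i; rewrite fcoef0 mcoeff_outdom // z0.
have [b bz maxb] : exists2 b, b \in msupp z & forall i, i \in msupp z -> (rk i <= rk b)%N.
  pose P n := [exists i : msupp z, rk (val i) == n].
  have exP : exists n, P n by exists (rk i0); apply/existsP; exists [` iz0]%fset.
  have ubP n : P n -> (n <= \max_(i : msupp z) rk (val i))%N.
    by case/existsP=> i /eqP<-; apply: leq_bigmax.
  case: (ex_maxnP exP ubP) => n /existsP[i /eqP<-] maxi.
  exists (val i) => [|j jz]; first exact: valP.
  by apply: maxi; apply/existsP; exists [` jz]%fset.
have := congr1 (mcoeff (lead b)) fz; rewrite lext_coef fcoef0 => /eqP.
rewrite (eq_big_seq (fun i => z@_i * ((i == b)%:R * (f b)@_(lead b)))) => [|i iz]; last first.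
  case: (i =P b) => [->|ib]; first by rewrite mul1r.
  have [->|/tri_f[//|]] := eqVneq ((f i)@_(lead b)) 0; first by rewrite mul0r.
  by rewrite ltnNge maxb.
rewrite (sum_pick z b (fun=> _)) => /eqP zb0.
have [p pf] := unit_f b.
have zb : z@_b = 0 by rewrite -[LHS]mulr1 -pf mulrCA zb0 mulr0.
by move: bz; rewrite -mcoeff_neq0 zb eqxx.
Qed.

Lemma triangular_tens (X Y X' Y' : choiceType) (f : X -> freemod k Y) (f' : X' -> freemod k Y')
    lead rk lead' rk' :
  triangular f lead rk -> triangular f' lead' rk' ->
  triangular (fun p : X * X' => tens (f p.1) (f' p.2))
    (fun p => (lead p.1, lead' p.2)) (fun p => (rk p.1 + rk' p.2)%N).
Proof.
move=> [uf tf] [uf' tf']; split=> [[i i']|[i i'] [j j']] /=; rewrite tens_coef /=.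
  have [[p pf] [p' pf']] := (uf i, uf' i').
  by exists (p * p'); rewrite mulrACA pf pf' mulr1.
move=> nz.
have /tf tij : (f i)@_(lead j) != 0.
  by apply: contraNneq nz => ->; rewrite mul0r.
have /tf' tij' : (f' i')@_(lead' j') != 0.
  by apply: contraNneq nz => ->; rewrite mulr0.
case: tij tij' => [->|lt] [->|lt']; [by left | right..]; lia.
Qed.

Lemma triangular_tmap_inj (X Y X' Y' : choiceType) (f : freemod k X -> freemod k Y)
    (f' : freemod k X' -> freemod k Y') lead rk lead' rk' :
  triangular (fun i => f (bas k i)) lead rk ->
  triangular (fun i => f' (bas k i)) lead' rk' -> injective (tmap f f').
Proof. by move=> tf tf'; apply: (triangular_inj (triangular_tens tf tf')). Qed.

Lemma triangular_tmap (X Y X' Y' : choiceType) (f : freemod k X -> freemod k Y)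
    (f' : freemod k X' -> freemod k Y') lead rk lead' rk' :
  triangular (fun i => f (bas k i)) lead rk ->
  triangular (fun i => f' (bas k i)) lead' rk' ->
  triangular (fun p => tmap f f' (bas k p)) (fun p => (lead p.1, lead' p.2))
    (fun p => (rk p.1 + rk' p.2)%N).
Proof.
move=> tf tf'; have [u t] := triangular_tens tf tf'.
by split=> [i|i j]; rewrite tmap_bas; [apply: u | apply: t].
Qed.

End Triangular.

Section QHopfLemmas.
Variables (k : comPzRingType) (q : k).
Implicit Types X Y : choiceType.

Section Algebra.
Variables (X : choiceType) (A : galg k X).

Lemma homog_lext Y (d : Y -> nat) m n (f : Y -> freemod k X) (x : freemod k Y) :
  (forall i, d i = m -> homog A n (f i)) ->
  in_degree d m x -> homog A n (lext f x).
Proof. exact: in_degree_lext. Qed.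

Lemma hmul_linl y : linear (fun x => hmul A x y).
Proof. exact: lext_linear. Qed.

Lemma hmul_linr x : linear (hmul A x).
Proof. by apply: lext_linear_r => i; apply: lext_linear. Qed.

Lemma hmul_bas i j : hmul A (bas k i) (bas k j) = bmul A i j.
Proof. by rewrite /hmul !lext_bas. Qed.

Lemma tmul_linl y : linear (fun x => tmul q A x y).
Proof. exact: lext_linear. Qed.

Lemma tmul_linr x : linear (tmul q A x).
Proof. by apply: lext_linear_r => i; apply: lext_linear. Qed.

Lemma tmul_bas p r : tmul q A (bas k p) (bas k r) =
  q ^+ (bdeg A p.2 * bdeg A r.1) *: tens (bmul A p.1 r.1) (bmul A p.2 r.2).
Proof. by rewrite /tmul !lext_bas. Qed.

(** The twist q^(|b||c|) only sees the inner factors, so only these have to be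
    homogeneous. *)
Lemma tmul_tens m n a b c d : homog A m b -> homog A n c ->
  tmul q A (tens a b) (tens c d) = q ^+ (m * n) *: tens (hmul A a c) (hmul A b d).
Proof.
move=> hb hc; move: a; apply: lin_eq => [||i].
- by apply: lin_comp (tmul_linl _) _; apply: tens_linl.
- by apply: lin_scale; apply: lin_comp (tens_linl _) (hmul_linl _).
move: d; apply: lin_eq => [||j].
- by apply: lin_comp (@tmul_linr _) _; apply: tens_linr.
- by apply: lin_scale; apply: (lin_comp (@tens_linr _ _ _ _)); apply: hmul_linr.
apply: (@lin_eq_supp _ _ _ (fun b => tmul q A (tens (bas k i) b) (tens c (bas k j)))
   (fun b => q ^+ (m * n) *: tens (hmul A (bas k i) c) (hmul A b (bas k j)))) => [||b' /hb <-].
- by apply: lin_comp (tmul_linl _) _; apply: tens_linr.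
- by apply: lin_scale; apply: (lin_comp (@tens_linr _ _ _ _)); apply: hmul_linl.
apply: (@lin_eq_supp _ _ _ (fun c => tmul q A _ (tens c (bas k j)))
   (fun c => q ^+ (bdeg A b' * n) *: tens (hmul A (bas k i) c) _)) => [||c' /hc <-].
- by apply: lin_comp (@tmul_linr _) _; apply: tens_linl.
- by apply: lin_scale; apply: lin_comp (tens_linl _) _; apply: hmul_linr.
by rewrite !tens_bas tmul_bas !hmul_bas.
Qed.

Lemma homog_hmul m n x y : (forall i j, homog A (bdeg A i + bdeg A j) (bmul A i j)) ->
  homog A m x -> homog A n y -> homog A (m + n) (hmul A x y).
Proof.
move=> hA hx hy; apply: (homog_lext (d := bdeg A) _ hx) => i <-.
by apply: (homog_lext (d := bdeg A) _ hy) => j <-.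
Qed.

End Algebra.

Section Coalgebra.
Variables (X : choiceType) (H : qhopf k X).

Lemma copr_linear : linear (copr H).
Proof. exact: lext_linear. Qed.

Lemma copr_bas i : copr H (bas k i) = bcopr H i.
Proof. exact: lext_bas. Qed.

Lemma coun_linear c x y : coun H (c *: x + y) = c * coun H x + coun H y.
Proof. exact: (@lext_linear k X k^o (bcoun H)). Qed.

Lemma coun_bas i : coun H (bas k i) = bcoun H i.
Proof. exact: (@lext_bas k X k^o (bcoun H)). Qed.

Lemma lin_coun_scale Y (y : freemod k Y) : linear (fun x => coun H x *: y).
Proof. by move=> c x x'; rewrite coun_linear scalerDl scalerA. Qed.

Lemma counl_tens Y (x : freemod k X) (y : freemod k Y) :
  lext (fun p : X * Y => bcoun H p.1 *: bas k p.2) (tens x y) = coun H x *: y.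
Proof.
move: x; apply: lin_eq => [||i].
- by apply: lin_comp (@lext_linear _ _ _ _) _; apply: tens_linl.
- exact: lin_coun_scale.
move: y; apply: lin_eq => [||j].
- by apply: lin_comp (@lext_linear _ _ _ _) _; apply: tens_linr.
- by apply: lin_scale; apply: lin_id.
by rewrite tens_bas lext_bas coun_bas.
Qed.

Lemma counr_tens Y (y : freemod k Y) (x : freemod k X) :
  lext (fun p : Y * X => bcoun H p.2 *: bas k p.1) (tens y x) = coun H x *: y.
Proof.
move: x; apply: lin_eq => [||i].
- by apply: lin_comp (@lext_linear _ _ _ _) _; apply: tens_linr.
- exact: lin_coun_scale.
move: y; apply: lin_eq => [||j].
- by apply: lin_comp (@lext_linear _ _ _ _) _; apply: tens_linl.
- by apply: lin_scale; apply: lin_id.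
by rewrite tens_bas lext_bas coun_bas.
Qed.

End Coalgebra.

Lemma coun_unit X (H : qhopf k X) i0 :
  (forall i, bcoun H i = (i == i0)%:R) -> forall x, coun H x = x@_i0.
Proof.
move=> e x; rewrite -[RHS]mulr1 -(sum_pick x i0 (fun=> 1)).
by apply: eq_bigr => i _; rewrite e mulr1.
Qed.

Lemma coun_unit_graded X (H : qhopf k X) i0 : bdeg H i0 = 0%N ->
  (forall i, bcoun H i = (i == i0)%:R) ->
  forall n x, homog H n x -> (0 < n)%N -> coun H x = 0.
Proof.
move=> d0 e n x /in_degreeP hx n0; rewrite (coun_unit e) hx // d0 => n00.
by rewrite -n00 in n0.
Qed.

Lemma connected_of_bas X (A : galg k X) i0 :
  (forall i, bdeg A i = 0 -> i = i0)%N -> gone A = bas k i0 ->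
  forall x, homog A 0 x -> exists! c : k, x = c *: gone A.
Proof.
move=> deg0 one x hx; exists x@_i0; split=> [|c ->]; last first.
  by rewrite one fcoefZ fcoef_bas eqxx mulr1.
rewrite one; apply: fcoefP => i; rewrite fcoefZ fcoef_bas.
case: eqP => [<-|ii0]; first by rewrite mulr1.
move/in_degreeP: hx => ->; first by rewrite mulr0.
by move/deg0 => ii; rewrite ii in ii0.
Qed.

Section Morphisms.
Variables (X Y : choiceType) (H : qhopf k X) (K : qhopf k Y).
Variable f : freemod k X -> freemod k Y.

(** Stated without the coproducts of [H] and [K], so that it is available while
    the compatibility of [f] with coproducts is still being proved. *)
Lemma tmap_tmul_of : linear f ->
  (forall i, homog K (bdeg H i) (f (bas k i))) ->
  (forall x y, f (hmul H x y) = hmul K (f x) (f y)) ->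
  forall y z, tmap f f (tmul q H y z) = tmul q K (tmap f f y) (tmap f f z).
Proof.
move=> lf df fM y z; move: y; apply: lin_eq => [||p].
- by apply: lin_comp (@tmap_linear _ _ _ _ _ _ _) _; apply: tmul_linl.
- by apply: lin_comp (tmul_linl _ _) _; apply: tmap_linear.
move: z; apply: lin_eq => [||r].
- by apply: lin_comp (@tmap_linear _ _ _ _ _ _ _) _; apply: tmul_linr.
- by apply: lin_comp (@tmul_linr _ _ _) _; apply: tmap_linear.
rewrite tmul_bas (linZ (@tmap_linear _ _ _ _ _ _ _)) tmap_tens // !tmap_bas.
rewrite (@tmul_tens _ K (bdeg H p.2) (bdeg H r.1)) //.
by rewrite -!fM !hmul_bas.
Qed.

Section OfMorphism.
Hypothesis mf : qhopf_morph H K f.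
Let lf : linear f := qm_linear mf.

Lemma qm_degree i : homog K (bdeg H i) (f (bas k i)).
Proof. by apply: (qm_graded mf); apply: in_degree_bas. Qed.

Lemma tmap_tmul y z :
  tmap f f (tmul q H y z) = tmul q K (tmap f f y) (tmap f f z).
Proof. exact: tmap_tmul_of (qm_linear mf) qm_degree (qm_mul mf) y z. Qed.

Lemma tmap_coassocl x :
  tmap f (tmap f f) (tassoc (tmap (copr H) id (copr H x))) =
  tassoc (tmap (copr K) id (copr K (f x))).
Proof.
rewrite -tassoc_tmap //; congr tassoc.
rewrite (qm_copr mf) !tmap_comp //; do ?exact: tmap_linear; do ?exact: copr_linear.
by apply: eq_tmap => y //; rewrite (qm_copr mf).
Qed.

Lemma tmap_coassocr x :
  tmap f (tmap f f) (tmap id (copr H) (copr H x)) =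
  tmap id (copr K) (copr K (f x)).
Proof.
rewrite (qm_copr mf) !tmap_comp //; do ?exact: tmap_linear; do ?exact: copr_linear.
by apply: eq_tmap => y //; rewrite (qm_copr mf).
Qed.

Lemma morph_counl x :
  lext (fun p : Y * Y => bcoun K p.1 *: bas k p.2) (copr K (f x)) =
  f (lext (fun p : X * X => bcoun H p.1 *: bas k p.2) (copr H x)).
Proof.
rewrite (qm_copr mf); move: (copr H x); apply: lin_eq => [||p].
- by apply: (lin_comp (@lext_linear _ _ _ _)); apply: tmap_linear.
- by apply: (lin_comp lf); apply: lext_linear.
by rewrite tmap_bas counl_tens (qm_coun mf) coun_bas lext_bas (linZ lf).
Qed.

Lemma morph_counr x :
  lext (fun p : Y * Y => bcoun K p.2 *: bas k p.1) (copr K (f x)) =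
  f (lext (fun p : X * X => bcoun H p.2 *: bas k p.1) (copr H x)).
Proof.
rewrite (qm_copr mf); move: (copr H x); apply: lin_eq => [||p].
- by apply: (lin_comp (@lext_linear _ _ _ _)); apply: tmap_linear.
- by apply: (lin_comp lf); apply: lext_linear.
by rewrite tmap_bas counr_tens (qm_coun mf) coun_bas lext_bas (linZ lf).
Qed.

(** Each axiom of [H] is an equation in [H], in its tensor square or in its
    tensor cube; after applying the tensor power of [f] it becomes the same
    axiom of [K], and triangularity makes these tensor powers injective. *)
Lemma qHopf_of_injective lead rk i0 :
  triangular (fun i => f (bas k i)) lead rk ->
  (forall i, bdeg H i = 0 -> i = i0)%N -> gone H = bas k i0 ->
  graded_qHopf q K -> graded_qHopf q H.
Proof.
move=> tri deg0 one hK.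
have injf : injective f.
  move=> x y; rewrite !(lin_lext lf); exact: (triangular_inj tri).
have injff : injective (tmap f f) by refine (@triangular_tmap_inj _ _ _ _ _ f f _ _ _ _ tri tri).
have injfff : injective (tmap f (tmap f f)).
  refine (@triangular_tmap_inj _ _ _ _ _ f _ _ _ _ _ tri _).
  exact: (@triangular_tmap _ _ _ _ _ f f _ _ _ _ tri tri).
split.
- move=> m n x y hx hy; apply: (in_degree_inj lf qm_degree injf).
  by rewrite (qm_mul mf); apply: (qh_mul_graded hK); apply: (qm_graded mf).
- apply: (in_degree_inj lf qm_degree injf).
  by rewrite (qm_one mf); apply: (qh_one_graded hK).
- move=> n x hx; apply: (in_degree_inj (@tmap_linear _ _ _ _ _ f f) _ injff (e := fun p => bdeg K p.1 + bdeg K p.2)%N).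
    move=> p; rewrite tmap_bas; apply: in_degree_tens; exact: qm_degree.
  by rewrite -(qm_copr mf); apply: (qh_copr_graded hK); apply: (qm_graded mf).
- move=> n x hx n0; rewrite -(qm_coun mf).
  by apply: (qh_coun_graded hK) n0; apply: (qm_graded mf).
- exact: (connected_of_bas deg0 one).
- by move=> x y z; apply: injf; rewrite !(qm_mul mf) (qh_mulA hK).
- by move=> x; apply: injf; rewrite (qm_mul mf) (qm_one mf) (qh_mul1x hK).
- by move=> x; apply: injf; rewrite (qm_mul mf) (qm_one mf) (qh_mulx1 hK).
- by move=> x; apply: injfff; rewrite tmap_coassocl tmap_coassocr (qh_coprA hK).
- by move=> x; apply: injf; rewrite -morph_counl (qh_counl hK).
- by move=> x; apply: injf; rewrite -morph_counr (qh_counr hK).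
- move=> x y; apply: injff.
  by rewrite tmap_tmul -!(qm_copr mf) (qm_mul mf) (qh_copr_mul hK).
Qed.

(** Equations pass to the image of [f]; gradings do not, hence the hypotheses on
    the basis of [K]. *)
Lemma qHopf_of_surjective j0 :
  (forall y, exists x, f x = y) ->
  (forall i j, homog K (bdeg K i + bdeg K j) (bmul K i j)) ->
  (forall i, homog2 K (bdeg K i) (bcopr K i)) ->
  bdeg K j0 = 0%N -> (forall j, bdeg K j = 0 -> j = j0)%N ->
  gone K = bas k j0 -> (forall j, bcoun K j = (j == j0)%:R) ->
  graded_qHopf q H -> graded_qHopf q K.
Proof.
move=> surj dM dC d0 deg0 one couE hH; split.
- by move=> m n x y; apply: homog_hmul.
- by rewrite one -d0; apply: in_degree_bas.
- by move=> n x hx; apply: in_degree_lext hx => j <-; apply: dC.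
- exact: coun_unit_graded d0 couE.
- exact: (connected_of_bas deg0 one).
- move=> x y z; have [[x' <-] [y' <-] [z' <-]] := And3 (surj x) (surj y) (surj z).
  by rewrite -!(qm_mul mf) (qh_mulA hH).
- by move=> x; have [x' <-] := surj x; rewrite -(qm_one mf) -(qm_mul mf) (qh_mul1x hH).
- by move=> x; have [x' <-] := surj x; rewrite -(qm_one mf) -(qm_mul mf) (qh_mulx1 hH).
- move=> x; have [x' <-] := surj x.
  by rewrite -tmap_coassocl -tmap_coassocr (qh_coprA hH).
- by move=> x; have [x' <-] := surj x; rewrite morph_counl (qh_counl hH).
- by move=> x; have [x' <-] := surj x; rewrite morph_counr (qh_counr hH).
- move=> x y; have [[x' <-] [y' <-]] := conj (surj x) (surj y).
  by rewrite -(qm_mul mf) !(qm_copr mf) (qh_copr_mul hH) tmap_tmul.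
Qed.

Lemma qhopf_iso_of_cancel g : cancel f g -> cancel g f -> linear g ->
  (forall j, homog H (bdeg K j) (g (bas k j))) -> qhopf_iso H K f.
Proof.
move=> fK gK lg hg; split=> //; exists g; split=> //; split=> //.
- move=> n y hy; rewrite (lin_lext lg).
  by apply: (homog_lext (d := bdeg K) _ hy) => j <-.
- by move=> x y; rewrite -{1}(gK x) -{1}(gK y) -(qm_mul mf) fK.
- by rewrite -(qm_one mf) fK.
- move=> y; rewrite -{2}(gK y) (qm_copr mf) tmap_comp //.
  by rewrite -[LHS]tmap_id; apply: eq_tmap => x; rewrite fK.
- by move=> y; rewrite -{2}(gK y) (qm_coun mf).
Qed.

End OfMorphism.

Lemma qhopf_morph_bas : linear f ->
  (forall i, homog K (bdeg H i) (f (bas k i))) ->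
  (forall i j, f (bmul H i j) = hmul K (f (bas k i)) (f (bas k j))) ->
  f (gone H) = gone K ->
  (forall i, copr K (f (bas k i)) = tmap f f (bcopr H i)) ->
  (forall i, coun K (f (bas k i)) = bcoun H i) ->
  qhopf_morph H K f.
Proof.
move=> lf df mf f1 cf ef; split=> //.
- move=> n x hx; rewrite (lin_lext lf).
  by apply: (homog_lext (d := bdeg H) _ hx) => i <-.
- move=> x y; move: x; apply: lin_eq => [||i].
  + by apply: (lin_comp lf); apply: hmul_linl.
  + by apply: lin_comp (hmul_linl _ _) lf.
  move: y; apply: lin_eq => [||j].
  + by apply: (lin_comp lf); apply: hmul_linr.
  + by apply: lin_comp (@hmul_linr _ _ _) lf.
  by rewrite hmul_bas mf.
- apply: lin_eq => [||i].
  + by apply: lin_comp lf; apply: copr_linear.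
  + by apply: (lin_comp (@tmap_linear _ _ _ _ _ _ _)); apply: copr_linear.
  by rewrite cf copr_bas.
- move=> x; rewrite -[LHS]/(idfun (coun K (f x) : k^o)); move: x.
  apply: (@lin_eq _ _ k^o) => [||i].
  + by move=> c x y; rewrite lf coun_linear.
  + by move=> c x y; rewrite coun_linear.
  by rewrite coun_bas -ef.
Qed.

End Morphisms.
End QHopfLemmas.

Section MorphismFactor.
Variable k : comPzRingType.

Lemma qhopf_morph_comp (X Y Z : choiceType) (H : qhopf k X) (K : qhopf k Y)
    (L : qhopf k Z) (f : freemod k X -> freemod k Y) (g : freemod k Y -> freemod k Z) :
  qhopf_morph H K f -> qhopf_morph K L g -> qhopf_morph H L (fun x => g (f x)).
Proof.
move=> mf mg; split.
- exact: lin_comp (qm_linear mg) (qm_linear mf).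
- by move=> n x hx; apply: (qm_graded mg); apply: (qm_graded mf).
- by move=> x y; rewrite (qm_mul mf) (qm_mul mg).
- by rewrite (qm_one mf) (qm_one mg).
- move=> x; rewrite (qm_copr mg) (qm_copr mf) tmap_comp //; exact: qm_linear mg.
- by move=> x; rewrite (qm_coun mg) (qm_coun mf).
Qed.

(** How the map j is obtained from its composition with the inclusion of a
    q-Hopf subalgebra. *)
Lemma qhopf_morph_factor (X Y Z : choiceType) (H : qhopf k X) (K : qhopf k Y)
    (L : qhopf k Z) (F : freemod k X -> freemod k Z) (g : freemod k Y -> freemod k Z)
    (j : freemod k X -> freemod k Y) lead rk :
  qhopf_morph K L g -> triangular (fun i => g (bas k i)) lead rk ->
  qhopf_morph H L F -> linear j -> (forall x, g (j x) = F x) ->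
  qhopf_morph H K j.
Proof.
move=> mg tri mF lj gj; have lg := qm_linear mg.
have injg : injective g.
  by move=> x y; rewrite !(lin_lext lg); exact: (triangular_inj tri).
have injgg : injective (tmap g g).
  by refine (@triangular_tmap_inj _ _ _ _ _ g g _ _ _ _ tri tri).
split=> //.
- move=> n x hx; apply: (in_degree_inj lg (qm_degree mg) injg).
  by rewrite gj; apply: (qm_graded mF).
- by move=> x y; apply: injg; rewrite (qm_mul mg) !gj (qm_mul mF).
- by apply: injg; rewrite gj (qm_one mF) (qm_one mg).
- move=> x; apply: injgg; rewrite -(qm_copr mg) gj (qm_copr mF) tmap_comp //.
  by apply: eq_tmap => y; rewrite gj.
- by move=> x; rewrite -(qm_coun mg) gj (qm_coun mF).
Qed.

End MorphismFactor.

(** * Standardization, inverses and inversions *)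

Section Standardization.
Local Open Scope nat_scope.
Implicit Types (u v w : seq nat).

(** Equal letters count as increasing from left to right, which is the
    convention of standardization: a word and its standardization have the same
    order in this sense. *)
Definition same_order u v : Prop :=
  size u = size v /\ forall i j, i < j < size u ->
    (nth 0 u i <= nth 0 u j) = (nth 0 v i <= nth 0 v j).

Lemma same_order_sym u v : same_order u v -> same_order v u.
Proof. by case=> suv ouv; split=> // i j; rewrite -suv => /ouv->. Qed.

Lemma same_order_take n u v : same_order u v -> same_order (take n u) (take n v).
Proof.
move=> [suv ouv]; split=> [|i j]; first by rewrite !size_take_min suv.
rewrite size_take_min => ij.
by rewrite !nth_take; try lia; rewrite ouv //; lia.
Qed.

Lemma same_order_drop n u v : same_order u v -> same_order (drop n u) (drop n v).
Proof.
move=> [suv ouv]; split=> [|i j]; first by rewrite !size_drop suv.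
by rewrite size_drop => ij; rewrite !nth_drop ouv //; lia.
Qed.

Lemma same_order_map (f : nat -> nat) u :
  {in u &, forall x y, (f x <= f y) = (x <= y)} -> same_order u (map f u).
Proof.
move=> hf; split=> [|i j /andP[ij ju]]; first by rewrite size_map.
have iu := ltn_trans ij ju.
by rewrite !(nth_map 0) // hf ?mem_nth.
Qed.

(** The rank of a position, counted by the earlier letters that are weakly
    smaller and the later ones that are strictly smaller; in this form it
    visibly depends only on the relative order. *)
Lemma st_at_split u i : i < size u -> st_at u i =
  (count (leq^~ (nth 0 u i)) (take i u) +
   count (ltn^~ (nth 0 u i)) (drop i.+1 u)).+1.
Proof.
move=> iu; set x := nth 0 u i.
have le_split v : count (leq^~ x) v = count (ltn^~ x) v + count_mem x v.
  by elim: v => //= y v ->; case: ltngtP => _ /=; lia.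
rewrite /st_at -/x -[X in count _ X](cat_take_drop i u).
rewrite count_cat (drop_nth 0) //= -/x.
by rewrite ltnn le_split /=; lia.
Qed.

Lemma eq_st u v : same_order u v -> st_seq u = st_seq v.
Proof.
case=> suv ouv; rewrite /st_seq suv; apply/eq_in_map => i.
rewrite mem_iota add0n => /= iv; have iu : i < size u by rewrite suv.
rewrite !st_at_split //; congr (_ + _).+1.
  rewrite -!(map_nth_iota0 0) ?(ltnW iu) ?(ltnW iv) // !count_map.
  by apply: eq_in_count => j; rewrite mem_iota /= => ji; apply: ouv; lia.
rewrite -[drop _ u]take_size -[drop _ v]take_size !size_drop suv.
rewrite -!(@map_nth_iota _ 0); try lia.
rewrite !count_map; apply: eq_in_count => j; rewrite mem_iota /= => ji.
by rewrite !ltnNge ouv //; lia.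
Qed.

Lemma same_order_st u : same_order u (st_seq u).
Proof.
split=> [|i j /andP[ij ju]]; first by rewrite size_map size_iota.
have iu : i < size u by exact: ltn_trans ju.
rewrite !(nth_map 0) ?size_iota ?nth_iota // !add0n.
case: (leqP (nth 0 u i) (nth 0 u j)) => le_u.
  apply/esym/ltnW/st_at_lt => //; rewrite ij andbT.
  by case: ltngtP le_u.
by apply/esym/negbTE; rewrite -ltnNge; apply: st_at_lt => //; rewrite le_u.
Qed.

Lemma perm_uniqP w : is_perm w -> uniq w.
Proof. by move=> pw; rewrite (perm_uniq pw) iota_uniq. Qed.

Lemma perm_memP w x : is_perm w -> (x \in w) = (0 < x <= size w).
Proof. by move=> pw; rewrite (perm_mem pw) mem_iota add1n ltnS. Qed.

Lemma mem_permword (w : permword) x :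
  (x \in val w) = (0 < x <= size (val w)).
Proof. exact: perm_memP (valP w). Qed.

Lemma uniq_permword (w : permword) : uniq (val w).
Proof. exact: perm_uniqP (valP w). Qed.

Lemma st_perm w : is_perm w -> st_seq w = w.
Proof.
move=> pw; apply: (@eq_from_nth _ 0) => [|i].
  by rewrite size_map size_iota.
rewrite size_map size_iota => iw.
rewrite (nth_map 0) ?size_iota // nth_iota // add0n.
have xw : nth 0 w i \in w by rewrite mem_nth.
move: (xw); rewrite perm_memP // => /andP[x0 xn].
rewrite /st_at (count_memPn _) ?addn0; last first.
  apply/negP => /(nthP 0)[j]; rewrite size_take_min => ji.
  rewrite nth_take; last by lia.
  by move/eqP; rewrite nth_uniq ?perm_uniqP //; lia.
rewrite (permP pw).
have -> : size w = (nth 0 w i).-1 + (size w - (nth 0 w i).-1) by lia.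
rewrite iotaD count_cat.
rewrite (eq_in_count (a2 := predT)) => [|j]; last by rewrite mem_iota /=; lia.
rewrite count_predT size_iota (eq_in_count (a2 := pred0)) => [|j]; last first.
  by rewrite mem_iota /=; lia.
by rewrite count_pred0 addn0; lia.
Qed.

(** The universal property from which all identities between standardizations
    below are derived. *)
Lemma stP u w : is_perm w -> (st_seq u = w <-> same_order u w).
Proof.
move=> pw; split=> [<-|/eq_st->]; [exact: same_order_st | exact: st_perm].
Qed.

Lemma size_st u : size (st_seq u) = size u.
Proof. by rewrite size_map size_iota. Qed.

Lemma eq_st_of u v : same_order u v -> st u = st v.
Proof. by move=> uv; apply/val_inj/eq_st. Qed.

Lemma st_val (w : permword) : st (val w) = w.
Proof. by apply/val_inj/st_perm/valP. Qed.

Lemma st_take_st n u : st (take n (val (st u))) = st (take n u).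
Proof. by apply/eq_st_of/same_order_take/same_order_sym/same_order_st. Qed.

Lemma st_drop_st n u : st (drop n (val (st u))) = st (drop n u).
Proof. by apply/eq_st_of/same_order_drop/same_order_sym/same_order_st. Qed.

Lemma inversions_same_order u v : same_order u v -> inversions u = inversions v.
Proof.
elim: u v => [|x u IHu] [|y v] [] //= [suv] ouv.
congr (_ + _); last first.
  apply: IHu; split=> // i j ij; apply: (ouv i.+1 j.+1); lia.
rewrite -(mkseq_nth 0 u) -(mkseq_nth 0 v) suv !count_map.
apply: eq_in_count => j; rewrite mem_iota /= => ju.
by rewrite !ltnNge (ouv 0 j.+1) //; lia.
Qed.

Lemma inversions_st u : inversions (st_seq u) = inversions u.
Proof. exact/esym/inversions_same_order/same_order_st. Qed.

(** The symmetric form of the length, in which positions and letters can be exchanged. *)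
Lemma inversions_nth u : inversions u =
  \sum_(i <- iota 0 (size u)) \sum_(j <- iota 0 (size u))
    ((i < j) && (nth 0 u j < nth 0 u i)).
Proof.
elim: u => [|x u IHu] /=; first by rewrite big_nil.
have e : iota 1 (size u) = map S (iota 0 (size u)).
  by rewrite -(addn0 1) iotaDl; apply: eq_map.
rewrite e big_cons big_cons /= add0n big_map IHu; congr (_ + _).
  rewrite -[in LHS](mkseq_nth 0 u) /mkseq count_map -sum1_count big_mkcond /=.
  by apply: eq_bigr => j _; case: ifP.
rewrite big_map; apply: eq_bigr => i _; rewrite big_cons /= add0n big_map.
by apply: eq_bigr.
Qed.

Lemma size_perm_inv (w : permword) : size (val (perm_inv w)) = size (val w).
Proof. by rewrite size_map size_iota. Qed.

Lemma nth_perm_inv (w : permword) i : i < size (val w) ->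
  nth 0 (val (perm_inv w)) i = (index i.+1 (val w)).+1.
Proof.
by move=> iw; rewrite /= (nth_map 0) ?size_iota // nth_iota // add1n.
Qed.

(** Reindexing the pairs of positions by the pairs of letters that they carry
    turns the inversions of [w] into those of its inverse. *)
Lemma inversions_perm_inv (w : permword) :
  inversions (val (perm_inv w)) = inversions (val w).
Proof.
have pw := valP w; set n := size (val w).
pose F a b := ((index a (val w) < index b (val w)) && (b < a) : nat).
have -> : inversions (val w) = \sum_(a <- iota 1 n) \sum_(b <- iota 1 n) F a b.
  rewrite inversions_nth -/n.
  transitivity (\sum_(a <- val w) \sum_(b <- val w) F a b); last first.
    by rewrite (perm_big _ pw); apply: eq_bigr => a _; rewrite (perm_big _ pw).
  rewrite -[in RHS](mkseq_nth 0 (val w)) /mkseq big_map; apply: eq_big_seq => i.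
  rewrite mem_iota => /= iw; rewrite big_map; apply: eq_big_seq => j.
  by rewrite mem_iota => /= jw; rewrite /F !index_uniq ?perm_uniqP.
have := @nth_perm_inv w; have := size_perm_inv w.
move: (perm_inv w) => v size_v nth_v.
rewrite inversions_nth size_v -/n exchange_big /=.
have e : iota 1 n = map S (iota 0 n).
  by rewrite -(addn0 1) iotaDl; apply: eq_map.
rewrite e big_map; apply: eq_big_seq => i; rewrite mem_iota add0n => /= iw.
rewrite big_map; apply: eq_big_seq => j; rewrite mem_iota add0n => /= jw.
by rewrite /F !nth_v // ltnS andbC.
Qed.

Lemma perm_invK : involutive perm_inv.
Proof.
move=> w; apply: val_inj; apply: (@eq_from_nth _ 0); rewrite !size_perm_inv //.
move=> i iw; rewrite nth_perm_inv ?size_perm_inv //.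
have xw : nth 0 (val w) i \in val w by rewrite mem_nth.
move: (xw); rewrite mem_permword => /andP[x0 xn].
have e : i.+1 = nth 0 (val (perm_inv w)) (nth 0 (val w) i).-1.
  rewrite nth_perm_inv; last by rewrite prednK.
  by rewrite prednK ?index_uniq ?uniq_permword.
rewrite e index_uniq ?size_perm_inv ?uniq_permword //; by rewrite prednK.
Qed.

Lemma index_filter_le (p : pred nat) w a b : uniq w -> p a -> p b ->
    a \in w -> b \in w ->
  (index a (filter p w) <= index b (filter p w)) = (index a w <= index b w).
Proof.
move=> + pa pb; elim: w => //= x w IHw /andP[xw uw].
rewrite !inE; have [->|xa] := eqVneq x a; first by rewrite pa /= eqxx.
have [xb|xb] := eqVneq x b; first by rewrite xb pb /= eqxx -xb (negPf xa).
move=> /= aw bw.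
by case: ifP => _ /=; rewrite ?(negPf xa) ?(negPf xb) ?ltnS IHw.
Qed.

Lemma perm_restrE i (w : permword) :
  val (perm_restr i w) = [seq x <- val w | x <= i].
Proof. by []. Qed.

Lemma stE u : val (st u) = st_seq u.
Proof. by []. Qed.

Lemma size_perm_restr i (w : permword) : i <= size (val w) ->
  size (val (perm_restr i w)) = i.
Proof.
move=> iw; rewrite perm_restrE size_filter (permP (valP w)).
have -> : size (val w) = i + (size (val w) - i) by lia.
rewrite iotaD count_cat (eq_in_count (a2 := predT)) => [|j]; last first.
  by rewrite mem_iota /=; lia.
rewrite count_predT size_iota (eq_in_count (a2 := pred0)) => [|j]; last first.
  by rewrite mem_iota /=; lia.
by rewrite count_pred0 addn0.
Qed.

(** The inverse permutation lists the positions of the letters 1, 2, ...; its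
    first [i] entries only concern the letters at most [i]. *)
Lemma perm_inv_restr i (w : permword) : i <= size (val w) ->
  perm_inv (perm_restr i w) = st (take i (val (perm_inv w))).
Proof.
move=> iw; apply/val_inj/esym/stP; first exact: valP.
have sz := size_perm_restr iw.
split=> [|a b]; first by rewrite size_takel !size_perm_inv ?sz.
rewrite size_takel ?size_perm_inv // => ab.
rewrite !nth_take; try lia.
rewrite !nth_perm_inv ?sz; try lia.
rewrite !ltnS index_filter_le ?uniq_permword ?mem_permword //.
all: clear -ab iw; case: w ab iw => w pw /= ab iw; lia.
Qed.

Lemma st_restr_gt i (w : permword) :
  st_seq [seq x <- val w | i < x] = [seq x - i | x <- val w & i < x].
Proof.
apply/stP; last first.
  by apply: same_order_map => x y; rewrite !mem_filter; lia.
have uw := uniq_permword w.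
apply: is_permP => [|x].
  rewrite map_inj_in_uniq ?filter_uniq // => x y.
  by rewrite !mem_filter => /andP[ix _] /andP[iy _]; lia.
case/mapP=> y; rewrite mem_filter mem_permword => /and3P[iy y0 yw] ->.
rewrite size_map size_filter (permP (valP w)).
have -> : size (val w) = i + (size (val w) - i) by lia.
rewrite iotaD count_cat [X in _ <= _ + X](eq_in_count (a2 := predT)) => [|j]; last first.
  by rewrite mem_iota /=; lia.
by rewrite count_predT size_iota; lia.
Qed.

Lemma size_restr_gt i (w : permword) : i <= size (val w) ->
  size [seq x <- val w | i < x] = size (val w) - i.
Proof.
move=> iw; have := size_perm_restr iw; rewrite perm_restrE !size_filter.
have -> : count (leq i.+1) (val w) = count (predC (leq^~ i)) (val w).
  by apply: eq_count => x /=; lia.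
have := count_predC (leq^~ i) (val w).
by case: w iw => w pw /= iw; lia.
Qed.

Lemma perm_inv_restr_gt i (w : permword) : i <= size (val w) ->
  perm_inv (st [seq x <- val w | i < x]) = st (drop i (val (perm_inv w))).
Proof.
move=> iw; apply/val_inj/esym/stP; first exact: valP.
have sz := size_restr_gt iw.
split=> [|a b]; first by rewrite size_drop !size_perm_inv stE size_st sz.
rewrite size_drop size_perm_inv => ab.
rewrite !nth_drop !nth_perm_inv ?stE ?size_st ?sz; try lia.
rewrite st_restr_gt !ltnS.
have idx x : index x.+1 [seq y - i | y <- val w & i < y] =
    index (i + x).+1 [seq y <- val w | i < y].
  have : all (fun y => i < y) [seq y <- val w | i < y] by apply: filter_all.
  elim: [seq y <- val w | i < y] => //= y s IHs /andP[iy /IHs->].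
  by congr (if _ then _ else _); lia.
rewrite !idx index_filter_le ?uniq_permword ?mem_permword //.
all: clear -ab iw; case: w ab iw => w pw /= ab iw; lia.
Qed.

(** An inversion lies among the small letters, among the large letters, or
    between a large letter and a later small one. *)
Lemma inversions_restr i u : inversions u =
  inversions [seq x <- u | x <= i] + inversions [seq x <- u | i < x] + inv_at i u.
Proof.
elim: u => //= x u ->; rewrite ltnNge; case: (leqP x i) => xi /=.
  rewrite mul0n add0n !addnA; do 2 congr (_ + _); congr (_ + _).
  by rewrite count_filter; apply: eq_count => y /=; lia.
rewrite mul1n count_filter.
have -> : count (fun y => y < x) u =
    count (fun y => y <= i) u + count (predI (fun y => y < x) (fun y => i < y)) u.
  by elim: u => //= y u ->; lia.
lia.
Qed.

End Standardization.

(** * The products of MR and MR' on coefficients *)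

Section Sums.

(** The reindexing common to associativity of convolution and coassociativity of
    deconcatenation. *)
Lemma triangle_sum (V : nmodType) n (F : nat -> nat -> V) :
  \sum_(i < n.+1) \sum_(j < i.+1) F j i =
  \sum_(j < n.+1) \sum_(l < (n - j).+1) F j (l + j)%N.
Proof.
elim: n => [|n IHn]; first by rewrite !big_ord1.
rewrite big_ord_recr /= IHn [RHS]big_ord_recr /= subnn big_ord1.
rewrite add0n [X in _ + X]big_ord_recr /= addrA -big_split /=; congr (_ + _).
apply: eq_bigr => j _; have jn := ltn_ord j.
rewrite subSn; last by rewrite -ltnS.
by rewrite [RHS]big_ord_recr /= addSn subnK // -ltnS.
Qed.

Lemma sum_pick_ord (V : nmodType) N m (F : nat -> V) :
  (forall i, (i <= N)%N -> i != m -> F i = 0) ->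
  \sum_(i < N.+1) F i = if (m <= N)%N then F m else 0.
Proof.
move=> F0; case: leqP => mN.
  have mN' : (m < N.+1)%N by [].
  rewrite (bigD1 (Ordinal mN')) //= big1 ?addr0 // => i im.
  by apply: F0; first by rewrite -ltnS.
apply: big1 => i _; apply: F0; first by rewrite -ltnS.
by rewrite neq_ltn (leq_trans (ltn_ord i)).
Qed.

Variable k : comPzRingType.

Lemma coef_big_bas (X : choiceType) (s : seq X) (P : pred X) (c : X -> k) z :
  uniq s ->
  (\sum_(x <- s | P x) c x *: bas k x)@_z = ((z \in s) && P z)%:R * c z.
Proof.
move=> us; rewrite fcoef_sum; case: (boolP (z \in s)) => zs /=; last first.
  rewrite mul0r big1_seq // => x /andP[_ xs].
  rewrite fcoefZ fcoef_bas; case: eqP => [xz|_]; last by rewrite mulr0.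
  by rewrite -xz xs in zs.
rewrite big_mkcond (big_rem z) //= big1_seq ?addr0 => [|x].
  by case: (P z); rewrite ?mul0r // fcoefZ fcoef_bas eqxx mulr1 mul1r.
rewrite mem_rem_uniq // inE => /andP[_ /andP[/negPf xz _]].
by case: (P x) => //; rewrite fcoefZ fcoef_bas xz mulr0.
Qed.

(** A product whose structure constants are sums over factorizations of [z] is a
    convolution. *)
Lemma hmul_coef (X : choiceType) (A : galg k X) z (I : Type) (r : seq I)
    (c : I -> k) (a b : I -> X) :
  (forall i j, (bmul A i j)@_z =
     \sum_(l <- r) c l * ((i == a l)%:R * (j == b l)%:R)) ->
  forall x y, (hmul A x y)@_z = \sum_(l <- r) c l * (x@_(a l) * y@_(b l)).
Proof.
move=> hA x y; move: x; apply: (@lin_eq _ _ k^o) => [||i].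
- by move=> d x x'; rewrite (hmul_linl A y d x x') fcoefD fcoefZ.
- move=> d x x'; rewrite [X in _ = X + _]big_distrr -big_split /=.
  by apply: eq_bigr => l _; rewrite fcoefD fcoefZ mulrDl mulrDr -mulrA mulrCA.
move: y; apply: (@lin_eq _ _ k^o) => [||j].
- by move=> d x x'; rewrite (hmul_linr A _ d x x') fcoefD fcoefZ.
- move=> d x x'; rewrite [X in _ = X + _]big_distrr -big_split /=.
  apply: eq_bigr => l _; rewrite fcoefD fcoefZ !mulrDr; congr (_ + _).
  by rewrite ![_ * (d * _)]mulrCA.
by rewrite hmul_bas hA; apply: eq_bigr => l _; rewrite !fcoef_bas.
Qed.

End Sums.

Section MalvenutoReutenauer.
Variables (k : comPzRingType) (q : k).

Lemma mem_permwords n w : (w \in permwords n) = (size (val w) == n).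
Proof.
rewrite mem_pmap_sub mem_permutations; apply/idP/eqP => [/perm_size->|<-].
  by rewrite size_iota.
exact: valP w.
Qed.

Lemma permwords_uniq n : uniq (permwords n).
Proof. by rewrite pmap_sub_uniq // permutations_uniq. Qed.

Lemma size_eq0_perm0 (w : permword) : (w == perm0) = (size (val w) == 0%N).
Proof. by rewrite -val_eqE /= size_eq0. Qed.

Section ProductMR.

Lemma bmul_MR_coef w w' z : (bmul (MR q) w w')@_z =
  \sum_(i < (size (val z)).+1)
    1 * ((w == st (take i (val z)))%:R * (w' == st (drop i (val z)))%:R).
Proof.
rewrite -[LHS]/((\sum_(x <- permwords _ | _) bas k x)@_z).
under eq_bigr do rewrite -[bas k _]scale1r.
rewrite coef_big_bas ?permwords_uniq // mem_permwords mulr1.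
rewrite (sum_pick_ord (m := size (val w))
  (F := fun i => 1 * ((w == st (take i (val z)))%:R * (w' == st (drop i (val z)))%:R))).
  rewrite mul1r -natrM mulnb ![_ == st _]eq_sym; case: leqP => wz.
    case: (_ == w); rewrite ?andbF //=.
    case: (st (drop _ _) =P w') => [<-|]; rewrite ?andbF // andbT.
    by rewrite stE size_st size_drop subnKC ?eqxx.
  by case: eqP => // sz; move: wz; rewrite sz ltnNge leq_addr.
move=> i iz /eqP iw; case: eqP => [e|_]; last by rewrite mul0r mulr0.
by case: iw; rewrite e stE size_st size_takel.
Qed.

Lemma hmul_MR_coef x y z : (hmul (MR q) x y)@_z =
  \sum_(i < (size (val z)).+1)
    x@_(st (take i (val z))) * y@_(st (drop i (val z))).
Proof.
rewrite (hmul_coef (fun w w' => bmul_MR_coef w w' z)).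
by apply: eq_bigr => i _; rewrite mul1r.
Qed.

Lemma hmul_MR_assoc x y z :
  hmul (MR q) x (hmul (MR q) y z) = hmul (MR q) (hmul (MR q) x y) z.
Proof.
apply: fcoefP => w; rewrite !hmul_MR_coef.
set u := val w; set n := size u.
transitivity (\sum_(j < n.+1) \sum_(l < (n - j).+1)
   x@_(st (take j u)) * y@_(st (drop j (take (l + j) u))) * z@_(st (drop (l + j) u))).
  apply: eq_bigr => j _; rewrite hmul_MR_coef big_distrr stE size_st size_drop.
  apply: eq_bigr => l _.
  by rewrite -stE st_take_st st_drop_st drop_drop take_drop /= mulrA.
rewrite -(triangle_sum n (fun j i => x@_(st (take j u)) *
  y@_(st (drop j (take i u))) * z@_(st (drop i u)))).
apply: eq_bigr => i _; rewrite hmul_MR_coef big_distrl.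
have iu : (i <= size u)%N by rewrite -ltnS.
rewrite stE size_st size_takel //; apply: eq_bigr => j _.
have ji : (j <= i)%N by rewrite -ltnS.
by rewrite -stE st_take_st st_drop_st take_takel.
Qed.

Lemma st_nil : st [::] = perm0. Proof. exact: val_inj. Qed.

Lemma hmul_MR_1l x : hmul (MR q) (bas k perm0) x = x.
Proof.
apply: fcoefP => w; rewrite hmul_MR_coef.
rewrite (sum_pick_ord (m := 0%N) (F := fun i =>
  (bas k perm0)@_(st (take i (val w))) * x@_(st (drop i (val w))))).
  by rewrite take0 drop0 st_nil st_val fcoef_bas eqxx mul1r.
move=> i iw i0; rewrite fcoef_bas eq_sym size_eq0_perm0 stE.
by rewrite size_st size_takel // (negPf i0) mul0r.
Qed.

Lemma hmul_MR_1r x : hmul (MR q) x (bas k perm0) = x.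
Proof.
apply: fcoefP => w; rewrite hmul_MR_coef.
rewrite (sum_pick_ord (m := size (val w)) (F := fun i =>
  x@_(st (take i (val w))) * (bas k perm0)@_(st (drop i (val w))))).
  by rewrite leqnn take_size drop_size st_nil st_val fcoef_bas eqxx mulr1.
move=> i iw i0; rewrite fcoef_bas eq_sym size_eq0_perm0 stE.
rewrite size_st size_drop; case: eqP => [e|_]; last by rewrite mulr0.
by case/eqP: i0; apply/eqP; rewrite eqn_leq iw /= -subn_eq0 e.
Qed.

End ProductMR.

Section ProductMR'.

Lemma lcons_linear a : linear (@lcons k a).
Proof. exact: lext_linear. Qed.

Lemma lcons_bas a u : @lcons k a (bas k u) = bas k (a :: u).
Proof. exact: lext_bas. Qed.

Lemma lcons_coef a (y : freemod k (seq nat)) c x : (lcons a y)@_(c :: x) = (a == c)%:R * y@_x.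
Proof.
rewrite lext_coef mulrC -(sum_pick y x (fun=> (a == c)%:R)).
by apply: eq_bigr => u _; rewrite fcoef_bas eqseq_cons andbC -mulnb natrM.
Qed.

Lemma lcons_coef_nil a y : (@lcons k a y)@_[::] = 0.
Proof.
by rewrite lext_coef big1 // => u _; rewrite fcoef_bas mulr0.
Qed.

Lemma qshuffle_nil v : qshuffle q [::] v = bas k v.
Proof. by case: v. Qed.

Lemma qshuffle0 u : qshuffle q u [::] = bas k u.
Proof. by case: u. Qed.

Lemma qshuffle_cons a u b v : qshuffle q (a :: u) (b :: v) =
  lcons a (qshuffle q u (b :: v)) +
  q ^+ (size u).+1 *: lcons b (qshuffle q (a :: u) v).
Proof. by []. Qed.

Lemma inv_at_le n x : all (fun y => y <= n)%N x -> inv_at n x = 0%N.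
Proof.
by elim: x => //= y x IHx /andP[yn /IHx->]; rewrite ltnNge yn.
Qed.

Lemma inv_at_gt n x : all (leq n.+1) x -> inv_at n x = 0%N.
Proof.
elim: x => //= y x IHx /andP[yn xn]; rewrite IHx // addn0.
rewrite (@eq_in_count _ _ pred0) ?count_pred0 ?muln0 // => z zx /=.
by apply/negbTE; rewrite -ltnNge; move/allP: xn; apply.
Qed.

(** A word is a shuffle of [u] and [v] in at most one way when [u] and [v] have
    disjoint alphabets, and a letter of [v] moved to the front passes all
    remaining letters of [u]. *)
Lemma qshuffle_coef n u v x : all (fun y => y <= n)%N u -> all (leq n.+1) v ->
  (qshuffle q u v)@_x =
  q ^+ inv_at n x * (([seq y <- x | (y <= n)%N] == u) &&
                     ([seq y <- x | (n < y)%N] == v))%:R.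
Proof.
have filt_le y s : [seq y <- s | (y <= n)%N] = [::] -> y \in s -> (n < y)%N.
  move=> /eqP; rewrite -[_ == _]negbK -has_filter => /hasPn h /h.
  by rewrite -ltnNge.
have filt_gt y s : [seq y <- s | (n < y)%N] = [::] -> y \in s -> (y <= n)%N.
  move=> /eqP; rewrite -[_ == _]negbK -has_filter => /hasPn h /h.
  by rewrite -leqNgt.
elim: x u v => [|c x IHx] u v un vn.
  rewrite mul1r; case: u un => [|a u] un.
    by rewrite qshuffle_nil fcoef_bas eq_sym.
  case: v vn => [|b v] vn; first by rewrite fcoef_bas.
  by rewrite fcoefD fcoefZ !lcons_coef_nil mulr0 addr0.
case: u un => [|a u] un.
  rewrite qshuffle_nil fcoef_bas.
  case: (v =P c :: x) => [e|ne].
    rewrite -e inv_at_gt // mul1r (all_filterP vn) eqxx andbT.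
    rewrite -[_ == _]negbK -has_filter -all_predC.
    by rewrite (eq_all (a2 := leq n.+1)) ?vn // => y /=; rewrite -ltnNge.
  case: eqP => [e|]; last by rewrite mulr0.
  case: eqP => [e'|]; last by rewrite mulr0.
  case: ne; rewrite -e'; apply/all_filterP/allP => y; exact: filt_le.
case: v vn => [|b v] vn.
  rewrite qshuffle0 fcoef_bas.
  case: (a :: u =P c :: x) => [e|ne].
    rewrite -e inv_at_le // mul1r (all_filterP un) eqxx.
    rewrite -[_ == [::]]negbK -has_filter -all_predC.
    by rewrite (eq_all (a2 := fun y => y <= n)%N) ?un // => y /=; rewrite -leqNgt.
  case: eqP => [e|]; last by rewrite mulr0.
  case: eqP => [e'|]; last by rewrite mulr0.
  case: ne; rewrite -e; apply/all_filterP/allP => y; exact: filt_gt.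
move: (un) (vn) => /andP[an un'] /andP[bn vn'].
rewrite qshuffle_cons fcoefD fcoefZ !lcons_coef !IHx //=.
rewrite ltnNge; case: (leqP c n) => cn /=.
  have /negPf-> : b != c by rewrite neq_ltn (leq_ltn_trans cn bn) orbT.
  rewrite mul0r mulr0 addr0 mul0n add0n eqseq_cons eq_sym.
  by case: (c == a); rewrite ?mul1r ?mul0r ?mulr0.
have /negPf-> : a != c by rewrite neq_ltn (leq_ltn_trans an cn).
rewrite mul0r add0r mul1n eqseq_cons [c == b]eq_sym exprD -mulrA.
case: (b == c); rewrite ?andbF ?mul0r ?mulr0 ?mul1r //= -size_filter.
case: eqP => [->|_] //=; by rewrite !mulr0.
Qed.

(** The structure constants are those of the coproduct of MR, with the two
    tensor factors as indices. *)
Lemma bmul_MR'_coef w w' z : (bmul (MR' q) w w')@_z =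
  \sum_(i < (size (val z)).+1) q ^+ inv_at i (val z) *
    ((w == perm_restr i z)%:R * (w' == st [seq x <- val z | (i < x)%N])%:R).
Proof.
rewrite -[LHS]/((\sum_(x <- permwords _) _ *: bas k x)@_z).
rewrite (coef_big_bas _ (fun x : permword => (qshuffle q (val w)
  [seq (size (val w) + i)%N | i <- val w'])@_(val x))) ?permwords_uniq //.
rewrite mem_permwords andbT.
rewrite (@qshuffle_coef (size (val w))); first last.
- by apply/allP => x /mapP[y]; rewrite mem_permword => /andP[y0 _] ->; lia.
- by apply/allP => x; rewrite mem_permword => /andP[].
rewrite (sum_pick_ord (m := size (val w)) (F := fun i => q ^+ inv_at i (val z) *
    ((w == perm_restr i z)%:R * (w' == st [seq x <- val z | (i < x)%N])%:R))).
  rewrite -val_eqE -[w' == _]val_eqE stE st_restr_gt.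
  rewrite perm_restrE ![val _ == _]eq_sym -[_%:R * _ in RHS]natrM mulnb.
  case: leqP => wz.
    rewrite mulrCA; congr (_ * _); rewrite -natrM mulnb.
    have [e|//] := eqVneq [seq y <- val z | (y <= size (val w))%N] (val w); rewrite ?andbF //=.
    have -> : (size (val z) == size (val w) + size (val w'))%N =
       (size [seq x <- val z | (size (val w) < x)%N] == size (val w')).
      by rewrite size_restr_gt // -[RHS](eqn_add2l (size (val w))) subnKC.
    have -> : ([seq y <- val z | (size (val w) < y)%N] ==
        [seq (size (val w) + i)%N | i <- val w']) =
       ([seq x - size (val w) | x <- val z & (size (val w) < x)%N] == val w')%N.
      have : all (fun y => size (val w) < y)%N [seq y <- val z | (size (val w) < y)%N].
        exact: filter_all.
      elim: [seq y <- val z | _] (val w') => [|y s IHs] [|y' s'] //= /andP[yn /IHs e'].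
      rewrite !eqseq_cons e'; congr (_ && _); apply/eqP/eqP; lia.
    case: eqP => [//|ne]; case: eqP => [e'|//].
    by case: ne; rewrite -[size (val w')](congr1 size e') size_map.
  case: eqP => [e|_]; last by rewrite mul0r.
  by move: wz; rewrite e ltnNge leq_addr.
move=> i iz /eqP iw; case: eqP => [e|_]; last by rewrite mul0r mulr0.
by case: iw; rewrite e size_perm_restr.
Qed.

Lemma hmul_MR'_coef x y z : (hmul (MR' q) x y)@_z =
  \sum_(i < (size (val z)).+1) q ^+ inv_at i (val z) *
    (x@_(perm_restr i z) * y@_(st [seq x <- val z | (i < x)%N])).
Proof. exact: (hmul_coef (fun w w' => bmul_MR'_coef w w' z)). Qed.

End ProductMR'.

End MalvenutoReutenauer.

(** * The q-shuffle algebra of words *)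

Section WordShuffle.
Variables (k : comPzRingType) (q : k).

Definition shuffle_alg : galg k (seq nat) := {|
  bdeg := size;
  bmul := qshuffle q;
  gone := bas k [::]
|}.

Definition deconcat (u : seq nat) : freemod k (seq nat * seq nat)%type :=
  \sum_(i < (size u).+1) bas k (take i u, drop i u).

Let T := tmul q shuffle_alg.
Let A (a : nat) (z : freemod k (seq nat * seq nat)%type) : freemod k (seq nat * seq nat)%type :=
  tmap (@lcons k a) id z.

Let A_lin a : linear (A a).
Proof. exact: tmap_linear. Qed.

Let T_linl z : linear (fun y => T y z).
Proof. exact: tmul_linl. Qed.

Let T_linr y : linear (T y).
Proof. exact: tmul_linr. Qed.

Let A_bas a x y : A a (bas k (x, y)) = bas k (a :: x, y).
Proof. by rewrite /A tmap_bas /= lcons_bas tens_bas. Qed.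

Let A_tens a x y : A a (tens x y) = tens (lcons a x) y.
Proof. by rewrite /A tmap_tens //; apply: lcons_linear. Qed.

Let T_bas x y x' y' : T (bas k (x, y)) (bas k (x', y')) =
  q ^+ (size y * size x') *: tens (qshuffle q x x') (qshuffle q y y').
Proof. exact: tmul_bas. Qed.

Let deconcat_cons a u : deconcat (a :: u) = bas k ([::], a :: u) + A a (deconcat u).
Proof.
rewrite /deconcat big_ord_recl /= (lin_sum (A_lin a)); congr (_ + _).
by apply: eq_bigr => i _; rewrite A_bas.
Qed.

Let ldeconcat_lcons a x : lext deconcat (lcons a x) =
  tens (bas k [::]) (lcons a x) + A a (lext deconcat x).
Proof.
move: x; apply: lin_eq => [||u].
- by apply: (lin_comp (@lext_linear _ _ _ _)); apply: lcons_linear.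
- apply: lin_add.
  + by apply: (lin_comp (@tens_linr _ _ _ _)); apply: lcons_linear.
  + by apply: (lin_comp (A_lin a)); apply: lext_linear.
by rewrite lcons_bas !lext_bas deconcat_cons tens_bas.
Qed.

Let T_nill z : T (bas k ([::], [::])) z = z.
Proof.
move: z; apply: lin_eq => [||[x y]]; [exact: T_linr | exact: lin_id |].
by rewrite T_bas mul0n expr0 scale1r !qshuffle_nil tens_bas.
Qed.

Let T_nilr z : T z (bas k ([::], [::])) = z.
Proof.
move: z; apply: lin_eq => [||[x y]]; [exact: T_linl | exact: lin_id |].
by rewrite T_bas muln0 expr0 scale1r !qshuffle0 tens_bas.
Qed.

Let T_Al a z y : A a (T z (bas k ([::], y))) = T (A a z) (bas k ([::], y)).
Proof.
move: z; apply: lin_eq => [||[x1 x2]].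
- exact: (lin_comp (A_lin a) (T_linl _)).
- exact: (lin_comp (T_linl _) (A_lin a)).
by rewrite A_bas !T_bas muln0 expr0 !scale1r !qshuffle0 A_tens lcons_bas.
Qed.

Let T_Ar b x z :
  q ^+ size x *: A b (T (bas k ([::], x)) z) = T (bas k ([::], x)) (A b z).
Proof.
move: z; apply: lin_eq => [||[y1 y2]].
- by apply: lin_scale; exact: (lin_comp (A_lin b) (@T_linr _)).
- exact: (lin_comp (@T_linr _) (A_lin b)).
rewrite A_bas !T_bas !qshuffle_nil (linZ (A_lin b)) A_tens lcons_bas scalerA.
by rewrite -exprD mulnS.
Qed.

Let T_AA a b n y z : homog2 shuffle_alg n y ->
  T (A a y) (A b z) = A a (T y (A b z)) + q ^+ n.+1 *: A b (T (A a y) z).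
Proof.
move=> hy; move: z; apply: lin_eq => [||[v1 v2]].
- exact: (lin_comp (@T_linr _) (A_lin b)).
- apply: lin_add.
  + apply: (lin_comp (A_lin a)); exact: (lin_comp (@T_linr _) (A_lin b)).
  + by apply: lin_scale; exact: (lin_comp (A_lin b) (@T_linr _)).
rewrite A_bas.
apply: (@lin_eq_supp _ _ _ (fun y => T (A a y) _)
  (fun y => A a (T y _) + q ^+ n.+1 *: A b (T (A a y) _))) => [||[u1 u2] /hy /= hn].
- exact: (lin_comp (T_linl _) (A_lin a)).
- apply: lin_add.
  + exact: (lin_comp (A_lin a) (T_linl _)).
  + apply: lin_scale; apply: (lin_comp (A_lin b)).
    exact: (lin_comp (T_linl _) (A_lin a)).
rewrite A_bas !T_bas !(linZ (A_lin _)) !A_tens qshuffle_cons (linD (tens_linl _)).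
rewrite (linZ (tens_linl _)) scalerDr !scalerA -!exprD /=; congr (_ + q ^+ _ *: _).
by rewrite -hn mulnS; lia.
Qed.

Lemma homog2_deconcat u : homog2 shuffle_alg (size u) (deconcat u).
Proof.
apply: (@in_degree_sum _ _ (fun p : seq nat * seq nat => size p.1 + size p.2)%N) => i _ _.
have e : size u = (size (take i u) + size (drop i u))%N.
  by rewrite -size_cat cat_take_drop.
rewrite [in X in in_degree _ X _]e.
exact: (@in_degree_bas k _ (fun p : seq nat * seq nat => size p.1 + size p.2)%N (take i u, drop i u)).
Qed.

(** Double induction. With A and B prefixing a letter to the left tensor factor,
    both sides split according to which of the two left factors are empty, and
    the twist q^(|b||c|) accounts for the letters that the prefixed letter
    passes. *)
Lemma deconcat_qshuffle u v :
  lext deconcat (qshuffle q u v) = tmul q shuffle_alg (deconcat u) (deconcat v).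
Proof.
rewrite -/T; have deconcat0 : deconcat [::] = bas k ([::], [::]) by rewrite /deconcat big_ord1.
elim: u v => [|a u IHu] v.
  by rewrite qshuffle_nil lext_bas deconcat0 T_nill.
elim: v => [|b v IHv].
  by rewrite qshuffle0 lext_bas deconcat0 T_nilr.
rewrite qshuffle_cons (linD (@lext_linear _ _ _ _)) (linZ (@lext_linear _ _ _ _)).
rewrite !ldeconcat_lcons IHu IHv.
rewrite scalerDr addrACA -(linZ (@tens_linr _ _ _ _)) -(linD (@tens_linr _ _ _ _)).
rewrite -qshuffle_cons !(deconcat_cons b).
rewrite !(linD (@T_linr _)) (linD (A_lin a)) !(deconcat_cons a) !(linD (T_linl _)).
rewrite T_bas muln0 expr0 scale1r qshuffle_nil.
rewrite T_Al -(T_Ar b) (T_AA _ _ _ (@homog2_deconcat u)) (linD (A_lin b)) scalerDr.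
have regroup (V : zmodType) (t p r s w : V) :
    t + (p + r + (s + w)) = t + p + (s + (r + w)).
  by rewrite -!addrA [r + (s + w)]addrCA.
exact: regroup.
Qed.

Lemma qshuffle_supp u v x : x \in msupp (qshuffle q u v) -> perm_eq x (u ++ v).
Proof.
suff: forall x, ~~ perm_eq x (u ++ v) -> (qshuffle q u v)@_x = 0.
  move=> h xs; apply: contraLR xs => /h e.
  by rewrite -mcoeff_eq0 e.
elim: u v => [|a u IHu] v {}x.
  rewrite qshuffle_nil fcoef_bas; case: eqP => //= ->; by rewrite perm_refl.
elim: v x => [|b v IHv] x.
  rewrite cats0 qshuffle0 fcoef_bas; case: eqP => //= ->; by rewrite perm_refl.
rewrite qshuffle_cons fcoefD fcoefZ; case: x => [|c x]; first by rewrite !lcons_coef_nil mulr0 addr0.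
rewrite !lcons_coef => h.
have -> : (a == c)%:R * (qshuffle q u (b :: v))@_x = 0.
  case: eqP h => [<-|_ _]; last by rewrite mul0r.
  by rewrite cat_cons perm_cons => /IHu->; rewrite mulr0.
have -> : (b == c)%:R * (qshuffle q (a :: u) v)@_x = 0.
  case: eqP h => [<-|_ _]; last by rewrite mul0r.
  rewrite perm_sym -[b :: v]cat1s perm_catCA perm_cons perm_sym.
  by move=> /IHv->; rewrite mulr0.
by rewrite mulr0 addr0.
Qed.

Lemma qshuffle_map (f : nat -> nat) u v :
  qshuffle q (map f u) (map f v) =
  lext (fun x => bas k (map f x)) (qshuffle q u v).
Proof.
have lc a x : lext (fun x => bas k (map f x)) (lcons a x) =
    lcons (f a) (lext (fun x => bas k (map f x)) x).
  move: x; apply: lin_eq => [||x].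
  - by apply: (lin_comp (@lext_linear _ _ _ _)); apply: lcons_linear.
  - by apply: (lin_comp (@lcons_linear _ _)); apply: lext_linear.
  by rewrite !(lcons_bas, lext_bas).
elim: u v => [|a u IHu] v; first by rewrite -[map f [::]]/[::] !qshuffle_nil lext_bas.
elim: v => [|b v IHv]; first by rewrite -[map f [::]]/[::] !qshuffle0 lext_bas.
rewrite [map _ (a :: _)]/= [map _ (b :: _)]/= !qshuffle_cons size_map.
rewrite (linD (@lext_linear _ _ _ _)) (linZ (@lext_linear _ _ _ _)) !lc.
by rewrite -IHu -IHv.
Qed.

Definition std : freemod k (seq nat) -> freemod k permword :=
  lext (fun u => bas k (st u)).

Lemma std_linear : linear std.
Proof. exact: lext_linear. Qed.

Lemma bmul_MR'_std w w' : bmul (MR' q) w w' =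
  std (qshuffle q (val w) [seq (size (val w) + i)%N | i <- val w']).
Proof.
apply: fcoefP => z.
rewrite -[LHS]/((\sum_(x <- permwords _) _ *: bas k x)@_z).
set Q := qshuffle _ _ _; set N := (_ + _)%N.
have QN x : x \in msupp Q -> perm_eq x (iota 1 N).
  move/qshuffle_supp/perm_trans; apply; rewrite iotaD.
  apply: perm_cat; first exact: valP w.
  rewrite [(1 + _)%N]addnC iotaDl; apply/perm_map/(valP w').
rewrite (coef_big_bas _ (fun x : permword => Q@_(val x))) ?permwords_uniq //.
rewrite mem_permwords andbT.
transitivity (Q@_(val z)).
  case: (boolP (val z \in msupp Q)) => [/QN/perm_size|/mcoeff_outdom->]; last by rewrite mulr0.
  by rewrite size_iota => ->; rewrite eqxx mul1r.
rewrite lext_coef -[LHS]mulr1 -(sum_pick Q (val z) (fun=> 1)).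
apply: eq_big_seq => x xQ; rewrite fcoef_bas mulr1; congr (_ * _%:R).
have px : is_perm x.
  by rewrite /is_perm; have e := QN _ xQ; rewrite (perm_size e) size_iota.
by rewrite -val_eqE /= st_perm.
Qed.

Lemma st_uniq u : uniq u -> st_seq u = [seq (count (fun y => y < x)%N u).+1 | x <- u].
Proof.
move=> uu; apply: (@eq_from_nth _ 0%N) => [|i]; first by rewrite size_st size_map.
rewrite size_st => iu; rewrite !(nth_map 0%N) ?size_iota // nth_iota // add0n.
rewrite /st_at (count_memPn _) ?addn0 //.
apply/negP => /(nthP 0%N)[j]; rewrite size_take_min => ji.
rewrite nth_take; last by lia.
by move/eqP; rewrite nth_uniq //; lia.
Qed.

(** Shuffling commutes with relabelling, and the rank of a letter in [u ++ v]
    standardizes [u] and shifts the standardization of [v] by [size u], which is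
    the shifted shuffle defining the product. *)
Lemma std_qshuffle u v : uniq (u ++ v) -> allrel ltn u v ->
  std (qshuffle q u v) = bmul (MR' q) (st u) (st v).
Proof.
move=> uuv lt_uv; pose f x := (count (fun y => y < x)%N (u ++ v)).+1.
have [uu _ uv] := and3P (eq_ind _ is_true uuv _ (cat_uniq u v)).
have fu : map f u = st_seq u.
  rewrite st_uniq //; apply/eq_in_map => x xu; rewrite /f count_cat.
  rewrite (@eq_in_count _ _ pred0 v) ?count_pred0 ?addn0 // => y yv /=.
  by apply/negbTE; rewrite -leqNgt ltnW //; move/allrelP: lt_uv; apply.
have fv : map f v = [seq (size (st_seq u) + i)%N | i <- st_seq v].
  rewrite size_st st_uniq // -map_comp; apply/eq_in_map => x xv /=.
  rewrite /f count_cat (@eq_in_count _ _ predT u) ?count_predT ?addnS // => y yu /=.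
  by move/allrelP: lt_uv; apply.
rewrite bmul_MR'_std -[val (st u)]/(st_seq u) -[val (st v)]/(st_seq v) -fv -fu.
rewrite qshuffle_map -[std (lext _ _)]/((std \o lext _) _).
apply: (@lin_eq_supp _ _ _ std) => [||x /qshuffle_supp px].
- exact: std_linear.
- by apply: (lin_comp std_linear); apply: lext_linear.
rewrite /= lext_bas /std !lext_bas; congr bas; apply/eq_st_of/same_order_map.
move=> a b; rewrite !(perm_mem px) => ax bx; rewrite /f ltnS.
have lt_count a' b' : a' \in u ++ v -> (a' < b')%N ->
    (count (fun y => y < a')%N (u ++ v) < count (fun y => y < b')%N (u ++ v))%N.
  move=> a'x ab; elim: (u ++ v) a'x => //= y s IHs.
  have sub : (count (fun y => y < a') s <= count (fun y => y < b') s)%N.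
    by apply: sub_count => z /=; lia.
  rewrite inE; case: (eqVneq a' y) => [<-|_] /=; first by rewrite ltnn ab; lia.
  by move/IHs; lia.
case: (leqP a b) => [|ba]; last by rewrite leqNgt lt_count.
by rewrite leq_eqVlt => /predU1P[->|ab]; [rewrite leqnn | rewrite ltnW // lt_count].
Qed.

Lemma tmap_std_deconcat u : tmap std std (deconcat u) = bcopr (MR' q) (st u).
Proof.
rewrite (lin_sum (@tmap_linear _ _ _ _ _ _ _)).
rewrite -[RHS]/(\sum_(i < (size (val (st u))).+1)
  bas k (st (take i (val (st u))), st (drop i (val (st u))))) stE size_st.
apply: eq_bigr => i _; rewrite tmap_bas /std !lext_bas tens_bas.
by rewrite -stE st_take_st st_drop_st.
Qed.

Lemma copr_MR'_std x : copr (MR' q) (std x) = tmap std std (lext deconcat x).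
Proof.
move: x; apply: lin_eq => [||u].
- by apply: (lin_comp (@copr_linear _ _ _)); apply: std_linear.
- by apply: (lin_comp (@tmap_linear _ _ _ _ _ _ _)); apply: lext_linear.
by rewrite /std !lext_bas copr_bas tmap_std_deconcat.
Qed.

(** Transport along standardization of the compatibility on words; prefixes and
    suffixes of [w] and of the shifted [w'] still have separated alphabets, so
    that [std_qshuffle] applies to each tensor factor. *)
Lemma copr_bmul_MR' w w' : copr (MR' q) (bmul (MR' q) w w') =
  tmul q (MR' q) (bcopr (MR' q) w) (bcopr (MR' q) w').
Proof.
set v := [seq (size (val w) + i)%N | i <- val w'].
have stv : st v = w'.
  rewrite -[RHS]st_val; apply/eq_st_of/same_order_sym/same_order_map => x y _ _.
  by rewrite leq_add2l.
have lt_wv : allrel ltn (val w) v.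
  apply/allrelP => x y; rewrite mem_permword => /andP[_ xw] /mapP[z].
  rewrite mem_permword => /andP[z0 _] ->; apply: leq_ltn_trans xw _.
  by rewrite -[X in (X < _)%N]addn0 ltn_add2l.
have uwv : uniq (val w ++ v).
  rewrite cat_uniq uniq_permword map_inj_uniq ?uniq_permword ?andbT; last exact: addnI.
  apply/hasPn => x xv; apply/negP => xw.
  by move/allrelP: lt_wv => /(_ _ _ xw xv); rewrite /= ltnn.
have -> : bcopr (MR' q) w = tmap std std (deconcat (val w)) by rewrite tmap_std_deconcat st_val.
have -> : bcopr (MR' q) w' = tmap std std (deconcat v) by rewrite tmap_std_deconcat stv.
rewrite bmul_MR'_std -/v copr_MR'_std deconcat_qshuffle /deconcat.
rewrite (lin_sum (@tmul_linl k q _ shuffle_alg _)) !(lin_sum (@tmap_linear _ _ _ _ _ _ _)).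
rewrite (lin_sum (@tmul_linl k q _ (MR' q) _)); apply: eq_bigr => i _.
rewrite (lin_sum (@tmul_linr k q _ shuffle_alg _)) !(lin_sum (@tmap_linear _ _ _ _ _ _ _)).
rewrite (lin_sum (@tmul_linr k q _ (MR' q) _)); apply: eq_bigr => j _.
rewrite tmul_bas (linZ (@tmap_linear _ _ _ _ _ _ _)) tmap_tens; do ?exact: std_linear.
rewrite !tmap_bas /= /std !lext_bas !tens_bas tmul_bas /= -!/(std _).
rewrite !size_st; congr (_ *: _).
have [u1 l1 u2 l2] : [/\ uniq (take i (val w) ++ take j v),
    allrel ltn (take i (val w)) (take j v),
    uniq (drop i (val w) ++ drop j v) & allrel ltn (drop i (val w)) (drop j v)].
  move: uwv lt_wv; rewrite -{1 2}(cat_take_drop i (val w)) -{1 2}(cat_take_drop j v).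
  rewrite allrel_catl !allrel_catr => uu /andP[/andP[-> _] /andP[_ ->]].
  by split=> //; apply: subseq_uniq uu; rewrite -catA;
    [rewrite cat_subseq // | rewrite -[X in subseq X _]cat0s cat_subseq ?sub0seq //];
    rewrite ?cat_subseq ?suffix_subseq ?prefix_subseq //;
    apply: subseq_trans (suffix_subseq _ _); rewrite ?suffix_subseq ?prefix_subseq.
by rewrite !std_qshuffle //= !size_st.
Qed.

End WordShuffle.

(** * The isomorphism theta and the axioms of MR and MR' *)

Section Theta.
Variables (k : comPzRingType) (q : k).

Lemma theta_linear : linear (theta q).
Proof. exact: lext_linear. Qed.

Lemma theta_bas w :
  theta q (bas k w) = q ^+ inversions (val w) *: bas k (perm_inv w).
Proof. exact: lext_bas. Qed.

Lemma theta_coef x z :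
  (theta q x)@_z = q ^+ inversions (val z) * x@_(perm_inv z).
Proof.
rewrite lext_coef -[in RHS](inversions_perm_inv z) [RHS]mulrC.
rewrite -(sum_pick x (perm_inv z) (fun w : permword => q ^+ inversions (val w))).
apply: eq_bigr => w _; rewrite fcoefZ fcoef_bas -(inj_eq (can_inj perm_invK)).
by rewrite perm_invK [_%:R * _]mulrC.
Qed.

(** Both sides are convolutions over the cuts of a permutation: by positions for
    its inverse, by letters for itself. *)
Lemma theta_mul x y :
  theta q (hmul (MR q) x y) = hmul (MR' q) (theta q x) (theta q y).
Proof.
apply: fcoefP => z; rewrite theta_coef hmul_MR_coef hmul_MR'_coef big_distrr.
rewrite size_perm_inv; apply: eq_bigr => i _.
have iz : (i <= size (val z))%N by rewrite -ltnS.
rewrite !theta_coef perm_inv_restr // perm_inv_restr_gt // mulrACA [RHS]mulrA /=.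
congr (_ * _); rewrite -!exprD inversions_st; congr (_ ^+ _).
by rewrite (inversions_restr i) addnC.
Qed.

Lemma theta_one : theta q (bas k perm0) = bas k perm0.
Proof.
rewrite theta_bas expr0 scale1r; congr bas; apply/eqP.
by rewrite size_eq0_perm0 size_perm_inv.
Qed.

Lemma perm_inv_eq0 w : (perm_inv w == perm0) = (w == perm0).
Proof. by rewrite !size_eq0_perm0 size_perm_inv. Qed.

Lemma theta_morph : qhopf_morph (MR q) (MR' q) (theta q).
Proof.
apply: qhopf_morph_bas.
- exact: theta_linear.
- move=> w; rewrite theta_bas; apply: in_degreeZ.
  rewrite -[bdeg (MR q) w]/(size (val w)) -size_perm_inv.
  exact: (@in_degree_bas k _ (fun w => size (val w))).
- by move=> w w'; rewrite -theta_mul hmul_bas.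
- exact: theta_one.
- move=> w; rewrite theta_bas (linZ (@copr_linear _ _ _)) copr_bas.
  rewrite (lin_sum (@tmap_linear _ _ _ _ _ _ _)) scaler_sumr size_perm_inv.
  apply: eq_bigr => i _; have iw : (i <= size (val w))%N by rewrite -ltnS.
  rewrite (linZ (@tmap_linear _ _ _ _ _ _ _)) tmap_bas !theta_bas.
  rewrite (linZ (tens_linl _)) (linZ (@tens_linr _ _ _ _)) !scalerA tens_bas.
  rewrite -(perm_inv_restr iw) -(perm_inv_restr_gt iw) -!exprD.
  rewrite stE inversions_st (inversions_restr i (val w)) [(_ + inv_at _ _)%N]addnC addnA.
  by [].
- move=> w; rewrite theta_bas -[_ *: _]addr0 coun_linear coun_bas /=.
  rewrite /coun msupp0 big_nil addr0 perm_inv_eq0.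
  by case: eqP => [->|_]; rewrite ?mulr0 // expr0 mul1r.
Qed.

Lemma MR'_mul_graded w w' :
  homog (MR' q) (bdeg (MR' q) w + bdeg (MR' q) w') (bmul (MR' q) w w').
Proof.
apply: in_degree_sum => x; rewrite mem_permwords => /eqP xs _.
apply: in_degreeZ; rewrite -[(_ + _)%N]xs.
exact: (@in_degree_bas k _ (fun w => size (val w))).
Qed.

Lemma MR'_copr_graded w : homog2 (MR' q) (bdeg (MR' q) w) (bcopr (MR' q) w).
Proof.
pose d (p : permword * permword) := (size (val p.1) + size (val p.2))%N.
apply: (@in_degree_sum _ _ d) => i _ _.
have -> : bdeg (MR' q) w = d (st (take i (val w)), st (drop i (val w))).
  by rewrite /d !stE !size_st -size_cat cat_take_drop.
exact: in_degree_bas.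
Qed.

Lemma MR'_coprA x : tassoc (tmap (copr (MR' q)) id (copr (MR' q) x)) =
  tmap id (copr (MR' q)) (copr (MR' q) x).
Proof.
move: x; apply: lin_eq => [||w].
- apply: (lin_comp (@tassoc_linear _ _ _ _)).
  by apply: (lin_comp (@tmap_linear _ _ _ _ _ _ _)); apply: copr_linear.
- by apply: (lin_comp (@tmap_linear _ _ _ _ _ _ _)); apply: copr_linear.
rewrite copr_bas !(lin_sum (@tmap_linear _ _ _ _ _ _ _)).
rewrite (lin_sum (@tassoc_linear _ _ _ _)).
set u := val w; set n := size u.
transitivity (\sum_(i < n.+1) \sum_(j < i.+1)
   bas k (st (take j u), (st (drop j (take i u)), st (drop i u)))).
  apply: eq_bigr => i _; rewrite tmap_bas copr_bas.
  rewrite (lin_sum (tens_linl _)) (lin_sum (@tassoc_linear _ _ _ _)).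
  have iu : (i <= size u)%N by rewrite -ltnS.
  rewrite stE size_st size_takel //; apply: eq_bigr => j _.
  have ji : (j <= i)%N by rewrite -ltnS.
  rewrite tens_bas /tassoc lext_bas -stE st_take_st st_drop_st.
  by rewrite take_takel.
rewrite (triangle_sum n (fun j i =>
   bas k (st (take j u), (st (drop j (take i u)), st (drop i u))))).
apply: eq_bigr => j _; rewrite tmap_bas copr_bas.
rewrite (lin_sum (@tens_linr _ _ _ _)) stE size_st size_drop.
apply: eq_bigr => l _.
by rewrite tens_bas -stE st_take_st st_drop_st take_drop drop_drop.
Qed.

Lemma MR'_counl x :
  lext (fun p : permword * permword => bcoun (MR' q) p.1 *: bas k p.2) (copr (MR' q) x) = x.
Proof.
move: x; apply: lin_eq => [||w]; [| exact: lin_id |].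
  by apply: (lin_comp (@lext_linear _ _ _ _)); apply: copr_linear.
rewrite copr_bas (lin_sum (@lext_linear _ _ _ _)).
rewrite (sum_pick_ord (m := 0%N) (F := fun i => lext _ (bas k (st (take i (val w)), st (drop i (val w)))))).
  by rewrite lext_bas take0 drop0 st_nil st_val /= scale1r.
move=> i iw i0; rewrite lext_bas -[bcoun _ _]/(_ == perm0)%:R size_eq0_perm0.
by rewrite stE size_st size_takel // (negPf i0) scale0r.
Qed.

Lemma MR'_counr x :
  lext (fun p : permword * permword => bcoun (MR' q) p.2 *: bas k p.1) (copr (MR' q) x) = x.
Proof.
move: x; apply: lin_eq => [||w]; [| exact: lin_id |].
  by apply: (lin_comp (@lext_linear _ _ _ _)); apply: copr_linear.
rewrite copr_bas (lin_sum (@lext_linear _ _ _ _)).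
rewrite (sum_pick_ord (m := size (val w)) (F := fun i => lext _ (bas k (st (take i (val w)), st (drop i (val w)))))).
  by rewrite leqnn lext_bas take_size drop_size st_nil st_val /= scale1r.
move=> i iw i0; rewrite lext_bas -[bcoun _ _]/(_ == perm0)%:R size_eq0_perm0.
rewrite stE size_st size_drop; case: eqP => [e|_]; last by rewrite scale0r.
by case/eqP: i0; apply/eqP; rewrite eqn_leq iw /= -subn_eq0 e.
Qed.

Lemma MR'_copr_mul x y : copr (MR' q) (hmul (MR' q) x y) =
  tmul q (MR' q) (copr (MR' q) x) (copr (MR' q) y).
Proof.
move: x; apply: lin_eq => [||w].
- by apply: (lin_comp (@copr_linear _ _ _)); apply: hmul_linl.
- by apply: (lin_comp (@tmul_linl k q _ _ _)); apply: copr_linear.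
move: y; apply: lin_eq => [||w'].
- by apply: (lin_comp (@copr_linear _ _ _)); apply: hmul_linr.
- by apply: (lin_comp (@tmul_linr k q _ _ _)); apply: copr_linear.
by rewrite hmul_bas !copr_bas copr_bmul_MR'.
Qed.

Lemma size_permword0 (w : permword) : size (val w) = 0%N -> w = perm0.
Proof. by move=> /eqP; rewrite -size_eq0_perm0 => /eqP. Qed.

Variable p : k.
Hypothesis pq : p * q = 1.

Let thetaV : freemod k permword -> freemod k permword :=
  lext (fun w => p ^+ inversions (val w) *: bas k (perm_inv w)).

Let thetaV_linear : linear thetaV.
Proof. exact: lext_linear. Qed.

Let thetaK : cancel (theta q) thetaV.
Proof.
apply: lin_eq => [||w].
- by apply: (lin_comp thetaV_linear); apply: theta_linear.
- exact: lin_id.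
rewrite theta_bas (linZ thetaV_linear) /thetaV lext_bas scalerA perm_invK.
by rewrite inversions_perm_inv -exprMn_comm ?[q * p]mulrC ?pq ?expr1n ?scale1r //; apply: mulrC.
Qed.

Let thetaVK : cancel thetaV (theta q).
Proof.
apply: lin_eq => [||w].
- by apply: (lin_comp theta_linear).
- exact: lin_id.
rewrite {1}/thetaV lext_bas (linZ theta_linear) theta_bas scalerA perm_invK.
by rewrite inversions_perm_inv -exprMn_comm ?pq ?expr1n ?scale1r //; apply: mulrC.
Qed.

Lemma theta_iso : qhopf_iso (MR q) (MR' q) (theta q).
Proof.
apply: (qhopf_iso_of_cancel theta_morph thetaK thetaVK thetaV_linear).
move=> w; rewrite /thetaV lext_bas; apply: in_degreeZ.
rewrite -[bdeg (MR' q) w]/(size (val w)) -size_perm_inv.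
exact: (@in_degree_bas k _ (fun w => size (val w))).
Qed.

Lemma MR'_qHopf : graded_qHopf q (MR' q).
Proof.
split.
- by move=> m n x y; apply: homog_hmul; apply: MR'_mul_graded.
- exact: (@in_degree_bas k _ (fun w : permword => size (val w)) perm0).
- by move=> n x hx; apply: in_degree_lext hx => w <-; apply: MR'_copr_graded.
- exact: (@coun_unit_graded _ _ (MR' q) perm0).
- exact: (@connected_of_bas _ _ (MR' q) perm0 size_permword0).
- move=> x y z; rewrite -(thetaVK x) -(thetaVK y) -(thetaVK z).
  by rewrite -!theta_mul hmul_MR_assoc.
- move=> x; rewrite -(thetaVK x) -[gone _]/(bas k perm0) -theta_one -theta_mul.
  by rewrite hmul_MR_1l.
- move=> x; rewrite -(thetaVK x) -[gone _]/(bas k perm0) -theta_one -theta_mul.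
  by rewrite hmul_MR_1r.
- exact: MR'_coprA.
- exact: MR'_counl.
- exact: MR'_counr.
- exact: MR'_copr_mul.
Qed.

Lemma MR_qHopf : graded_qHopf q (MR q).
Proof.
apply: (@qHopf_of_injective _ q _ _ _ _ _ theta_morph perm_inv (fun=> 0%N) perm0).
- split=> [w|w w']; rewrite theta_bas fcoefZ fcoef_bas.
    by exists (p ^+ inversions (val w)); rewrite eqxx mulr1 -exprMn pq expr1n.
  rewrite (inj_eq (can_inj perm_invK)); case: (w =P w') => [->|_]; first by left.
  by rewrite mulr0 eqxx.
- exact: size_permword0.
- by [].
- exact: MR'_qHopf.
Qed.

End Theta.

(** * Compositions, descents and increasing blocks *)

Section Compositions.
Local Open Scope nat_scope.
Implicit Types (a b : seq nat).

Lemma foldl_addn x a : foldl addn x a = x + sumn a.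
Proof. by elim: a x => [|y a IHa] x /=; rewrite ?addn0 // IHa addnA. Qed.

Lemma scanl_des a : scanl addn 0 a = [seq sumn (take i a) | i <- iota 1 (size a)].
Proof.
apply: (@eq_from_nth _ 0) => [|i]; first by rewrite size_scanl size_map size_iota.
rewrite size_scanl => ia; rewrite (nth_scanl 0) ?ia // foldl_addn add0n.
by rewrite (nth_map 0) ?size_iota // nth_iota // add1n.
Qed.

(** Partial sums turn a composition into the increasing sequence of its descents
    followed by its sum, and differences turn it back. *)
Lemma scanl_des_rcons a : a != [::] -> scanl addn 0 a = rcons (des a) (sumn a).
Proof.
rewrite scanl_des /des -size_eq0; case e: (size a) => [|n] // _.
have -> : iota 1 n.+1 = rcons (iota 1 n) n.+1.
  by have := iotaD 1 n 1; rewrite addn1 cats1 add1n.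
by rewrite map_rcons; congr rcons; rewrite -e take_size.
Qed.

Lemma scanl_pairmap x t : path ltn x t ->
  scanl addn x (pairmap (fun y z => z - y) x t) = t.
Proof.
elim: t x => //= y t IHt x /andP[xy yt].
by rewrite subnKC 1?ltnW // IHt.
Qed.

Lemma pairmap_scanl x a : pairmap (fun y z => z - y) x (scanl addn x a) = a.
Proof. by apply: scanlK => y z; rewrite addKn. Qed.

Lemma sumn_pairmap x t : path ltn x t ->
  x + sumn (pairmap (fun y z => z - y) x t) = last x t.
Proof.
elim: t x => [|y t IHt] x /=; first by rewrite addn0.
by move=> /andP[xy yt]; rewrite addnA subnKC 1?ltnW // IHt.
Qed.

Lemma path_scanl x a : is_comp a -> path ltn x (scanl addn x a).
Proof.
elim: a x => //= y a IHa x /andP[y0 ca]; rewrite IHa // andbT.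
by rewrite -[X in X < _]addn0 ltn_add2l.
Qed.

Lemma path_filter_iota n (p : pred nat) :
  path ltn 0 (rcons [seq i <- iota 1 n | p i] n.+1).
Proof.
rewrite rcons_path path_min_sorted; last first.
  by apply/allP => i; rewrite mem_filter mem_iota => /andP[_ /andP[]].
rewrite sorted_filter ?iota_ltn_sorted //=; last exact: ltn_trans.
have := mem_last 0 [seq i <- iota 1 n | p i].
rewrite inE mem_filter mem_iota add1n => /predU1P[-> //|].
by case/andP=> _ /andP[].
Qed.

Lemma sumn_cdes n D : sumn (cdes_seq n D) = n.
Proof.
rewrite /cdes_seq; case: n => // n /=.
by rewrite -[LHS]add0n sumn_pairmap ?path_filter_iota // last_rcons.
Qed.

Lemma cdes_neq0 n D : (cdes_seq n D == [::]) = (n == 0).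
Proof.
rewrite /cdes_seq; case: n => // n /=.
by rewrite -size_eq0 size_pairmap size_rcons.
Qed.

Lemma des_cdes n D : des (cdes_seq n D) = [seq i <- iota 1 n.-1 | i \in D].
Proof.
case: (posnP n) => [->|n0] //.
have h : cdes_seq n D != [::] by rewrite cdes_neq0 -lt0n.
have := scanl_des_rcons h; rewrite sumn_cdes /cdes_seq.
case: n n0 {h} => // n _ /=; rewrite scanl_pairmap ?path_filter_iota // => e.
by apply: (@rcons_injl _ n.+1); rewrite /= -e.
Qed.

Lemma sorted_des a : is_comp a -> sorted ltn (des a) /\
  forall i, i \in des a -> 0 < i < sumn a.
Proof.
case: (eqVneq a [::]) => [->|a0] // ca.
have := path_scanl 0 ca; rewrite scanl_des_rcons // rcons_path => /andP[pa la].
split; first exact: path_sorted pa.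
move=> i ia.
have tr : transitive ltn by exact: ltn_trans.
have := order_path_min tr pa => /allP/(_ i ia) /= i0.
rewrite i0; have := path_scanl 0 ca; rewrite scanl_des_rcons //.
move/path_sorted; rewrite (sorted_pairwise tr) -cats1 pairwise_cat.
by case/and3P=> /allrelP h _ _; apply: h ia _; rewrite inE.
Qed.

Lemma filter_des a : is_comp a ->
  [seq i <- iota 1 (sumn a).-1 | i \in des a] = des a.
Proof.
move=> ca; have [sa ba] := sorted_des ca.
apply: (irr_sorted_eq ltn_trans ltnn) => //.
  by apply: sorted_filter; [exact: ltn_trans | exact: iota_ltn_sorted].
move=> i; rewrite mem_filter mem_iota; case: (boolP (i \in des a)) => //= /ba.
lia.
Qed.

Lemma cdes_des a : is_comp a -> cdes_seq (sumn a) (des a) = a.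
Proof.
move=> ca; rewrite /cdes_seq; case: eqP => [|/eqP n0].
  by case: a ca => //= x a /andP[x0 _]; lia.
rewrite filter_des // -scanl_des_rcons ?pairmap_scanl //.
by apply: contraNneq n0 => ->.
Qed.

Lemma size_des a : size (des a) = (size a).-1.
Proof. by rewrite size_map size_iota. Qed.

Lemma filter_sublists s (p : pred nat) : filter p s \in sublists s.
Proof.
elim: s => //= x s IHs; rewrite mem_cat; case: ifP => _; last by rewrite IHs orbT.
by rewrite map_f.
Qed.

Lemma sublists_sub s t : t \in sublists s -> {subset t <= s}.
Proof.
elim: s t => [|x s IHs] t /=; first by rewrite inE => /eqP->.
rewrite mem_cat => /orP[/mapP[t' /IHs t's ->]|/IHs ts] y.
  by rewrite !inE => /predU1P[->|/t's->]; rewrite ?eqxx ?orbT.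
by rewrite inE => /ts->; rewrite orbT.
Qed.

Lemma sublists_filter s t : uniq s -> t \in sublists s -> [seq i <- s | i \in t] = t.
Proof.
elim: s t => [|x s IHs] t /=; first by rewrite inE => _ /eqP->.
move=> /andP[xs us]; rewrite mem_cat => /orP[/mapP[t' t's ->]|ts].
  rewrite mem_head; congr (_ :: _); rewrite -[RHS](IHs _ us t's).
  apply: eq_in_filter => y ys; rewrite inE.
  by case: eqP => // yx; rewrite -yx ys in xs.
by case: ifP => [/(sublists_sub ts) xs'|_]; [rewrite xs' in xs | apply: IHs].
Qed.

Lemma uniq_sublists s : uniq s -> uniq (sublists s).
Proof.
elim: s => //= x s IHs /andP[xs /IHs us].
rewrite cat_uniq us map_inj_uniq ?us ?andbT /=; last by move=> t t' [].
apply/hasPn => t /sublists_sub ts; apply/negP => /mapP[t' _ e].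
by move: (ts x); rewrite e mem_head => /(_ isT); apply/negP.
Qed.

Lemma mem_comps n (b : composition) : (b \in comps n) = (sumn (val b) == n).
Proof.
apply/mapP/eqP => [[D _ ->]|<-]; first exact: sumn_cdes.
exists [seq i <- iota 1 (sumn (val b)).-1 | i \in des (val b)].
  exact: filter_sublists.
apply: val_inj; rewrite /= filter_des ?cdes_des //; exact: valP.
Qed.

Lemma comps_uniq n : uniq (comps n).
Proof.
rewrite map_inj_in_uniq ?uniq_sublists ?iota_uniq // => D D' hD hD' e.
have := congr1 (fun c : composition => des (val c)) e.
by rewrite /= !des_cdes !sublists_filter ?iota_uniq.
Qed.

Lemma mem_des_cons m b i : is_comp (m :: b) ->
  (i \in des (m :: b)) = (b != [::]) && ((i == m) || (m < i) && (i - m \in des b)).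
Proof.
case: b => [|m' b] //= /andP[m0 cb].
rewrite /des /= inE addn0; congr (_ || _).
have -> : iota 2 (size b) = [seq j.+1 | j <- iota 1 (size b)].
  exact: (iotaDl 1 1 (size b)).
rewrite -map_comp; apply/mapP/andP => [[j jb ->]|[mi /mapP[j jb e]]].
  rewrite /= addKn -[X in (X < _) /\ _]addn0 ltn_add2l; split.
    by move: jb cb; rewrite mem_iota; case: j => //= j _; lia.
  by apply/mapP; exists j.
by exists j => //=; rewrite -e subnKC // ltnW.
Qed.

(** Increase inside the blocks is increase at every position that does not
    separate two blocks. *)
Lemma reshape_sortedP b w : is_comp b -> sumn b = size w ->
  reflect (forall i, 0 < i < size w -> i \notin des b -> nth 0 w i.-1 < nth 0 w i)
          (all (sorted ltn) (reshape b w)).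
Proof.
elim: b w => [|m b IHb] w cb /= sw.
  by apply: ReflectT => i; rewrite -sw; lia.
have [m0 cb'] := andP cb.
have sd : sumn b = size (drop m w) by rewrite size_drop; lia.
apply: (iffP andP) => [[/(sortedP 0) st /(IHb _ cb' sd) hb] i ib nd|h].
  case: (ltngtP i m) => im.
  - have := st i.-1; rewrite size_takel; last by lia.
    by rewrite !nth_take ?prednK; try lia; apply; lia.
  - have := hb (i - m); rewrite !nth_drop size_drop subnKC; last exact: ltnW.
    rewrite (_ : m + (i - m).-1 = i.-1); last by lia.
    apply; first by lia.
    apply: contra nd => nd; rewrite mem_des_cons // im nd orbT andbT.
    by apply: contraTneq nd => ->.
  move: nd; rewrite mem_des_cons // im eqxx andbT negbK => /eqP b0.
  by move: sd; rewrite b0 size_drop /=; lia.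
split.
  apply/(sortedP 0) => i; rewrite size_takel; last by lia.
  move=> im; rewrite !nth_take; try lia.
  apply: (h i.+1); first by lia.
  by rewrite mem_des_cons //; apply/negP => /andP[_ /orP[/eqP|/andP[]]]; lia.
apply/(IHb _ cb' sd) => i; rewrite size_drop => ib nd.
rewrite !nth_drop (_ : m + i.-1 = (m + i).-1); last by lia.
apply: h; first by lia.
rewrite mem_des_cons // addKn (negPf nd) andbF orbF negb_and negbK.
apply/orP; right; apply/eqP; lia.
Qed.

Lemma sumn_perm_comp (w : permword) : sumn (val (perm_comp w)) = size (val w).
Proof. exact: sumn_cdes. Qed.

Lemma des_perm_comp (w : permword) : des (val (perm_comp w)) =
  [seq i <- iota 1 (size (val w)).-1 | nth 0 (val w) i < nth 0 (val w) i.-1].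
Proof.
rewrite /= des_cdes; apply: eq_in_filter => i iw.
by rewrite mem_filter iw andbT.
Qed.

Lemma refine_perm_comp (w : permword) (b : composition) :
  refine (perm_comp w) b = (sumn (val b) == size (val w)) &&
    all (sorted ltn) (reshape (val b) (val w)).
Proof.
rewrite /refine sumn_perm_comp eq_sym; case: eqP => //= sb.
rewrite des_perm_comp; apply/allP/(reshape_sortedP (valP b) sb) => h i.
  case: i => // i iw nd; rewrite ltnNge leq_eqVlt; apply/norP; split.
    by rewrite nth_uniq ?uniq_permword ?(ltnW iw) // eqn_leq ltnn.
  apply: contra nd => lt_i; apply: h; rewrite mem_filter lt_i mem_iota add1n.
  by case: (size _) iw.
rewrite mem_filter mem_iota => /andP[lt_i iw]; apply: contraLR lt_i => nd.
rewrite -leqNgt ltnW // h //; move: iw; case: i {nd} => // i.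
by case: (size _).
Qed.

(** The increasing runs use smaller and smaller letters, so that descents occur
    exactly between two runs. *)
Fixpoint run_word b : seq nat :=
  if b is m :: b' then iota (sumn b').+1 m ++ run_word b' else [::].

Lemma size_run_word b : size (run_word b) = sumn b.
Proof. by elim: b => //= m b IHb; rewrite size_cat size_iota IHb. Qed.

Lemma is_perm_run_word b : is_perm (run_word b).
Proof.
rewrite /is_perm size_run_word; elim: b => //= m b IHb.
by rewrite addnC iotaD perm_catC perm_cat // add1n.
Qed.

Definition run_perm (b : composition) : permword :=
  Sub (run_word (val b)) (is_perm_run_word (val b)).

Lemma run_word_descent b i : is_comp b -> 0 < i < sumn b ->
  (nth 0 (run_word b) i < nth 0 (run_word b) i.-1) = (i \in des b).
Proof.
elim: b i => [|m b IHb] i cb /= ib; first by lia.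
have [m0 cb'] := andP cb.
rewrite mem_des_cons // !nth_cat size_iota.
case: (ltngtP i m) => im.
- rewrite (_ : i.-1 < m) ?nth_iota; try lia.
- have -> : i.-1 < m = false by lia.
  rewrite (_ : i.-1 - m = (i - m).-1); last by lia.
  rewrite IHb //; last by lia.
  case: (boolP (i - m \in des b)) => nd; last by rewrite /= andbF.
  by rewrite /= andbT; apply/esym; apply: contraTneq nd => ->.
rewrite im (_ : m.-1 < m) ?nth_iota; try lia.
rewrite subnn orTb andbT (_ : b != [::]); last first.
  by apply: contraTneq ib => ->; rewrite im /= addn0 ltnn andbF.
have : nth 0 (run_word b) 0 \in run_word b.
  by rewrite mem_nth // size_run_word; lia.
rewrite (perm_memP _ (is_perm_run_word b)) size_run_word; lia.
Qed.

Lemma perm_comp_run (b : composition) : perm_comp (run_perm b) = b.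
Proof.
apply: val_inj; rewrite /= size_run_word -[RHS](cdes_des (valP b)).
rewrite /cdes_seq; case: eqP => // n0; congr (pairmap _ _ (rcons _ _)).
apply: eq_in_filter => i; rewrite mem_iota => ib.
rewrite mem_filter mem_iota run_word_descent ?(valP b) //; last by lia.
by rewrite (_ : 0 < i < 1 + (sumn (val b)).-1) ?andbT //; lia.
Qed.

Lemma refine_refl (b : composition) : refine b b.
Proof. by rewrite /refine eqxx; apply/allP. Qed.

(** Refinement is unitriangular with respect to the number of parts; this yields
    injectivity of iota and surjectivity of pi'. *)
Lemma refine_eq_or_longer (b c : composition) : refine b c ->
  b = c \/ size (val b) < size (val c).
Proof.
case/andP=> /eqP sbc /allP sub.
have [sb bb] := sorted_des (valP b); have [sc bc] := sorted_des (valP c).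
have ub : uniq (des (val b)) by apply: (sorted_uniq ltn_trans ltnn).
have le := uniq_leq_size ub sub; rewrite !size_des in le.
have nil0 (d : composition) : size (val d) = 0 -> sumn (val d) = 0.
  by move/eqP; rewrite size_eq0 => /eqP->.
have nilS (d : composition) : sumn (val d) = 0 -> size (val d) = 0.
  by case: d => -[|x d] //= /andP[x0 _]; lia.
case: (ltnP (size (val b)) (size (val c))) => lt; [by right | left].
have e : size (val b) = size (val c).
  move: (nil0 c) (nilS b) lt le; rewrite sbc.
  by move: (size (val b)) (size (val c)) (sumn (val c)) => x y z; lia.
apply: val_inj; rewrite -(cdes_des (valP b)) -(cdes_des (valP c)) sbc.
congr cdes_seq; apply: (irr_sorted_eq ltn_trans ltnn) => //.
by have [] := uniq_min_size ub sub; rewrite ?size_des ?e.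
Qed.

End Compositions.

(** * Normal coefficients of series in q-commuting variables *)

Section Words.
Local Open Scope nat_scope.
Implicit Types (s u v : seq nat).

Definition cross_inversions u v := \sum_(x <- u) count (fun y => y < x) v.

Lemma inversions_cat u v :
  inversions (u ++ v) = inversions u + inversions v + cross_inversions u v.
Proof.
rewrite /cross_inversions; elim: u => [|x u IHu] /=; first by rewrite big_nil addn0.
by rewrite IHu big_cons count_cat; lia.
Qed.

Lemma cross_inversions_perml u u' v : perm_eq u u' -> cross_inversions u v = cross_inversions u' v.
Proof. exact: perm_big. Qed.

Lemma cross_inversions_permr u v v' : perm_eq v v' -> cross_inversions u v = cross_inversions u v'.
Proof. by move=> /permP pv; apply: eq_bigr => x _; apply: pv. Qed.

(** The exponent in the relation x_i x_j = q x_j x_i. *)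
Lemma inversions_swap u i j v : j < i ->
  inversions (u ++ [:: i; j] ++ v) = (inversions (u ++ [:: j; i] ++ v)).+1.
Proof.
move=> ji; rewrite !inversions_cat.
have pij : perm_eq [:: i; j] [:: j; i] by rewrite (perm_catC [:: i] [:: j]).
rewrite (cross_inversions_perml v pij) (cross_inversions_permr u (perm_cat pij (perm_refl v))) /=.
by rewrite ji ltnNge (ltnW ji) /=; lia.
Qed.

Lemma inversions_sorted s : sorted leq s -> inversions s = 0.
Proof.
elim: s => //= x s IHs ps; rewrite IHs ?(path_sorted ps) // addn0.
apply/eqP; rewrite -leqn0 leqNgt -has_count -all_predC.
apply: sub_all (order_path_min leq_trans ps) => y /=; by rewrite -leqNgt.
Qed.

Lemma sort_descent u : ~~ sorted leq u ->
  exists u1 i j u2, j < i /\ u = u1 ++ [:: i; j] ++ u2.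
Proof.
elim: u => // x u IHu; case: u IHu => [|y u] //= IHu.
rewrite negb_and => /orP[xy|/IHu[u1 [i [j [u2 [ji ->]]]]]].
  by exists [::], x, y, u; split; first by rewrite ltnNge.
by exists (x :: u1), i, j, u2.
Qed.

Lemma sum_by_image (V : nmodType) (T S : eqType) (r : seq T) (h : T -> S)
    (G : T -> V) :
  (\sum_(u <- r) G u =
   \sum_(t <- undup (map h r)) \sum_(u <- r | h u == t) G u)%R.
Proof.
rewrite (exchange_big_dep predT) //=; apply: eq_big_seq => u ur.
under eq_bigl do rewrite eq_sym.
rewrite -big_filter filter_pred1_uniq ?undup_uniq ?big_seq1 //.
by rewrite mem_undup map_f.
Qed.

(** The rearrangements of [s] with a given suffix vary only by the order of the
    remaining prefix. *)
Lemma perms_by_suffix i s u0 : i <= size s -> u0 \in permutations s ->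
  perm_eq [seq u <- permutations s | drop i u == drop i u0]
          [seq u1 ++ drop i u0 | u1 <- permutations (take i u0)].
Proof.
move=> is_; rewrite mem_permutations => pu.
have szi : size (take i u0) = i by rewrite size_takel // (perm_size pu).
apply: uniq_perm => [||u].
- by rewrite filter_uniq // permutations_uniq.
- rewrite map_inj_uniq ?permutations_uniq // => a b e.
  have := congr1 size e; rewrite !size_cat => /addIn sab.
  by move/eqP: e; rewrite eqseq_cat // => /andP[/eqP].
rewrite mem_filter mem_permutations; apply/andP/mapP => [[/eqP e pus]|[u1 + ->]].
  exists (take i u); last by rewrite -e cat_take_drop.
  rewrite mem_permutations -(perm_cat2r (drop i u0)) -{1}e !cat_take_drop.
  by rewrite (perm_trans pus) // perm_sym.
rewrite mem_permutations => pu1; rewrite drop_size_cat ?(perm_size pu1) //.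
split=> //; apply: perm_trans pu.
by rewrite -[X in perm_eq _ X](cat_take_drop i u0) perm_cat2r.
Qed.

Lemma perms_by_prefix i s u0 : i <= size s -> u0 \in permutations s ->
  perm_eq [seq u <- permutations s | take i u == take i u0]
          [seq take i u0 ++ u2 | u2 <- permutations (drop i u0)].
Proof.
move=> is_; rewrite mem_permutations => pu.
have szi : size (take i u0) = i by rewrite size_takel // (perm_size pu).
apply: uniq_perm => [||u].
- by rewrite filter_uniq // permutations_uniq.
- rewrite map_inj_uniq ?permutations_uniq // => a b /eqP.
  by rewrite eqseq_cat // eqxx => /eqP.
rewrite mem_filter mem_permutations; apply/andP/mapP => [[/eqP e pus]|[u1 + ->]].
  exists (drop i u); last by rewrite -e cat_take_drop.
  rewrite mem_permutations -(perm_cat2l (take i u0)) -{1}e !cat_take_drop.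
  by rewrite (perm_trans pus) // perm_sym.
rewrite mem_permutations => pu1; rewrite take_size_cat //.
split=> //; apply: perm_trans pu.
by rewrite -[X in perm_eq _ X](cat_take_drop i u0) perm_cat2l.
Qed.

End Words.

Section NormalCoefficients.
Variables (k : comPzRingType) (q : k).
Local Notation series := (ncseries k).
Implicit Types (f g : series) (s u v : seq nat).

Local Notation nc := (normal_coef q).

Lemma nc_perm f s s' : perm_eq s s' -> nc f s = nc f s'.
Proof. by move=> ps; apply/perm_big/perm_permutations. Qed.

Lemma nc_ext f g s : (forall u, size u = size s -> f u = g u) -> nc f s = nc g s.
Proof.
move=> fg; apply: eq_big_seq => u; rewrite mem_permutations => /perm_size us.
by rewrite fg.
Qed.

Lemma Aq_rel_add x y : Aq_rel q x -> Aq_rel q y -> Aq_rel q (x + y).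
Proof.
elim=> [|c i j u v x' ji _ IHx] ry; first by rewrite add0r.
by rewrite -addrA; apply: Aq_relD; last exact: IHx.
Qed.

Lemma Aq_rel_scale c x : Aq_rel q x -> Aq_rel q (c *: x).
Proof.
elim=> [|d i j u v x' ji _ IHx]; first by rewrite scaler0; apply: Aq_rel0.
by rewrite scalerDr scalerA; apply: Aq_relD.
Qed.

Lemma Aq_rel_sum (I : eqType) (r : seq I) (F : I -> freemod k (seq nat)) :
  (forall i, i \in r -> Aq_rel q (F i)) -> Aq_rel q (\sum_(i <- r) F i).
Proof.
elim: r => [|i r IHr] rF; first by rewrite big_nil; apply: Aq_rel0.
rewrite big_cons; apply: Aq_rel_add; first by apply: rF; rewrite mem_head.
by apply: IHr => j jr; apply: rF; rewrite inE jr orbT.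
Qed.

(** Straightening by induction on the number of inversions: one relation
    exchanges the letters of an adjacent descent. *)
Lemma Aq_rel_sort u :
  Aq_rel q (bas k u - q ^+ inversions u *: bas k (sort leq u)).
Proof.
have [n] := ubnP (inversions u); elim: n u => // n IHn u.
rewrite ltnS => un; case: (boolP (sorted leq u)) => su.
  rewrite inversions_sorted // (sorted_sort leq_trans su) expr0 scale1r subrr.
  exact: Aq_rel0.
have [u1 [i [j [u2 [ji e]]]]] := sort_descent su.
have inv_u : inversions u = (inversions (u1 ++ [:: j; i] ++ u2)).+1.
  by rewrite e inversions_swap.
(* the word with the descent removed has one inversion less *)
have := IHn (u1 ++ [:: j; i] ++ u2); rewrite -inv_u => /(_ un) /(Aq_rel_scale q).
have -> : sort leq (u1 ++ [:: j; i] ++ u2) = sort leq u.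
  apply/(perm_sortP leq_total leq_trans anti_leq).
  by rewrite e perm_cat2l (perm_catCA [:: j] [:: i] u2).
move/(Aq_relD 1 u1 u2 ji); rewrite -e scale1r scalerBr addrA subrK scalerA.
by rewrite -exprS -inv_u.
Qed.

Let weight s (x : freemod k (seq nat)) : k^o :=
  lext (fun u => q ^+ inversions u * (perm_eq u s)%:R : k^o) x.

Let weight_linear s : linear (weight s).
Proof. exact: lext_linear. Qed.

Let weight_rel s x : Aq_rel q x -> weight s x = 0.
Proof.
elim=> [|c i j u v x' ji _ IHx]; first by rewrite (lin0 (weight_linear s)).
rewrite (linD (weight_linear s)) IHx addr0 (linZ (weight_linear s)).
rewrite (linD (weight_linear s)) -scaleN1r !(linZ (weight_linear s)).
rewrite /weight !lext_bas inversions_swap // exprS.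
have /permPl -> : perm_eq (u ++ [:: i; j] ++ v) (u ++ [:: j; i] ++ v).
  by rewrite perm_cat2l (perm_catCA [:: i] [:: j] v).
rewrite -[_ *: (_ *: _)]/(-1 * (q * _)) mulN1r mulrA subrr.
by rewrite -[LHS]/(c * 0) mulr0.
Qed.

Let weight_component s f : weight s (component f s) = nc f s.
Proof.
rewrite /component (lin_sum (weight_linear s)); apply: eq_big_seq => u.
rewrite mem_permutations => us; rewrite (linZ (weight_linear s)) /weight lext_bas us mulr1.
by rewrite mulrC.
Qed.

Lemma nc_sub s f g : nc (fun u => f u - g u) s = nc f s - nc g s.
Proof.
rewrite /normal_coef -sumrB; apply: eq_bigr => u _; exact: mulrBr.
Qed.

(** The weighted sum of coefficients over the rearrangements of [s] vanishes on
    the relations; conversely, straightening every word leaves only this sum in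
    front of the sorted word. *)
Lemma Aq_eqP f g : Aq_eq q f g <-> forall s, nc f s = nc g s.
Proof.
split=> [h s|h s].
  apply/eqP; rewrite -subr_eq0 -nc_sub -weight_component.
  by rewrite (weight_rel _ (h s)).
have : component (fun u => f u - g u) s =
    \sum_(u <- permutations s) (f u - g u) *: (bas k u - q ^+ inversions u *: bas k (sort leq u)).
  under eq_bigr do rewrite scalerBr.
  rewrite sumrB; rewrite [X in _ - X](_ : _ = 0) ?subr0 //.
  transitivity (\sum_(u <- permutations s)
     (q ^+ inversions u * (f u - g u)) *: bas k (sort leq s)).
    apply: eq_big_seq => u; rewrite mem_permutations => us.
    rewrite scalerA mulrC; congr (_ *: bas k _).
    exact/(perm_sortP leq_total leq_trans anti_leq).
  by rewrite -scaler_suml -/(nc _ s) nc_sub h subrr scale0r.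
move=> ->; apply: Aq_rel_sum => u _; apply: Aq_rel_scale; exact: Aq_rel_sort.
Qed.

Lemma nc_series_mul f g s : nc (series_mul f g) s =
  \sum_(i < (size s).+1) \sum_(u <- permutations s)
     q ^+ inversions u * (f (take i u) * g (drop i u)).
Proof.
rewrite exchange_big; apply: eq_big_seq => u.
rewrite mem_permutations => /perm_size us.
by rewrite /series_mul big_distrr us.
Qed.

(** For a fixed suffix, the inversions of the prefix separate from the others,
    which only depend on its letters; the sum over prefixes is then a normal
    coefficient. *)
Lemma nc_series_mull f f' g s : (forall s, nc f s = nc f' s) ->
  nc (series_mul f g) s = nc (series_mul f' g) s.
Proof.
move=> ff; rewrite !nc_series_mul; apply: eq_bigr => i _.
have is_ : (i <= size s)%N by rewrite -ltnS.
rewrite !(sum_by_image (permutations s) (drop i)); apply: eq_big_seq => t.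
rewrite mem_undup => /mapP[u0 u0s ->].
have szi : size (take i u0) = i.
  by move: u0s; rewrite mem_permutations => /perm_size e; rewrite size_takel ?e.
have E h : \sum_(u <- permutations s | drop i u == drop i u0)
     q ^+ inversions u * (h (take i u) * g (drop i u)) =
   q ^+ (inversions (drop i u0) + cross_inversions (take i u0) (drop i u0)) * g (drop i u0) *
   nc h (take i u0).
  rewrite -big_filter (perm_big _ (perms_by_suffix is_ u0s)) big_map.
  rewrite big_distrr; apply: eq_big_seq => u1; rewrite mem_permutations => pu1.
  have su1 : size u1 = i by rewrite (perm_size pu1).
  rewrite take_size_cat // drop_size_cat // inversions_cat (cross_inversions_perml _ pu1).
  by rewrite -addnA exprD [q ^+ inversions u1 * _]mulrC [h _ * _]mulrC mulrACA.
by rewrite !E ff.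
Qed.

Lemma nc_series_mulr f g g' s : (forall s, nc g s = nc g' s) ->
  nc (series_mul f g) s = nc (series_mul f g') s.
Proof.
move=> gg; rewrite !nc_series_mul; apply: eq_bigr => i _.
have is_ : (i <= size s)%N by rewrite -ltnS.
rewrite !(sum_by_image (permutations s) (take i)); apply: eq_big_seq => t.
rewrite mem_undup => /mapP[u0 u0s ->].
have szi : size (take i u0) = i.
  by move: u0s; rewrite mem_permutations => /perm_size e; rewrite size_takel ?e.
have E h : \sum_(u <- permutations s | take i u == take i u0)
     q ^+ inversions u * (f (take i u) * h (drop i u)) =
   q ^+ (inversions (take i u0) + cross_inversions (take i u0) (drop i u0)) * f (take i u0) *
   nc h (drop i u0).
  rewrite -big_filter (perm_big _ (perms_by_prefix is_ u0s)) big_map.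
  rewrite big_distrr; apply: eq_big_seq => u2; rewrite mem_permutations => pu2.
  rewrite take_size_cat // drop_size_cat // inversions_cat (cross_inversions_permr _ pu2).
  by rewrite addnAC exprD mulrACA.
by rewrite !E gg.
Qed.

End NormalCoefficients.

(** * Quasi-symmetric series *)

Section Multiplicities.
Local Open Scope nat_scope.
Implicit Types (a idx s u : seq nat).

(** For a sorted word, the composition a such that the word is a term of M_a. *)
Definition mults s : seq nat := [seq count_mem x s | x <- undup s].

Lemma is_comp_mults s : is_comp (mults s).
Proof.
by apply/allP => m /mapP[x]; rewrite mem_undup -has_pred1 has_count => xs ->.
Qed.

Definition mult_comp s : composition := Sub (mults s) (is_comp_mults s).

Lemma block_word_cons m a x idx :
  block_word (m :: a) (x :: idx) = nseq m x ++ block_word a idx.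
Proof. by []. Qed.

Lemma block_word_sub a idx : {subset block_word a idx <= idx}.
Proof.
elim: idx a => [|x idx IH] [|m a] //= y.
rewrite block_word_cons mem_cat inE mem_nseq => /orP[/andP[_ ->]|/IH->] //.
by rewrite orbT.
Qed.

Lemma block_word_map (g : nat -> nat) a idx :
  block_word a (map g idx) = map g (block_word a idx).
Proof.
elim: idx a => [|x idx IH] [|m a] //=.
by rewrite !block_word_cons map_cat map_nseq IH.
Qed.

Lemma size_block_word a idx : size a = size idx -> size (block_word a idx) = sumn a.
Proof.
elim: idx a => [|x idx IH] [|m a] //= [e].
by rewrite block_word_cons size_cat size_nseq IH.
Qed.

Lemma path_ltn_all x idx : path ltn x idx -> {in idx, forall y, x < y}.
Proof. by move/(order_path_min ltn_trans)/allP. Qed.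

Lemma sorted_block_word a idx : sorted ltn idx -> sorted leq (block_word a idx).
Proof.
elim: idx a => [|x idx IH] [|m a] //= px; rewrite block_word_cons.
have := IH a (path_sorted px); rewrite !(sorted_pairwise leq_trans).
rewrite pairwise_cat => ->; rewrite andbT; apply/andP; split.
  apply/allrelP => y z; rewrite mem_nseq => /andP[_ /eqP->] /block_word_sub zi.
  by rewrite ltnW // (path_ltn_all px).
by elim: m => //= m ->; rewrite andbT; apply/allP => y; rewrite mem_nseq => /andP[_ /eqP->].
Qed.

Lemma mults_block_word a idx : is_comp a -> size a = size idx ->
  sorted ltn idx -> mults (block_word a idx) = a.
Proof.
elim: idx a => [|x idx IH] [|m a] //= /andP[m0 ca] [sa] px.
have xW : x \notin block_word a idx.
  by apply/negP => /block_word_sub /(path_ltn_all px); rewrite ltnn.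
have -> : mults (block_word (m :: a) (x :: idx)) = m :: mults (block_word a idx).
  rewrite block_word_cons /mults; move: xW; set W := block_word a idx => xW.
  have -> : undup (nseq m x ++ W) = x :: undup W.
    case: m m0 => // m _ /=; elim: m => [|m IHm] /=; first by rewrite (negPf xW).
    by rewrite mem_head.
  rewrite map_cons count_cat count_nseq /= eqxx mul1n (count_memPn xW) addn0.
  congr (_ :: _); apply/eq_in_map => y; rewrite mem_undup => yW.
  rewrite count_cat count_nseq /=; case: eqP => // xy.
  by rewrite xy yW in xW.
by rewrite IH // (path_sorted px).
Qed.

Lemma sorted_undup s : sorted leq s -> sorted ltn (undup s).
Proof.
move=> ss; rewrite ltn_sorted_uniq_leq undup_uniq /=.
exact: subseq_sorted leq_trans _ _ (undup_subseq s) ss.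
Qed.

Lemma block_word_mults s : sorted leq s -> block_word (mults s) (undup s) = s.
Proof.
move=> ss; apply: (sorted_eq leq_trans anti_leq) => //.
  exact/sorted_block_word/sorted_undup.
rewrite /block_word /mults.
have -> : zip [seq count_mem x s | x <- undup s] (undup s) =
    [seq (count_mem x s, x) | x <- undup s].
  by elim: (undup s) => //= x t ->.
by rewrite -map_comp; apply: perm_count_undup.
Qed.


(** The word x_1^(a_1) ... x_r^(a_r), where the coefficient on M_a is read. *)
Definition packed_word a : seq nat := block_word a (iota 0 (size a)).

Lemma size_packed_word a : size (packed_word a) = sumn a.
Proof. by rewrite size_block_word // size_iota. Qed.

Lemma sorted_packed_word a : sorted leq (packed_word a).
Proof. by rewrite sorted_block_word // iota_ltn_sorted. Qed.

Lemma mults_packed_word a : is_comp a -> mults (packed_word a) = a.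
Proof. by move=> ca; rewrite mults_block_word ?size_iota ?iota_ltn_sorted. Qed.

Lemma block_word_des a idx i : is_comp a -> size a = size idx ->
  sorted ltn idx -> 0 < i < sumn a ->
  (nth 0 (block_word a idx) i.-1 == nth 0 (block_word a idx) i) = (i \notin des a).
Proof.
elim: idx a i => [|x idx IH] [|m a] i ca //= sa px ib; first by lia.
case: sa => sa; have [m0 ca'] := andP ca.
rewrite mem_des_cons // block_word_cons !nth_cat size_nseq.
case: (ltngtP i m) => im.
- by rewrite (_ : i.-1 < m) ?nth_nseq; [rewrite im (_ : i.-1 < m) ?eqxx ?andbF //; lia | lia].
- rewrite (_ : i.-1 < m = false); last by lia.
  rewrite (_ : i.-1 - m = (i - m).-1); last by lia.
  rewrite IH ?(path_sorted px) //; last by lia.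
  case: (boolP (i - m \in des a)) => nd /=; last by rewrite andbF.
  by rewrite andbT; case: (a) nd.
rewrite im (_ : m.-1 < m); last by lia.
rewrite nth_nseq (_ : m.-1 < m) ?subnn /=; last by lia.
have a0 : 0 < sumn a by lia.
have : nth 0 (block_word a idx) 0 \in idx.
  by apply: (@block_word_sub a); rewrite mem_nth // size_block_word.
move/(path_ltn_all px) => xlt; rewrite andbT (ltn_eqF xlt).
by case: (a) a0.
Qed.

Lemma mult_compE s : sorted leq s ->
  s = map (nth 0 (undup s)) (packed_word (mults s)).
Proof.
move=> ss; rewrite -{1}(block_word_mults ss) -block_word_map; congr block_word.
by rewrite -[LHS](mkseq_nth 0) /mkseq size_map.
Qed.

Lemma sumn_mults s : sumn (mults s) = size s.
Proof.
rewrite -[in RHS](perm_size (perm_count_undup s)) size_flatten /shape -map_comp.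
by congr sumn; apply: eq_map => x /=; rewrite size_nseq.
Qed.

Lemma mults_map (g : nat -> nat) s :
  {in s &, injective g} -> mults (map g s) = mults s.
Proof.
move=> ginj; rewrite /mults.
have -> : undup (map g s) = map g (undup s).
  elim: s ginj => //= x s IHs ginj; rewrite IHs; last first.
    by move=> y z ys zs; apply: ginj; rewrite inE (ys, zs) ?orbT.
  rewrite (_ : (g x \in map g s) = (x \in s)); first by case: ifP.
  apply/mapP/idP => [[y ys] /ginj ->|xs]; last by exists x.
  - by [].
  - by rewrite mem_head.
  - by rewrite inE ys orbT.
rewrite -map_comp; apply/eq_in_map => x; rewrite mem_undup => xs /=.
rewrite count_map; apply: eq_in_count => y ys /=.
by apply/eqP/eqP => [/ginj->|->].
Qed.

Lemma nth_undup_mono s : sorted leq s ->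
  {in packed_word (mults s) &, forall i j,
     (nth 0 (undup s) i <= nth 0 (undup s) j) = (i <= j)}.
Proof.
move=> ss i j; move=> /block_word_sub + /block_word_sub.
rewrite !mem_iota !add0n size_map => /= iu ju.
have h := sorted_ltn_nth ltn_trans 0 (sorted_undup ss).
case: (ltngtP i j) => [ij|ji|->]; last by rewrite leqnn.
  by rewrite ltnW // h.
by apply/negbTE; rewrite -ltnNge h.
Qed.

(** In a sorted word, the positions between the number of smaller letters and
    the number of weakly smaller letters carry the letter itself. *)
Lemma nth_rank s x j : sorted leq s ->
  count (fun y => y < x) s <= j < count (fun y => y <= x) s -> nth 0 s j = x.
Proof.
move=> ss /andP[lo hi].
have js : j < size s := leq_trans hi (count_size _ _).
have mono (b c : nat) : b <= c < size s -> nth 0 s b <= nth 0 s c.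
  by move=> /andP[bc cs]; apply: (sorted_leq_nth leq_trans leqnn) => //; rewrite inE; lia.
apply/eqP; rewrite eqn_leq; apply/andP; split; rewrite leqNgt; apply/negP => lt.
  move: hi; rewrite -{1}(cat_take_drop j s) count_cat.
  rewrite [X in _ + X](@eq_in_count _ _ pred0) ?count_pred0 => [|y /(nthP 0)[i]].
    have := count_size (fun y => y <= x) (take j s); rewrite size_takel; lia.
  rewrite size_drop nth_drop => is_ <- /=; apply/negbTE; rewrite -ltnNge.
  by apply: leq_trans lt _; apply: mono; rewrite leq_addr -ltn_subRL.
move: lo; rewrite -(cat_take_drop j.+1 s) count_cat.
rewrite (@eq_in_count _ _ predT (take _ _)) ?count_predT ?size_takel => [|//|y /(nthP 0)[i]]; first by lia.
rewrite size_takel // => ij <-; rewrite nth_take //=.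
by apply: leq_ltn_trans lt; apply: mono; rewrite -ltnS ij.
Qed.

End Multiplicities.

Section QuasiSymmetric.
Variables (k : comPzRingType) (q : k).
Local Notation series := (ncseries k).
Implicit Types (f g : series) (s u v : seq nat).
Local Notation nc := (normal_coef q).

Lemma sum_seq1 (V : nmodType) (T : eqType) (r : seq T) (F : T -> V) t :
  uniq r -> (forall i, i \in r -> i != t -> F i = 0) ->
  \sum_(u <- r) F u = if t \in r then F t else 0.
Proof.
move=> ur F0; case: ifPn => tr; last first.
  apply: big1_seq => u /andP[_ us]; apply: F0 => //.
  by apply: contraNneq tr => <-.
rewrite (big_rem t) //= big1_seq ?addr0 // => u /andP[_].
by rewrite mem_rem_uniq // inE => /andP[ut us]; apply: F0.
Qed.

Lemma M_seriesE (a : composition) u :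
  M_series k a u = (sorted leq u && (mult_comp u == a))%:R.
Proof.
rewrite /M_series -(inj_eq val_inj) /=; congr (nat_of_bool _)%:R.
apply/and3P/andP => [[/eqP su /[dup] sd /(sorted_block_word (val a)) sb /eqP e]|[su /eqP e]].
  by rewrite e; split=> //; rewrite mults_block_word ?(valP a).
by rewrite -e size_map eqxx sorted_undup // block_word_mults.
Qed.

Lemma nc_sorted_series f s : sorted leq s ->
  (forall u, ~~ sorted leq u -> f u = 0) -> nc f s = f s.
Proof.
move=> ss f0; rewrite /normal_coef (@sum_seq1 _ _ _ _ s) ?permutations_uniq //.
  by rewrite mem_permutations perm_refl inversions_sorted // expr0 mul1r.
move=> u; rewrite mem_permutations => us ne; rewrite f0 ?mulr0 //.
apply: contra ne => su; apply/eqP.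
exact: (sorted_eq leq_trans anti_leq).
Qed.

Lemma QSym_series_coef (x : freemod k composition) s : sorted leq s -> nc (QSym_series x) s = x@_(mult_comp s).
Proof.
move=> ss; rewrite nc_sorted_series // => [|u su]; last first.
  by rewrite /QSym_series big1 // => a _; rewrite M_seriesE (negPf su) mulr0.
rewrite /QSym_series -[RHS]mulr1 -(sum_pick x (mult_comp s) (fun=> 1)).
by apply: eq_bigr => a _; rewrite M_seriesE ss mulr1 eq_sym.
Qed.

Lemma QSym_series_inj (x y : freemod k composition) :
  (forall s, nc (QSym_series x) s = nc (QSym_series y) s) -> x = y.
Proof.
move=> xy; apply: fcoefP => a; have := xy (packed_word (val a)).
rewrite !QSym_series_coef ?sorted_packed_word //.
have -> // : mult_comp (packed_word (val a)) = a.
by apply: val_inj; rewrite /= mults_packed_word // (valP a).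
Qed.

Lemma nc_eq_sorted f g :
  (forall s, sorted leq s -> nc f s = nc g s) -> forall s, nc f s = nc g s.
Proof.
move=> fg s; have p : perm_eq s (sort leq s) by rewrite perm_sym perm_sort.
by rewrite !(nc_perm _ _ p) fg // sort_sorted.
Qed.

(** Quasi-symmetry of a series in noncommuting variables: invariance under
    monotone relabelling of words. *)
Definition quasi_symmetric f : Prop := forall (g : nat -> nat) u,
  {in u &, forall i j, (g i <= g j)%N = (i <= j)%N} -> f (map g u) = f u.

Lemma mono_inj_in (g : nat -> nat) u :
  {in u &, forall i j, (g i <= g j)%N = (i <= j)%N} -> {in u &, injective g}.
Proof.
move=> mg x y xu yu e; apply/eqP.
by rewrite eqn_leq -(mg x y) // -(mg y x) // e leqnn.
Qed.

Lemma nc_map f (g : nat -> nat) t : quasi_symmetric f ->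
  {in t &, forall i j, (g i <= g j)%N = (i <= j)%N} -> nc f (map g t) = nc f t.
Proof.
move=> qf mg; have gi := mono_inj_in mg.
pose h y := nth 0%N t (index y (map g t)).
have hK x : x \in t -> h (g x) = x.
  move=> xt; have gx : g x \in map g t by apply: map_f.
  have ix : (index (g x) (map g t) < size t)%N by rewrite -(size_map g) index_mem.
  apply: gi => //; first by rewrite mem_nth.
  by rewrite -(nth_map 0%N 0%N g) // nth_index.
have gK y : y \in map g t -> g (h y) = y by case/mapP=> x xt ->; rewrite hK.
have inj_u u : perm_eq u t -> map h (map g u) = u.
  move=> ut; rewrite -map_comp -[RHS]map_id; apply/eq_in_map => x xu /=.
  by rewrite hK // -(perm_mem ut).
have p : perm_eq (permutations (map g t)) (map (map g) (permutations t)).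
  apply: uniq_perm => [||u]; first exact: permutations_uniq.
    rewrite map_inj_in_uniq ?permutations_uniq // => u v.
    rewrite !mem_permutations => ut vt e.
    by rewrite -(inj_u _ ut) e inj_u.
  rewrite mem_permutations; apply/idP/mapP => [ut|[v]]; last first.
    by rewrite mem_permutations => vt ->; apply: perm_map.
  have e : map g (map h u) = u.
    rewrite -map_comp -[RHS]map_id; apply/eq_in_map => y yu /=.
    by rewrite gK // -(perm_mem ut).
  exists (map h u) => //; rewrite mem_permutations.
  by have := perm_map h ut; rewrite inj_u.
rewrite /normal_coef (perm_big _ p) big_map; apply: eq_big_seq => u.
rewrite mem_permutations => ut.
have mgu : {in u &, forall i j, (g i <= g j)%N = (i <= j)%N}.
  by move=> x y xu yu; apply: mg; rewrite -(perm_mem ut).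
by rewrite qf // -(inversions_same_order (same_order_map mgu)).
Qed.

(** A quasi-symmetric series is determined in A_q by its normal coefficients at
    packed words, because every sorted word is a monotone relabelling of one. *)
Lemma nc_M_expand n f s : quasi_symmetric f ->
  (forall u, size u != n -> f u = 0) ->
  nc (QSym_series (M_expand q n f)) s = nc f s.
Proof.
move=> qf f0; apply: nc_eq_sorted s => s ss; rewrite QSym_series_coef //.
rewrite (coef_big_bas _ (fun a : composition => nc f (packed_word (val a)))) ?comps_uniq //.
rewrite andbT mem_comps /= sumn_mults.
rewrite {3}(mult_compE ss) nc_map //; last exact: nth_undup_mono.
case: eqP => [_|/eqP ne]; first by rewrite mul1r.
rewrite mul0r; apply/esym/big1_seq => u /andP[_]; rewrite mem_permutations => /perm_size us.
by rewrite f0 ?mulr0 // us size_packed_word sumn_mults.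
Qed.

Lemma quasi_M (a : composition) : quasi_symmetric (M_series k a).
Proof.
move=> g u mg; rewrite !M_seriesE.
have -> : mult_comp (map g u) = mult_comp u.
  by apply: val_inj; rewrite /= mults_map //; apply: mono_inj_in.
congr (_ (_ && _))%:R.
rewrite sorted_map; case: u mg => //= x u.
elim: u x => //= y u IHu x mg; rewrite mg ?inE ?eqxx ?orbT // IHu // => i j iu ju.
by apply: mg; rewrite inE (iu, ju) orbT.
Qed.

Lemma quasi_mul f g : quasi_symmetric f -> quasi_symmetric g ->
  quasi_symmetric (series_mul f g).
Proof.
move=> qf qg h u mh; rewrite /series_mul size_map; apply: eq_bigr => i _.
rewrite -map_take -map_drop qf ?qg // => x y xu yu.
  by apply: mh; [apply: mem_drop xu | apply: mem_drop yu].
by apply: mh; [apply: mem_take xu | apply: mem_take yu].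
Qed.

End QuasiSymmetric.

(** * The series of a permutation and the product of QSym *)

Section QSymProduct.
Variables (k : comPzRingType) (q : k).
Local Notation series := (ncseries k).
Implicit Types (f g : series) (s u v : seq nat).
Local Notation nc := (normal_coef q).

Lemma QSym_series_bas (a : composition) u : QSym_series (bas k a) u = M_series k a u.
Proof. exact: (@lext_bas k _ k^o (fun a => M_series k a u)). Qed.

Lemma QSym_series_linear c (x y : freemod k composition) u :
  QSym_series (c *: x + y) u = c * QSym_series x u + QSym_series y u.
Proof. exact: (@lext_linear k _ k^o (fun a => M_series k a u)). Qed.

Lemma nc_linear c f g s :
  nc (fun u => c * f u + g u) s = c * nc f s + nc g s.
Proof.
rewrite /normal_coef big_distrr -big_split; apply: eq_bigr => u _ /=.
by rewrite mulrDr mulrCA.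
Qed.

Lemma series_mul_linearl c f f' g u : series_mul (fun u => c * f u + f' u) g u =
  c * series_mul f g u + series_mul f' g u.
Proof.
rewrite /series_mul big_distrr -big_split; apply: eq_bigr => i _ /=.
by rewrite mulrDl mulrA.
Qed.

Lemma series_mul_linearr c f g g' u : series_mul f (fun u => c * g u + g' u) u =
  c * series_mul f g u + series_mul f g' u.
Proof.
rewrite /series_mul big_distrr -big_split; apply: eq_bigr => i _ /=.
by rewrite mulrDr mulrCA.
Qed.

Lemma eq_series_mul f f' g g' u : f =1 f' -> g =1 g' ->
  series_mul f g u = series_mul f' g' u.
Proof. by move=> ff gg; apply: eq_bigr => i _; rewrite ff gg. Qed.

Lemma M_series_size (a : composition) u :
  size u != sumn (val a) -> M_series k a u = 0.
Proof.
rewrite M_seriesE; case: (mult_comp u =P a) => [<-|_]; last by rewrite andbF.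
by rewrite /= sumn_mults eqxx.
Qed.

(** Both sides are bilinear, and for basis vectors the product of QSym was
    defined by the normal coefficients of the product of series, which is
    quasi-symmetric. *)
Lemma nc_hmul_QSym x y s : nc (QSym_series (hmul (QSym q) x y)) s =
  nc (series_mul (QSym_series x) (QSym_series y)) s.
Proof.
move: x; apply: (@lin_eq _ _ k^o) => [c x x'|c x x'|a].
- rewrite (hmul_linl _ _ c x x') -[RHS]nc_linear; apply: nc_ext => u _.
  exact: QSym_series_linear.
- rewrite -[RHS]nc_linear; apply: nc_ext => u _; rewrite -series_mul_linearl.
  by apply: eq_series_mul => // v; apply: QSym_series_linear.
move: y; apply: (@lin_eq _ _ k^o) => [c y y'|c y y'|b].
- rewrite (hmul_linr _ _ c y y') -[RHS]nc_linear; apply: nc_ext => u _.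
  exact: QSym_series_linear.
- rewrite -[RHS]nc_linear; apply: nc_ext => u _; rewrite -series_mul_linearr.
  by apply: eq_series_mul => // v; apply: QSym_series_linear.
rewrite hmul_bas nc_M_expand.
- by apply: nc_ext => u _; apply: eq_series_mul => v; rewrite QSym_series_bas.
- by apply: quasi_mul; apply: quasi_M.
move=> u su; apply: big1 => i _.
have [ea|na] := eqVneq (size (take i u)) (sumn (val a)); last first.
  by rewrite M_series_size ?mul0r.
have [eb|nb] := eqVneq (size (drop i u)) (sumn (val b)); last first.
  by rewrite (@M_series_size b) ?mulr0.
by case/eqP: su; rewrite -ea -eb -size_cat cat_take_drop.
Qed.

Lemma sorted_leq_map (g : nat -> nat) u :
  {in u &, forall i j, (g i <= g j)%N = (i <= j)%N} ->
  sorted leq (map g u) = sorted leq u.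
Proof.
case: u => //= x u; rewrite path_map.
elim: u x => //= y u IHu x mg; rewrite mg ?inE ?eqxx ?orbT // IHu // => i j iu ju.
by apply: mg; rewrite inE (iu, ju) orbT.
Qed.

Lemma quasi_h n : quasi_symmetric (h_series k n).
Proof. by move=> g u mg; rewrite /h_series size_map sorted_leq_map. Qed.

Lemma QSym_in_AqP : QSym_in_Aq q.
Proof.
split.
- by move=> x y /Aq_eqP; apply: QSym_series_inj.
- apply/Aq_eqP => s; apply: nc_ext => u _; rewrite QSym_series_bas M_seriesE.
  congr (_ _)%:R; apply/andP/eqP => [[_ /eqP/(congr1 val)/= e]|-> //].
  by apply/nilP; rewrite /nilp -sumn_mults e.
- by move=> x y; apply/Aq_eqP => s; apply: nc_hmul_QSym.
- move=> n; apply/Aq_eqP => s; apply: nc_M_expand; first exact: quasi_h.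
  by move=> u /negPf un; rewrite /h_series un.
Qed.

(** The realization of the Malvenuto-Reutenauer algebra by series in
    noncommuting variables, in which a permutation is the sum of all words that
    standardize to it. *)
Definition std_series (x : freemod k permword) : series := fun u => x@_(st u).

Lemma std_series_mul x y u :
  series_mul (std_series x) (std_series y) u = std_series (hmul (MR q) x y) u.
Proof.
rewrite /std_series hmul_MR_coef stE size_st; apply: eq_bigr => i _.
by rewrite -stE st_take_st st_drop_st.
Qed.

Lemma quasi_std_series x : quasi_symmetric (std_series x).
Proof.
move=> g u mg; congr (_@__); apply/eq_st_of/same_order_sym/same_order_map.
exact: mg.
Qed.

Lemma size_std_series (w : permword) u :
  size u != size (val w) -> std_series (bas k w) u = 0.
Proof.
move=> uw; rewrite /std_series fcoef_bas; case: eqP => // e.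
by rewrite e stE size_st eqxx in uw.
Qed.

Section StandardWord.
Variables (b : composition) (w : permword).
Hypothesis sbw : sumn (val b) = size (val w).
Let s := packed_word (val b).
Let n := size (val w).
Let u0 := [seq nth 0%N s x.-1 | x <- val w].

Let ss : sorted leq s. Proof. exact: sorted_packed_word. Qed.
Let size_s : size s = n. Proof. by rewrite size_packed_word sbw. Qed.

Let u0_perm : perm_eq u0 s.
Proof.
apply: (@perm_trans _ [seq nth 0%N s x.-1 | x <- iota 1 n]).
  by apply: perm_map; apply: valP w.
rewrite (_ : map _ _ = s) //.
rewrite (iotaDl 1 0) -map_comp -[RHS](mkseq_nth 0%N) size_s.
exact: eq_map.
Qed.

Let st_unique u : perm_eq u s -> st_seq u = val w -> u = u0.
Proof.
move=> us e; have su : size u = n by rewrite (perm_size us) size_s.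
apply: (@eq_from_nth _ 0%N) => [|i iu]; first by rewrite size_map su.
rewrite (nth_map 0%N) -?/n -?su // -e.
rewrite /st_seq (nth_map 0%N) ?size_iota // nth_iota // add0n.
apply/esym/nth_rank => //; rewrite -!(permP us).
rewrite (_ : (st_at u i).-1 = count (fun y => y < nth 0 u i) u + count_mem (nth 0 u i) (take i u))%N //.
by rewrite leq_addr /=; apply: (st_at_le iu).
Qed.

Let st_u0 : (st_seq u0 == val w) = refine (perm_comp (perm_inv w)) b.
Proof.
rewrite refine_perm_comp size_perm_inv sbw eqxx /=.
have szi : sumn (val b) = size (val (perm_inv w)) by rewrite size_perm_inv.
have sz0 : size u0 = n by rewrite size_map.
have nth_u0 i : (i < n)%N -> nth 0%N u0 i = nth 0%N s (nth 0%N (val w) i).-1.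
  by move=> iw; rewrite (nth_map 0%N).
have idx i : (0 < i <= n)%N -> (index i (val w) < n)%N /\ nth 0%N (val w) (index i (val w)) = i.
  by move=> ib; rewrite index_mem nth_index mem_permword.
have descent i : (0 < i < n)%N -> i \notin des (val b) -> nth 0%N s i.-1 = nth 0%N s i.
  move=> ib nd; apply/eqP; rewrite block_word_des ?size_iota ?iota_ltn_sorted ?(valP b) //.
  by rewrite sbw.
apply/eqP/(reshape_sortedP (valP b) szi) => [/(stP _ (valP w)) [_ ord] i|inc].
  rewrite size_perm_inv => ib nd.
  have [i1 i2] := andP ib.
  have [lt_i nth_i] := idx i ltac:(by rewrite i1 ltnW).
  have [lt_i1 nth_i1] := idx i.+1 ltac:(by rewrite i2).
  rewrite !nth_perm_inv ?prednK //; last exact: ltnW.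
  rewrite ltnS ltnNge; apply/negP => le_idx.
  have ne : index i.+1 (val w) != index i (val w).
    by apply/eqP => e; move: nth_i; rewrite -e nth_i1 => /eqP; rewrite eqn_leq ltnn.
  have := ord (index i.+1 (val w)) (index i (val w)).
  rewrite sz0 ltn_neqAle ne le_idx lt_i => /(_ isT).
  by rewrite !nth_u0 // nth_i nth_i1 /= descent // leqnn ltnn.
apply/(stP _ (valP w)); split=> [|i j]; first by rewrite size_map.
rewrite sz0 => /andP[ij jn]; have iN := ltn_trans ij jn.
rewrite !nth_u0 //.
have wi : nth 0%N (val w) i \in val w by apply: mem_nth.
have wj : nth 0%N (val w) j \in val w by apply: mem_nth.
have ixi : index (nth 0%N (val w) i) (val w) = i by rewrite index_uniq ?uniq_permword.
have ixj : index (nth 0%N (val w) j) (val w) = j by rewrite index_uniq ?uniq_permword.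
move: wi wj ixi ixj; rewrite !mem_permword.
move: (nth 0%N (val w) i) (nth 0%N (val w) j) => x y /andP[x0 xn] /andP[y0 yn] ixi ixj.
have mono (c d : nat) : (c <= d)%N -> (d < n)%N -> (nth 0%N s c <= nth 0%N s d)%N.
  move=> cd dn; apply: (sorted_leq_nth leq_trans leqnn) => //.
    by rewrite inE size_s (leq_ltn_trans cd).
  by rewrite inE size_s.
case: (leqP x y) => [xy|yx].
  by apply: mono; [rewrite -ltnS !prednK | rewrite prednK].
apply/negbTE/negP => le_s.
have const c : (y.-1 <= c)%N -> (c <= x.-1)%N -> nth 0%N s c = nth 0%N s y.-1.
  move=> yc cx; have xn' : (x.-1 < n)%N by rewrite prednK.
  apply/eqP; rewrite eqn_leq (mono _ _ yc) ?(leq_ltn_trans cx) // andbT.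
  by apply: leq_trans le_s; apply: mono.
(* equal letters of the sorted word force the inverse to increase from y to x *)
have chain d : (y + d <= x)%N -> (0 < d)%N -> (index y (val w) < index (y + d)%N (val w))%N.
  elim: d => // d IHd yd _.
  have step : (index (y + d)%N (val w) < index (y + d.+1)%N (val w))%N.
    have b0 : (0 < y + d)%N by rewrite addn_gt0 y0.
    have bn : (y + d < n)%N by apply: leq_trans xn; rewrite addnS in yd.
    have := inc (y + d)%N; rewrite size_perm_inv b0 bn => /(_ isT).
    rewrite !nth_perm_inv ?prednK //; last exact: ltnW.
    rewrite ltnS addnS; apply.
    rewrite -(@block_word_des (val b) (iota 0 (size (val b)))) ?size_iota
      ?iota_ltn_sorted ?(valP b) ?sbw ?b0 //.
    rewrite -/(packed_word _) -/s !const //.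
    - by rewrite (leq_trans (leq_pred _)) ?leq_addr.
    - by rewrite -ltnS prednK // -addnS.
    - by rewrite -!subn1 leq_sub2r ?leq_addr.
    - by rewrite -!subn1 leq_sub2r // ltnW // -addnS.
  case: d IHd yd step => [|d] IHd yd step; first by rewrite addn0 in step.
  by apply: ltn_trans (IHd _ _) step => //; rewrite ltnW // -addnS.
have := chain (x - y)%N; rewrite subnKC; last exact: ltnW.
rewrite leqnn subn_gt0 => /(_ isT yx).
by rewrite ixi ixj ltnNge (ltnW ij).
Qed.

(** At most one rearrangement of a packed word standardizes to [w], and it does
    iff its equal letters occupy positions of increasing letters in the inverse
    of [w], that is, iff the inverse increases along the blocks of [b]. *)
Lemma nc_std_series_bas : nc (std_series (bas k w)) (packed_word (val b)) =
  q ^+ inversions (val w) * (refine (perm_comp (perm_inv w)) b)%:R.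
Proof.
rewrite -st_u0 /normal_coef (@sum_seq1 _ _ _ _ u0) ?permutations_uniq //.
  rewrite mem_permutations u0_perm /std_series fcoef_bas eq_sym -val_eqE stE.
  by case: eqP => [<-|_]; rewrite ?mulr0 ?inversions_st.
move=> u; rewrite mem_permutations => us ne; rewrite /std_series fcoef_bas.
case: eqP => [e|_]; last by rewrite mulr0.
by case/eqP: ne; apply: st_unique => //; rewrite e.
Qed.

End StandardWord.

Lemma pi'_linear : linear (@pi' k).
Proof. exact: lext_linear. Qed.

Lemma F_coef (w : permword) (b : composition) :
  (F_elt k (perm_comp w))@_b = (refine (perm_comp w) b)%:R.
Proof.
rewrite /F_elt; under eq_bigr do rewrite -[bas k _]scale1r.
rewrite coef_big_bas ?comps_uniq // mulr1 mem_comps /refine.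
by rewrite eq_sym; case: eqP.
Qed.

Lemma M_expand_std_series (w : permword) :
  M_expand q (size (val w)) (std_series (bas k w)) = pi' (theta q (bas k w)).
Proof.
rewrite theta_bas (linZ pi'_linear) [pi' _]lext_bas; apply: fcoefP => b.
rewrite (coef_big_bas _ (fun a : composition => nc (std_series (bas k w)) (packed_word (val a)))) ?comps_uniq //.
rewrite andbT mem_comps fcoefZ F_coef; case: eqP => [sb|ne].
  by rewrite mul1r nc_std_series_bas.
by rewrite refine_perm_comp size_perm_inv; case: eqP => //; rewrite mul0r mulr0.
Qed.

Lemma nc_pi'_theta x s : nc (QSym_series (pi' (theta q x))) s = nc (std_series x) s.
Proof.
move: x; apply: (@lin_eq _ _ k^o) => [c x y|c x y|w].
- rewrite theta_linear pi'_linear -[RHS]nc_linear; apply: nc_ext => u _.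
  exact: QSym_series_linear.
- rewrite -[RHS]nc_linear; apply: nc_ext => u _.
  by rewrite /std_series fcoefD fcoefZ.
rewrite -M_expand_std_series nc_M_expand //; first exact: quasi_std_series.
by move=> u; apply: size_std_series.
Qed.

(** The two multiplicative realizations by series have the same class in A_q. *)
Lemma pi'_theta_mul x y : pi' (theta q (hmul (MR q) x y)) =
  hmul (QSym q) (pi' (theta q x)) (pi' (theta q y)).
Proof.
apply: (@QSym_series_inj _ q) => s; rewrite nc_pi'_theta nc_hmul_QSym.
rewrite (nc_series_mull (f' := std_series x)); last exact: nc_pi'_theta.
rewrite (@nc_series_mulr _ q _ _ (std_series y)); last exact: nc_pi'_theta.
by apply: nc_ext => u _; rewrite std_series_mul.
Qed.

Lemma is_perm_iota n : is_perm (iota 1 n).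
Proof. by rewrite /is_perm size_iota. Qed.

Definition id_perm n : permword := Sub (iota 1 n) (is_perm_iota n).

Lemma st_eq_id n u : (id_perm n == st u) = (size u == n) && sorted leq u.
Proof.
rewrite -val_eqE eq_sym stE /=; apply/eqP/andP => [e|[/eqP su ss]].
  have [su ord] := (stP u (is_perm_iota n)).1 e; rewrite su size_iota; split=> //.
  apply/(sortedP 0%N) => i iu; rewrite ord ?iu ?ltnSn //.
  move: iu; rewrite su size_iota => iu.
  by rewrite !nth_iota ?(ltnW iu) // leq_add2l leqnSn.
apply/(stP u (is_perm_iota n)); split=> [|i j]; first by rewrite size_iota.
rewrite su => /andP[ij jn]; have iN := ltn_trans ij jn.
rewrite !nth_iota // leq_add2l (ltnW ij).
by apply: (sorted_leq_nth leq_trans leqnn) => //; rewrite ?inE ?su ?(ltnW ij).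
Qed.

Lemma h_elt_pi'_theta n : h_elt q n = pi' (theta q (bas k (id_perm n))).
Proof.
rewrite -M_expand_std_series /= size_iota; apply: eq_bigr => a _; congr (_ *: _).
by apply: nc_ext => u _; rewrite /std_series fcoef_bas st_eq_id.
Qed.

End QSymProduct.

(** * The maps pi' and iota *)

Section Blocks.
Local Open Scope nat_scope.
Implicit Types (a b u v : seq nat).

Lemma sorted_same_order u v : same_order u v -> uniq u -> uniq v ->
  sorted ltn u = sorted ltn v.
Proof.
move=> [suv ord] uu uv; rewrite !ltn_sorted_uniq_leq uu uv /=.
by apply/(sortedP 0)/(sortedP 0) => h i iu; have := h i;
  rewrite suv in iu * || rewrite -suv in iu *; move=> /(_ iu); rewrite ord ?suv ?ltnSn.
Qed.

Lemma reshape_cat a b u :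
  reshape (a ++ b) u = reshape a (take (sumn a) u) ++ reshape b (drop (sumn a) u).
Proof.
elim: a u => [|m a IHa] u /=; first by rewrite drop0.
rewrite IHa take_takel ?leq_addr // drop_drop addnC; congr (_ :: reshape _ _ ++ _).
by rewrite take_drop addnC.
Qed.

Lemma blocks_same_order b u v : same_order u v -> uniq u -> uniq v ->
  all (sorted ltn) (reshape b u) = all (sorted ltn) (reshape b v).
Proof.
elim: b u v => //= m b IHb u v uv uu uv'.
rewrite (@sorted_same_order _ (take m v)) ?take_uniq //; last exact: same_order_take.
by rewrite (IHb _ (drop m v)) ?drop_uniq //; apply: same_order_drop.
Qed.

Lemma blocks_st b u : uniq u ->
  all (sorted ltn) (reshape b (st_seq u)) = all (sorted ltn) (reshape b u).
Proof.
move=> uu; apply: blocks_same_order => //; first exact/same_order_sym/same_order_st.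
exact: perm_uniqP (is_perm_st u).
Qed.

End Blocks.

Section RefineCat.
Variable k : comPzRingType.

(** Only the cut at position [sumn b] contributes; the blocks of [b] lie before
    it and those of [c] after it. This is the compatibility of pi' with
    coproducts and of iota with products. *)
Lemma refine_cat_sum (z : permword) (b c : composition) :
  \sum_(i < (size (val z)).+1)
    (refine (perm_comp (st (take i (val z)))) b)%:R *
    (refine (perm_comp (st (drop i (val z)))) c)%:R =
  (refine (perm_comp z) (comp_cat b c))%:R :> k.
Proof.
rewrite (sum_pick_ord (m := sumn (val b)) (F := fun i =>
    (refine (perm_comp (st (take i (val z)))) b)%:R *
    (refine (perm_comp (st (drop i (val z)))) c)%:R)).
  rewrite !refine_perm_comp !stE !size_st !blocks_st ?take_uniq ?drop_uniq ?uniq_permword //.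
  rewrite /= sumn_cat reshape_cat all_cat -natrM mulnb.
  case: leqP => sb.
    rewrite size_takel // eqxx size_drop /=.
    rewrite -[sumn (val c) == _](eqn_add2l (sumn (val b))) subnKC //.
    by rewrite andbCA.
  case: eqP => // e; by move: sb; rewrite -e ltnNge leq_addr.
move=> i iz ne; rewrite refine_perm_comp stE size_st size_takel // eq_sym (negPf ne).
by rewrite mul0r.
Qed.

Lemma refine_perm0 (b : composition) : refine (perm_comp perm0) b = (b == comp0).
Proof.
rewrite refine_perm_comp -val_eqE /=; case: b => -[|m b] //= /andP[m0 _].
by rewrite addn_eq0 (gtn_eqF m0).
Qed.

Lemma refine_comp0 w : refine (perm_comp w) comp0 = (w == perm0).
Proof. by rewrite refine_perm_comp size_eq0_perm0 /= andbT eq_sym. Qed.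

End RefineCat.

Section PiPrime.
Variables (k : comPzRingType) (q : k).
Hypothesis hq : exists p : k, p * q = 1.

Lemma pi'_bas w : pi' (bas k w) = F_elt k (perm_comp w).
Proof. exact: lext_bas. Qed.

Lemma pi'_mul x y :
  pi' (hmul (MR' q) x y) = hmul (QSym q) (pi' x) (pi' y).
Proof.
have [p pq] := hq; have [_ [g [_ _ gK]]] := theta_iso pq.
by rewrite -(gK x) -(gK y) -theta_mul pi'_theta_mul.
Qed.

Lemma QSym_copr_coef (b c d : composition) :
  (bcopr (QSym q) b)@_(c, d) = (b == comp_cat c d)%:R.
Proof.
rewrite fcoef_sum (sum_pick_ord (m := size (val c)) (F := fun i =>
   (bas k (comp_take i b, comp_drop i b))@_(c, d))).
  rewrite fcoef_bas xpair_eqE -!val_eqE /=; case: leqP => cb.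
    congr (_ _)%:R; apply/andP/eqP => [[/eqP<- /eqP<-]|->].
      by rewrite size_takel // cat_take_drop.
    by rewrite take_size_cat // drop_size_cat.
  by case: eqP => // e; move: cb; rewrite e size_cat ltnNge leq_addr.
move=> i ib ne; rewrite fcoef_bas xpair_eqE -!val_eqE /=.
case: eqP => //= e; case/eqP: ne.
by rewrite -[size (val c)](congr1 size e) size_takel.
Qed.

Lemma pi'_morph : qhopf_morph (MR' q) (QSym q) (@pi' k).
Proof.
apply: qhopf_morph_bas.
- exact: pi'_linear.
- move=> w; rewrite pi'_bas; apply: in_degree_sum => b.
  rewrite mem_comps sumn_perm_comp => /eqP bw _; rewrite -[bdeg _ _]bw.
  exact: (@in_degree_bas k _ (fun a : composition => sumn (val a))).
- by move=> w w'; rewrite -pi'_mul hmul_bas.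
- rewrite pi'_bas; apply: fcoefP => b.
  by rewrite F_coef refine_perm0 fcoef_bas eq_sym.
- move=> w; rewrite pi'_bas; apply: fcoefP => -[b c].
  rewrite lext_coef; under eq_bigr do rewrite QSym_copr_coef -[_%:R]mulr1.
  rewrite (sum_pick _ _ (fun=> 1)) mulr1 F_coef -refine_cat_sum.
  rewrite (lin_sum (@tmap_linear _ _ _ _ _ _ _)) fcoef_sum.
  by apply: eq_bigr => i _; rewrite tmap_bas tens_coef !pi'_bas !F_coef.
- move=> w; rewrite pi'_bas (@coun_unit _ _ (QSym q) comp0) //.
  by rewrite F_coef refine_comp0.
Qed.

(** F_b is M_b plus terms M_c with more parts; induction downwards on the number
    of parts. *)
Lemma pi'_surjective (y : freemod k composition) : exists x, pi' x = y.
Proof.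
suff hb (b : composition) : exists x, pi' x = bas k b.
  rewrite (lin_lext (@lin_id k _) y) /lext.
  elim/big_ind: _ => [|_ _ [x <-] [x' <-]|b _].
  - by exists 0; rewrite (lin0 (@pi'_linear k)).
  - by exists (x + x'); rewrite (linD (@pi'_linear k)).
  by have [x <-] := hb b; exists (y@_b *: x); rewrite (linZ (@pi'_linear k)).
have size_le (c : composition) : (size (val c) <= sumn (val c))%N.
  by case: c => s; elim: s => //= m s IHs /andP[m0 /IHs]; lia.
have [n] := ubnP (sumn (val b) - size (val b)); elim: n b => // n IHn b bn.
(* the terms of F_b other than M_b *)
have sum_longer : exists x, pi' x =
    \sum_(c <- comps (sumn (val b)) | refine b c && (c != b)) bas k c.
  rewrite big_seq_cond; elim/big_ind: _ => [|_ _ [x <-] [x' <-]|c].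
  - by exists 0; rewrite (lin0 (@pi'_linear k)).
  - by exists (x + x'); rewrite (linD (@pi'_linear k)).
  rewrite mem_comps => /andP[/eqP cb /andP[/refine_eq_or_longer[->|lt] ne]].
    by rewrite eqxx in ne.
  apply: IHn; rewrite cb; have := size_le c; rewrite cb.
  by move: lt bn; move: (size (val c)) (size (val b)) (sumn (val b)) => x1 x2 x3; lia.
have [x hx] := sum_longer; exists (bas k (run_perm b) - x).
rewrite -scaleN1r addrC (@pi'_linear k) scaleN1r hx pi'_bas perm_comp_run.
rewrite /F_elt [X in _ + X](bigID (fun c => c != b)) /= addrA addNr add0r.
rewrite (eq_bigl (pred1 b)) => [|c].
  by rewrite -big_filter filter_pred1_uniq ?comps_uniq ?big_seq1 // mem_comps.
by rewrite negbK /=; case: eqP => [->|]; rewrite ?andbF // refine_refl.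
Qed.

Lemma comp_sum0 (b : composition) : sumn (val b) = 0%N -> b = comp0.
Proof.
by case: b => -[|m b] cb /= e; [apply: val_inj | case/andP: (cb) => m0 _; lia].
Qed.

Lemma QSym_qHopf : graded_qHopf q (QSym q).
Proof.
have [p pq] := hq.
apply: (@qHopf_of_surjective _ q _ _ _ _ _ pi'_morph comp0) => //.
- exact: pi'_surjective.
- move=> b c; apply: in_degree_sum => d; rewrite mem_comps => /eqP <- _.
  apply: in_degreeZ; exact: (@in_degree_bas k _ (fun a : composition => sumn (val a))).
- move=> b; pose d (r : composition * composition) := (sumn (val r.1) + sumn (val r.2))%N.
  apply: (@in_degree_sum _ _ d) => i _ _.
  have -> : bdeg (QSym q) b = d (comp_take i b, comp_drop i b).
    by rewrite /d /= -sumn_cat cat_take_drop.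
  exact: in_degree_bas.
- exact: comp_sum0.
- exact: MR'_qHopf pq.
Qed.

End PiPrime.

Section Iota.
Variables (k : comPzRingType) (q : k).

Lemma iota_linear : linear (@iota_map k).
Proof. exact: lext_linear. Qed.

Lemma iota_coef (b : composition) z :
  (iota_map (bas k b))@_z = (refine (perm_comp z) b)%:R.
Proof.
rewrite [iota_map _]lext_bas; under eq_bigr do rewrite -[bas k _]scale1r.
rewrite coef_big_bas ?permwords_uniq // mulr1 mem_permwords.
by rewrite refine_perm_comp [sumn _ == _]eq_sym andbA andbb.
Qed.

Lemma iota_cat (b c : composition) : iota_map (bas k (comp_cat b c)) =
  hmul (MR q) (iota_map (bas k b)) (iota_map (bas k c)).
Proof.
apply: fcoefP => z; rewrite iota_coef hmul_MR_coef -refine_cat_sum.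
by apply: eq_bigr => i _; rewrite !iota_coef.
Qed.

Lemma iota_mul x y :
  iota_map (hmul (NSym q) x y) = hmul (MR q) (iota_map x) (iota_map y).
Proof.
move: x; apply: lin_eq => [||b].
- by apply: (lin_comp iota_linear); apply: hmul_linl.
- by apply: lin_comp (hmul_linl _ _) iota_linear.
move: y; apply: lin_eq => [||c].
- by apply: (lin_comp iota_linear); apply: hmul_linr.
- by apply: lin_comp (@hmul_linr _ _ _ _) iota_linear.
by rewrite hmul_bas iota_cat.
Qed.

Lemma iota_one : iota_map (bas k comp0) = bas k perm0.
Proof.
by apply: fcoefP => z; rewrite iota_coef refine_comp0 fcoef_bas eq_sym.
Qed.

Lemma sorted_permword (w : permword) : sorted ltn (val w) -> w = id_perm (size (val w)).
Proof.
move=> sw; apply: val_inj; apply: (irr_sorted_eq ltn_trans ltnn) => //.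
  exact: iota_ltn_sorted.
exact: perm_mem (valP w).
Qed.

Lemma size_id_perm n : size (val (id_perm n)) = n.
Proof. exact: size_iota. Qed.

(** Only the identity permutation has no descent. *)
Lemma iota_part n : iota_map (bas k (comp_part n)) = bas k (id_perm n).
Proof.
apply: fcoefP => z; rewrite iota_coef fcoef_bas refine_perm_comp; congr (_ _)%:R.
have -> : sumn (val (comp_part n)) = n by case: n => //= n; rewrite addn0.
apply/andP/eqP => [[/eqP nz hz]|<-].
  have sz : sorted ltn (val z).
    case: n nz hz => [|n] nz /=; first by move/esym/size0nil: nz => ->.
    by rewrite nz take_size andbT.
  by rewrite [RHS](sorted_permword sz) -nz.
rewrite size_id_perm; split=> //; case: n => //= n.
by rewrite take_oversize ?size_iota // andbT; apply: (iota_ltn_sorted 1 n.+1).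
Qed.

Lemma inv_at_id i n : inv_at i (iota 1 n) = 0%N.
Proof.
have := inversions_restr i (iota 1 n).
by rewrite (inversions_sorted (iota_sorted 1 n)) => /esym/eqP; rewrite addn_eq0 => /andP[_ /eqP].
Qed.

Lemma copr_iota_part n : copr (MR q) (iota_map (bas k (comp_part n))) =
  tmap (@iota_map k) (@iota_map k) (NSym_copr_gen k n).
Proof.
rewrite iota_part copr_bas (lin_sum (@tmap_linear _ _ _ _ _ _ _)).
rewrite -[LHS]/(\sum_(i < (size (val (id_perm n))).+1) q ^+ inv_at i (iota 1 n) *:
  bas k (perm_restr i (id_perm n), st [seq x <- val (id_perm n) | (i < x)%N])).
rewrite size_id_perm.
apply: eq_bigr => i _; have iN : (i <= n)%N by rewrite -ltnS.
rewrite inv_at_id expr0 scale1r tmap_bas !iota_part tens_bas.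
have szi : (i <= size (val (id_perm n)))%N by rewrite size_id_perm.
congr (bas k (_, _)).
  rewrite (@sorted_permword (perm_restr i _)) ?size_perm_restr //.
  by rewrite perm_restrE sorted_filter ?iota_ltn_sorted //; apply: ltn_trans.
set u := [seq _ <- _ | _].
have uu : uniq u by rewrite filter_uniq ?uniq_permword.
rewrite (@sorted_permword (st u)) ?stE ?size_st ?size_restr_gt ?size_id_perm //.
rewrite -(@sorted_same_order _ _ (same_order_st u) uu (perm_uniqP (is_perm_st u))).
by rewrite sorted_filter ?iota_ltn_sorted //; apply: ltn_trans.
Qed.

Lemma iota_homog b : homog (MR q) (bdeg (NSym q) b) (iota_map (bas k b)).
Proof.
rewrite [iota_map _]lext_bas; apply: in_degree_sum => w.
rewrite mem_permwords => /eqP bw _; rewrite -[bdeg _ _]bw.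
exact: (@in_degree_bas k _ (fun w : permword => size (val w))).
Qed.

Lemma comp_cons n s (c : is_comp (n :: s)) (c' : is_comp s) :
  exist _ (n :: s) c = comp_cat (comp_part n) (exist _ s c').
Proof. by apply: val_inj => /=; case: n c. Qed.

Section WithInverse.
Hypothesis hq : exists p : k, p * q = 1.

(** Compatibility with coproducts is multiplicative in both algebras, so it
    reduces to the generators H_n, whose images are identity permutations. *)
Lemma iota_morph : qhopf_morph (NSym q) (MR q) (@iota_map k).
Proof.
have [p pq] := hq.
apply: qhopf_morph_bas.
- exact: iota_linear.
- exact: iota_homog.
- by move=> b c; rewrite -iota_mul hmul_bas.
- exact: iota_one.
- case; elim=> [|n s IHs] cs.
    rewrite (_ : exist _ _ _ = comp0); last exact: val_inj.
    rewrite iota_one copr_bas tmap_bas !iota_one tens_bas.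
    rewrite -[LHS]/(\sum_(i < 1) _) big_ord1 expr0 scale1r.
    by congr (bas k (_, _)); apply: val_inj.
  have cs' : is_comp s by case/andP: cs.
  rewrite (comp_cons cs cs') iota_cat (qh_copr_mul (MR_qHopf pq)) copr_iota_part IHs.
  rewrite -(tmap_tmul_of q iota_linear iota_homog iota_mul).
  by congr tmap; case: n cs.
- move=> b; rewrite (@coun_unit _ _ (MR q) perm0) // iota_coef.
  by rewrite refine_perm0.
Qed.

Lemma iota_triangular : triangular (fun b => iota_map (bas k b)) run_perm
  (fun b : composition => size (val b)).
Proof.
split=> [b|b c]; rewrite iota_coef perm_comp_run.
  by exists 1; rewrite refine_refl mulr1.
by case: (boolP (refine c b)) => [/refine_eq_or_longer[]|_]; [left | right | rewrite eqxx].
Qed.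

Lemma iota_injective : injective (@iota_map k).
Proof.
move=> x y; rewrite !(lin_lext iota_linear); exact: (triangular_inj iota_triangular).
Qed.

Lemma NSym_qHopf : graded_qHopf q (NSym q).
Proof.
have [p pq] := hq.
apply: (@qHopf_of_injective _ q _ _ _ _ _ iota_morph _ _ comp0 iota_triangular) => //.
- exact: comp_sum0.
- exact: MR_qHopf pq.
Qed.

(** Both sides are algebra homomorphisms that send H_n to h_n. *)
Lemma pi'_theta_iota x :
  pi' (theta q (iota_map x)) = Sym_incl (phi q x).
Proof.
rewrite -[RHS]/(phi_val q x); move: x; apply: lin_eq => [||b].
- apply: (lin_comp (@pi'_linear k)).
  by apply: (lin_comp (@theta_linear k q)); apply: iota_linear.
- exact: lext_linear.
rewrite [phi_val _ _]lext_bas; case: b; elim=> [|n s IHs] cs.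
  rewrite (_ : exist _ _ _ = comp0); last exact: val_inj.
  by rewrite iota_one theta_one (qm_one (pi'_morph hq)).
have cs' : is_comp s by case/andP: cs.
rewrite (comp_cons cs cs') iota_cat pi'_theta_mul iota_part -h_elt_pi'_theta IHs.
by case: n cs.
Qed.

End WithInverse.
End Iota.

(** * Knuth equivalence and row insertion *)

Section Plactic.
Local Open Scope nat_scope.
Implicit Types (r s u v w : seq nat) (t : seq (seq nat)) (x y z : nat).

Inductive knuth : seq nat -> seq nat -> Prop :=
| knuth_refl w : knuth w w
| knuth_sym w w' : knuth w w' -> knuth w' w
| knuth_trans w w' w'' : knuth w w' -> knuth w' w'' -> knuth w w''
| knuth_yzx u v x y z : x < y < z ->
    knuth (u ++ [:: y; z; x] ++ v) (u ++ [:: y; x; z] ++ v)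
| knuth_xzy u v x y z : x < y < z ->
    knuth (u ++ [:: x; z; y] ++ v) (u ++ [:: z; x; y] ++ v).

Lemma knuth_cat u v w w' : knuth w w' -> knuth (u ++ w ++ v) (u ++ w' ++ v).
Proof.
elim=> [w0|w0 w1 _ IH|w0 w1 w2 _ IH1 _ IH2|u' v' x y z h|u' v' x y z h].
- exact: knuth_refl.
- exact: knuth_sym.
- exact: knuth_trans IH1 IH2.
- by have := knuth_yzx (u ++ u') (v' ++ v) h; rewrite -!catA.
- by have := knuth_xzy (u ++ u') (v' ++ v) h; rewrite -!catA.
Qed.

Lemma knuth_catl u w w' : knuth w w' -> knuth (u ++ w) (u ++ w').
Proof. by move/(knuth_cat u [::]); rewrite !cats0. Qed.

Lemma knuth_catr v w w' : knuth w w' -> knuth (w ++ v) (w' ++ v).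
Proof. exact: (@knuth_cat [::]). Qed.

Lemma knuth_perm w w' : knuth w w' -> perm_eq w w'.
Proof.
elim=> [//|w0 w1 _|w0 w1 w2 _ p1 _|u v x y z _|u v x y z _].
- by rewrite perm_sym.
- exact: perm_trans p1.
- rewrite perm_cat2l perm_cat2r perm_cons; exact: permEl (perm_catC [:: z] [:: x]).
- rewrite perm_cat2l perm_cat2r; exact: permEl (perm_catCA [:: x] [:: z] [:: y]).
Qed.

Lemma knuth_map (g : nat -> nat) w w' :
  {in w &, {homo g : x y / x < y}} -> knuth w w' -> knuth (map g w) (map g w').
Proof.
move=> + k; elim: k => [w0|w0 w1 k IH|w0 w1 w2 k1 IH1 _ IH2|u v x y z h|u v x y z h] gm.
- exact: knuth_refl.
- apply/knuth_sym/IH => x y; rewrite !(perm_mem (knuth_perm k)); exact: gm.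
- apply: knuth_trans (IH1 gm) _; apply: IH2 => x y.
  by rewrite -!(perm_mem (knuth_perm k1)); apply: gm.
- case/andP: h => xy yz; rewrite !map_cat; apply: knuth_yzx.
  by rewrite !gm ?mem_cat ?inE ?eqxx ?orbT.
- case/andP: h => xy yz; rewrite !map_cat; apply: knuth_xzy.
  by rewrite !gm ?mem_cat ?inE ?eqxx ?orbT.
Qed.

(** The two letters exchanged in a Knuth relation are the extreme ones; a set of
    letters that contains both and is convex contains the third. *)
Lemma knuth_filter (p : pred nat) w w' :
  (forall x y z, x < y < z -> p x -> p z -> p y) ->
  knuth w w' -> knuth (filter p w) (filter p w').
Proof.
move=> hp; elim=> [w0|w0 w1 _ IH|w0 w1 w2 _ IH1 _ IH2|u v x y z h|u v x y z h].
- exact: knuth_refl.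
- exact: knuth_sym.
- exact: knuth_trans IH1 IH2.
- have := hp _ _ _ h; rewrite !filter_cat /=.
  case: (p x); case: (p y); case: (p z) => // hy; try exact: knuth_refl.
    exact: knuth_yzx.
  by have := hy isT isT.
- have := hp _ _ _ h; rewrite !filter_cat /=.
  case: (p x); case: (p y); case: (p z) => // hy; try exact: knuth_refl.
    exact: knuth_xzy.
  by have := hy isT isT.
Qed.

(** Both sides of an elementary Knuth relation have a descent. *)
Lemma knuth_sorted w w' : knuth w w' ->
  w = w' \/ ~~ sorted ltn w /\ ~~ sorted ltn w'.
Proof.
have nsort u v x y z : x < z -> ~~ sorted ltn (u ++ [:: y; z; x] ++ v) /\
    ~~ sorted ltn (u ++ [:: z; x; y] ++ v).
  move=> xz; rewrite !(sorted_pairwise ltn_trans) !pairwise_cat /= !andbA.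
  by rewrite [z < x]ltnNge (ltnW xz) !(andbF, andFb).
elim=> [w0|w0 w1 _ []|w0 w1 w2 _ IH1 _ IH2|u v x y z /andP[xy yz]|u v x y z /andP[xy yz]].
- by left.
- by move=> ->; left.
- by case; right.
- case: IH1 IH2 => [->|[n0 n1]] [e|[n1' n2]]; first by left.
  + by right.
  + by right; rewrite -e.
  + by right.
- right; have [h _] := nsort u v x y z (ltn_trans xy yz); split=> //.
  rewrite !(sorted_pairwise ltn_trans) !pairwise_cat /= !andbA.
  by rewrite [y < x]ltnNge (ltnW xy) !(andbF, andFb).
- right; have [_ h] := nsort u v x y z (ltn_trans xy yz); split=> //.
  rewrite !(sorted_pairwise ltn_trans) !pairwise_cat /= !andbA.
  by rewrite [z < y]ltnNge (ltnW yz) !(andbF, andFb).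
Qed.

(** Insertion into one row, with the bumped letter made explicit so that a
    tableau can be treated row by row. *)
Definition row_insert r x : seq nat * option nat :=
  let p := find (fun y => x < y) r in
  if p == size r then (rcons r x, None) else (set_nth 0 r p x, Some (nth 0 r p)).

Definition bumped (o : option nat) : seq nat := if o is Some y then [:: y] else [::].

(** Insertion of a word into one row; the second component is the word of bumped
    letters, which is inserted into the rows below. *)
Fixpoint row_inserts r w : seq nat * seq nat :=
  if w is x :: w' then
    let ro := row_insert r x in
    let rw := row_inserts ro.1 w' in (rw.1, bumped ro.2 ++ rw.2)
  else (r, [::]).

Lemma insert_cons r t x : insert (r :: t) x =
  (row_insert r x).1 :: foldl insert t (bumped (row_insert r x).2).
Proof. by rewrite /row_insert /=; case: ifP. Qed.

Lemma inserts_cons r t w : foldl insert (r :: t) w =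
  (row_inserts r w).1 :: foldl insert t (row_inserts r w).2.
Proof.
elim: w r t => //= x w IHw r t.
rewrite -[if _ == _ then _ else _]/(insert (r :: t) x) insert_cons IHw.
by rewrite foldl_cat.
Qed.

Lemma row_insert_last r x : all (fun y => y <= x) r -> row_insert r x = (rcons r x, None).
Proof.
move=> rx; rewrite /row_insert (_ : find _ r = size r) ?eqxx //.
apply/hasNfind; rewrite -all_predC; apply: sub_all rx => y /=.
by rewrite -leqNgt.
Qed.

Lemma row_insert_bump r1 y r2 x : all (fun y => y <= x) r1 -> x < y ->
  row_insert (r1 ++ y :: r2) x = (r1 ++ x :: r2, Some y).
Proof.
move=> r1x xy; have nh : ~~ has (fun y => x < y) r1.
  by rewrite -all_predC; apply: sub_all r1x => z /=; rewrite -leqNgt.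
have e : find (fun y => x < y) (r1 ++ y :: r2) = size r1.
  by rewrite find_cat (negPf nh) /= xy addn0.
rewrite /row_insert e size_cat /= -[X in X == _]addn0 eqn_add2l /=.
rewrite nth_cat ltnn subnn /=; congr (_, _).
by elim: r1 {r1x nh e} => //= a r1 ->.
Qed.

Lemma row_insertP r x : all (fun y => y <= x) r \/
  exists r1 y r2, [/\ r = r1 ++ y :: r2, all (fun y => y <= x) r1 & x < y].
Proof.
elim: r => [|a r [IHr|[r1 [y [r2 [-> h xy]]]]]]; first by left.
- case: (leqP a x) => ax; first by left; rewrite /= ax.
  by right; exists [::], a, r.
- case: (leqP a x) => ax; last by right; exists [::], a, (r1 ++ y :: r2).
  by right; exists (a :: r1), y, r2; rewrite /= ax.
Qed.

Lemma row_insert_catr r1 r2 x : all (fun y => y <= x) r1 ->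
  row_insert (r1 ++ r2) x = (r1 ++ (row_insert r2 x).1, (row_insert r2 x).2).
Proof.
move=> h; case: (row_insertP r2 x) => [h2|[a [y [b [-> ha xy]]]]].
  by rewrite !row_insert_last ?all_cat ?h // rcons_cat.
by rewrite catA !row_insert_bump ?all_cat ?h // catA.
Qed.

Lemma row_insert_catl r1 r2 x : has (fun y => x < y) r1 ->
  row_insert (r1 ++ r2) x = ((row_insert r1 x).1 ++ r2, (row_insert r1 x).2).
Proof.
case: (row_insertP r1 x) => [h /hasP[y /(allP h)]|[a [y [b [-> ha xy]]]] _].
  by rewrite leqNgt => /negPf->.
by rewrite -catA /= !row_insert_bump // -catA.
Qed.

Lemma row_insert_perm r x :
  perm_eq ((row_insert r x).1 ++ bumped (row_insert r x).2) (x :: r).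
Proof.
case: (row_insertP r x) => [h|[a [y [b [-> ha xy]]]]].
  by rewrite row_insert_last //= cats0 perm_rcons.
rewrite row_insert_bump //; apply/permP => p.
by rewrite /= !count_cat /=; lia.
Qed.

Lemma row_insert_sorted r x : sorted ltn r -> x \notin r ->
  sorted ltn (row_insert r x).1.
Proof.
rewrite !(sorted_pairwise ltn_trans).
case: (row_insertP r x) => [h|[a [y [b [-> ha xy]]]]] sr xr.
  rewrite row_insert_last //= -cats1 pairwise_cat sr /= andbT; apply/allrelP.
  move=> y x' yr; rewrite inE => /eqP ->; rewrite ltn_neqAle (allP h) // andbT.
  by apply: contraNneq xr => <-.
move: sr xr; rewrite row_insert_bump //= !pairwise_cat /= mem_cat inE !negb_or.
case/and4P=> /allrelP hab sa yb sb /and3P[xa xy' xb].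
rewrite sa sb /= !andbT; apply/andP; split.
  apply/allrelP => c d ca; rewrite inE => /predU1P[->|db].
    rewrite ltn_neqAle (allP ha) // andbT.
    by apply: contraNneq xa => <-.
  by apply: hab => //; rewrite inE db orbT.
by apply: sub_all yb => d /=; apply: ltn_trans.
Qed.

Lemma row_inserts_perm r w :
  perm_eq ((row_inserts r w).1 ++ (row_inserts r w).2) (r ++ w).
Proof.
elim: w r => [|x w IHw] r /=; first by [].
have h := row_insert_perm r x; have := IHw (row_insert r x).1.
move: (row_insert r x) h => [r' o] /= h1 h2.
apply/permP => p; have := permP h1 p; have := permP h2 p.
by rewrite !count_cat /=; lia.
Qed.


Inductive knuth_triple : seq nat -> seq nat -> Prop :=
| knuth_triple_yzx x y z : x < y < z -> knuth_triple [:: y; z; x] [:: y; x; z]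
| knuth_triple_xzy x y z : x < y < z -> knuth_triple [:: x; z; y] [:: z; x; y].

(** After [y] has entered the row, [x] acts on the part up to [y] and [z] on the
    part after [y], so that their order does not matter; the bumped letters
    satisfy x' <= y < y' < z'. *)
Lemma row_inserts_yzx r x y z : x < y < z -> sorted ltn r ->
  (row_inserts r [:: y; z; x]).1 = (row_inserts r [:: y; x; z]).1 /\
  ((row_inserts r [:: y; z; x]).2 = (row_inserts r [:: y; x; z]).2 \/
   knuth_triple (row_inserts r [:: y; z; x]).2 (row_inserts r [:: y; x; z]).2).
Proof.
move=> /andP[xy yz] sr; have xz := ltn_trans xy yz; rewrite /=.
(* the row after the insertion of y, split after y *)
have [a [b [e ay]]] : exists a b, (row_insert r y).1 = rcons a y ++ b /\
    [/\ all (fun c => c <= y) a & ((row_insert r y).2 = None /\ b = [::]) \/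
     exists y', [/\ (row_insert r y).2 = Some y', y < y' & all (ltn y') b]].
  case: (row_insertP r y) => [h|[a [y' [b [er ha yy]]]]].
    by exists r, [::]; rewrite row_insert_last // cats0; split=> //; split=> //; left.
  exists a, b; rewrite er row_insert_bump // cat_rcons; split=> //; split=> //.
  right; exists y'; split=> //.
  move: sr; rewrite er (sorted_pairwise ltn_trans) pairwise_cat /=.
  by case/and4P.
case: ay => ay ob; rewrite e.
have hx : has (fun c => x < c) (rcons a y) by rewrite has_rcons xy.
have az : all (fun c => c <= z) (rcons a y).
  rewrite all_rcons ltnW //=; apply: sub_all ay => c /= cy.
  exact: leq_trans cy (ltnW yz).
rewrite (row_insert_catr _ az) /= !(row_insert_catl _ hx) /=.
have px := row_insert_perm (rcons a y) x.
have sub c : c \in (row_insert (rcons a y) x).1 -> c <= y.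
  move=> cr; have : c \in x :: rcons a y by rewrite -(perm_mem px) mem_cat cr.
  rewrite inE mem_rcons inE => /or3P[/eqP->|/eqP->|/(allP ay)] //; exact: ltnW.
rewrite row_insert_catr /=; last first.
  by apply/allP => c /sub cy; apply: leq_trans cy (ltnW yz).
split=> //.
have [a' [x' [ex xx' x'y]]] : exists a' x',
    [/\ row_insert (rcons a y) x = (a', Some x'), x < x' & x' <= y].
  case: (row_insertP (rcons a y) x) => [h|[c [x' [d [ec hc xx']]]]].
    by move: h; rewrite all_rcons leqNgt xy.
  exists (c ++ x :: d), x'; split=> //; first by rewrite ec row_insert_bump.
  have : x' \in rcons a y by rewrite ec mem_cat mem_head orbT.
  by rewrite mem_rcons inE => /predU1P[->|/(allP ay)].
rewrite ex /=; case: ob => [[-> ->]|[y' [-> yy' hb]]] /=; first by left.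
case: (row_insertP b z) => [h|[c [z' [d [eb hc zz']]]]].
  by left; rewrite row_insert_last.
right; rewrite eb row_insert_bump //=; apply: knuth_triple_yzx.
rewrite (leq_ltn_trans x'y yy') /=; apply: (allP hb).
by rewrite eb mem_cat mem_head orbT.
Qed.

(** If a letter of the row lies between [x] and [z], then [x] and [z] bump
    independently and the relation persists; otherwise [x] and [z] meet in the
    same place and the bumped letters satisfy the other Knuth relation. *)
Lemma row_inserts_xzy r x y z : x < y < z -> sorted ltn r -> x \notin r ->
  z \notin r ->
  (row_inserts r [:: x; z; y]).1 = (row_inserts r [:: z; x; y]).1 /\
  ((row_inserts r [:: x; z; y]).2 = (row_inserts r [:: z; x; y]).2 \/
   knuth_triple (row_inserts r [:: x; z; y]).2 (row_inserts r [:: z; x; y]).2 \/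
   knuth_triple (row_inserts r [:: z; x; y]).2 (row_inserts r [:: x; z; y]).2).
Proof.
move=> /andP[xy yz] sr xr zr; have xz := ltn_trans xy yz; rewrite /=.
have weak c s : all (fun d => d <= x) s -> x <= c -> all (fun d => d <= c) s.
  by move=> h xc; apply: sub_all h => d /= dx; apply: leq_trans xc.
case: (row_insertP r x) => [h|[a [c [b [er ha xc]]]]].
  (* no letter above x: the three letters end up at the end of the row *)
  have hz := weak z _ h (ltnW xz); have hy := weak y _ h (ltnW xy).
  rewrite (row_insert_last h) (row_insert_last hz) /=.
  have hxz : all (fun d => d <= z) (rcons r x) by rewrite all_rcons (ltnW xz).
  have hxy : all (fun d => d <= y) (rcons r x) by rewrite all_rcons (ltnW xy).
  rewrite (row_insert_last hxz) /= -[rcons (rcons r x) z]cats1.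
  rewrite (row_insert_bump [::] hxy yz) /= -[rcons r z]cats1.
  rewrite (row_insert_bump [::] h xz) /= [r ++ [:: x]]cats1 (row_insert_last hxy) /=.
  by rewrite cats1; split=> //; left.
have /and4P[hab sa cb sb] : [&& allrel ltn a (c :: b), pairwise ltn a,
    all (ltn c) b & pairwise ltn b].
  by move: sr; rewrite er (sorted_pairwise ltn_trans) pairwise_cat /=.
have haz := weak z _ ha (ltnW xz); have hay := weak y _ ha (ltnW xy).
rewrite er (row_insert_bump _ ha xc) /=.
have hax : all (fun d => d <= y) (a ++ [:: x]) by rewrite all_cat hay /= (ltnW xy).
have haxz : all (fun d => d <= z) (a ++ [:: x]) by rewrite all_cat haz /= (ltnW xz).
have cat1 d s : a ++ x :: d :: s = (a ++ [:: x]) ++ d :: s by rewrite -catA.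
have cat2 s : a ++ x :: s = (a ++ [:: x]) ++ s by rewrite -catA.
have cz' : c != z by apply: contraNneq zr => <-; rewrite er mem_cat mem_head orbT.
case: (leqP c z) => cz; last first.
  (* no letter of the row lies between x and z *)
  rewrite (row_insert_bump b haz cz) /= (row_insert_bump b ha xz) /=.
  case: b cb {sb er hab} => [|d b] cb.
    rewrite (row_insert_last haxz) (row_insert_last hax) /= -!cats1.
    by rewrite (row_insert_bump [::] hax yz) /=; split=> //; left.
  have cd : c < d by case/andP: cb.
  have zd := ltn_trans cz cd; have yd := ltn_trans yz zd.
  rewrite cat1 (row_insert_bump b haxz zd) /= (row_insert_bump b hax yz) /=.
  rewrite (row_insert_bump b hax yd) /=; split=> //; right; left.
  by apply: knuth_triple_yzx; rewrite cz cd.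
have {cz'}cz : c < z by rewrite ltn_neqAle cz'.
have haxcz : all (fun d => d <= z) (a ++ [:: c]) by rewrite all_cat haz /= (ltnW cz).
have -> : a ++ c :: b = (a ++ [:: c]) ++ b by rewrite -catA.
rewrite (row_insert_catr b haxcz) /= -[(a ++ [:: c]) ++ _]catA /=.
rewrite (row_insert_bump _ ha xc) /= (cat2 b) (row_insert_catr b haxz) /=.
rewrite (cat2 (row_insert b z).1) !(row_insert_catr _ hax) /=; split=> //.
case: (row_insertP b z) => [h|[b1 [z' [b2 [eb hb zz']]]]].
  by left; rewrite row_insert_last.
right; left; rewrite eb row_insert_bump //=.
(* y bumps a letter that is at most z, because z is now in the row *)
have [y' [-> cy' y'z]] : exists y', [/\ (row_insert (b1 ++ z :: b2) y).2 = Some y',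
    c < y' & y' <= z].
  case: (row_insertP b1 y) => [h|[d1 [y' [d2 [ed hd yy']]]]].
    by exists z; rewrite row_insert_bump.
  exists y'; rewrite ed -catA /= row_insert_bump //; split=> //.
    by apply: (allP cb); rewrite eb ed !mem_cat mem_head orbT.
  by apply: (allP hb); rewrite ed mem_cat mem_head orbT.
by apply: knuth_triple_xzy; rewrite cy' (leq_ltn_trans y'z zz').
Qed.

End Plactic.

(** * Insertion tableaux *)

Section Tableaux.
Local Open Scope nat_scope.
Implicit Types (r s u v w : seq nat) (t : seq (seq nat)) (x y z : nat).

Lemma insert_perm t x : perm_eq (flatten (insert t x)) (x :: flatten t).
Proof.
elim: t x => [|r t IHt] x //; rewrite insert_cons /=.
have p := row_insert_perm r x.
case: (row_insert r x) p => r' [y|] /= p.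
  apply/permP => a; have := permP p a; have := permP (IHt y) a.
  by rewrite /= !count_cat /=; lia.
by apply/permP => a; have := permP p a; rewrite /= !count_cat /=; lia.
Qed.

Lemma inserts_perm t w : perm_eq (flatten (foldl insert t w)) (flatten t ++ w).
Proof.
elim: w t => [|x w IHw] t /=; first by rewrite cats0.
apply: perm_trans (IHw _) _; apply/permP => a; have := permP (insert_perm t x) a.
by rewrite /= !count_cat /=; lia.
Qed.

Lemma Ptab_perm w : perm_eq (flatten (Ptab w)) w.
Proof. exact: inserts_perm [::] w. Qed.

Lemma insert_sorted t x : all (sorted ltn) t -> uniq (flatten t ++ [:: x]) ->
  all (sorted ltn) (insert t x).
Proof.
elim: t x => [|r t IHt] x //= /andP[sr st] ut; rewrite -[if _ then _ else _]/(insert (r :: t) x).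
have xr : x \notin r.
  by move: ut; rewrite -catA cat_uniq has_cat /= orbF !negb_or => /and3P[_ /andP[]].
rewrite insert_cons /= row_insert_sorted //=.
have p := row_insert_perm r x.
case: (row_insert r x) p => r' [y|] //= p; apply: IHt => //.
have e : perm_eq (r' ++ (flatten t ++ [:: y])) ((r ++ flatten t) ++ [:: x]).
  apply/permP => a; have := permP p a; rewrite /= !count_cat /=; lia.
by move: ut; rewrite -(perm_uniq e) cat_uniq => /and3P[].
Qed.

Lemma inserts_sorted t w : all (sorted ltn) t -> uniq (flatten t ++ w) ->
  all (sorted ltn) (foldl insert t w).
Proof.
elim: w t => //= x w IHw t st ut; apply: IHw.
  apply: insert_sorted => //; move: ut; rewrite -cat_rcons -cats1 cat_uniq.
  by case/andP.
have e : perm_eq (flatten (insert t x) ++ w) (flatten t ++ x :: w).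
  apply/permP => a; have := permP (insert_perm t x) a; rewrite /= !count_cat /=; lia.
by rewrite (perm_uniq e).
Qed.

Lemma Ptab_sorted w : uniq w -> all (sorted ltn) (Ptab w).
Proof. exact: (@inserts_sorted [::]). Qed.

(** Row by row, two related words either become equal or bump related words; the
    rows being finite, the words finally agree. *)
Lemma inserts_triple t w w' : knuth_triple w w' -> all (sorted ltn) t ->
  uniq (flatten t ++ w) -> foldl insert t w = foldl insert t w'.
Proof.
elim: t w w' => [|r t IHt] w w' k.
  case: k => x y z /andP[xy yz] _ _ /=; have xz := ltn_trans xy yz;
    have [yx zy zx] : [/\ (y < x) = false, (z < y) = false & (z < x) = false]
      by split; apply/negbTE; rewrite -leqNgt ltnW.
    by rewrite !(xy, yz, xz, yx, zy, zx) /= !(xy, yz, xz, yx, zy, zx) /= ?(xy, yz, xz, yx, zy, zx).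
  by rewrite !(xy, yz, xz, yx, zy, zx) /= !(xy, yz, xz, yx, zy, zx) /= ?(xy, yz, xz, yx, zy, zx).
move=> /= /andP[sr st] ut; rewrite !inserts_cons.
have [kp kt] : (row_inserts r w).1 = (row_inserts r w').1 /\
  ((row_inserts r w).2 = (row_inserts r w').2 \/
   knuth_triple (row_inserts r w).2 (row_inserts r w').2 \/
   knuth_triple (row_inserts r w').2 (row_inserts r w).2).
  case: k ut => x y z h ut.
    by have [-> []] := row_inserts_yzx h sr; split=> //; [left | right; left].
  move: ut; rewrite -catA cat_uniq => /and3P[_ + _].
  rewrite has_cat negb_or => /andP[_]; rewrite /= !negb_or => /and3P[xr zr _].
  exact: row_inserts_xzy.
have uo v : perm_eq v (row_inserts r w).2 -> uniq (flatten t ++ v).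
  move=> pv.
  have e : perm_eq ((row_inserts r w).1 ++ (flatten t ++ v)) ((r ++ flatten t) ++ w).
    apply/permP => a; have := permP (row_inserts_perm r w) a; have := permP pv a.
    by rewrite !count_cat; lia.
  by move: ut; rewrite -(perm_uniq e) cat_uniq => /and3P[].
rewrite kp; congr (_ :: _); case: kt => [-> //|[kt|kt]].
  by apply: IHt => //; apply: uo.
apply/esym/IHt => //; apply: uo.
case: kt => x y z _; apply/permP => a /=; lia.
Qed.

(** Elementary relations are treated by [inserts_triple]; a common suffix is
    inserted into equal tableaux. *)
Lemma knuth_Ptab w w' : knuth w w' -> uniq w -> Ptab w = Ptab w'.
Proof.
have triple u v a b : knuth_triple a b -> uniq (u ++ a ++ v) ->
    Ptab (u ++ a ++ v) = Ptab (u ++ b ++ v).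
  move=> k uw; rewrite /Ptab !foldl_cat; congr foldl.
  apply: inserts_triple => //.
    by apply: Ptab_sorted; move: uw; rewrite cat_uniq => /andP[].
  have e : perm_eq (flatten (foldl insert [::] u) ++ a) (u ++ a).
    by rewrite perm_cat2r Ptab_perm.
  by move: uw; rewrite (perm_uniq e) catA cat_uniq => /andP[].
elim=> [//|w0 w1 k IH u1|w0 w1 w2 k1 IH1 _ IH2 u0|u v x y z h uw|u v x y z h uw].
- by apply/esym/IH; rewrite (perm_uniq (knuth_perm k)).
- by rewrite IH1 // IH2 // -(perm_uniq (knuth_perm k1)).
- by apply: triple uw; apply: knuth_triple_yzx.
- by apply: triple uw; apply: knuth_triple_xzy.
Qed.

(** Rows from the bottom to the top. *)
Definition reading t : seq nat := flatten (rev t).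

Lemma reading_cons r t : reading (r :: t) = reading t ++ r.
Proof. by rewrite /reading rev_cons -cats1 flatten_cat /= cats0. Qed.

Lemma reading_perm t : perm_eq (reading t) (flatten t).
Proof. by apply/perm_flatten; rewrite perm_rev. Qed.

(** The inserted letter moves left past the letters that are larger than the one
    it bumps. *)
Lemma knuth_bump_right y r x : path ltn y r -> x < y ->
  knuth (y :: rcons r x) [:: y, x & r].
Proof.
elim: r y => [|c r IHr] y /=; first by move=> *; apply: knuth_refl.
move=> /andP[yc pr] xy.
apply: knuth_trans (_ : knuth _ (y :: [:: c, x & r])) _.
  by apply: (@knuth_catl [:: y]); apply: IHr => //; apply: ltn_trans yc.
by apply: (@knuth_yzx [::] r); rewrite xy.
Qed.

(** The bumped letter moves left past the letters that are smaller than the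
    inserted one. *)
Lemma knuth_bump_left r x y : sorted ltn (rcons r x) -> x < y ->
  knuth (r ++ [:: y; x]) (y :: rcons r x).
Proof.
elim/last_ind: r x => [|r b IHr] x; first by move=> *; apply: knuth_refl.
move=> srbx xy.
have bx : b < x.
  move: srbx; rewrite -!cats1 -catA /= (sorted_pairwise ltn_trans) pairwise_cat /=.
  by case/and4P=> _ _ /andP[].
have srb : sorted ltn (rcons r b).
  move: srbx; rewrite -cats1 (sorted_pairwise ltn_trans) pairwise_cat.
  by rewrite -(sorted_pairwise ltn_trans) => /and3P[].
rewrite cat_rcons -[rcons (rcons r b) x]cats1 -cat_cons.
apply: knuth_trans (knuth_catr [:: x] (IHr b srb (ltn_trans bx xy))).
rewrite -catA /=; have := @knuth_xzy r [::] b x y; rewrite bx xy /=.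
exact.
Qed.

Lemma knuth_row_insert r x : sorted ltn r -> x \notin r ->
  knuth (rcons r x) (bumped (row_insert r x).2 ++ (row_insert r x).1).
Proof.
move=> sr xr; case: (row_insertP r x) => [h|[a [y [b [er ha xy]]]]].
  by rewrite row_insert_last //; apply: knuth_refl.
have sr' := row_insert_sorted sr xr; move: sr'.
rewrite er row_insert_bump //= -cats1 -catA /= => sr'.
have pb : path ltn y b.
  move: sr; rewrite er !(sorted_pairwise ltn_trans) pairwise_cat => /and3P[_ _].
  by rewrite -(sorted_pairwise ltn_trans).
rewrite cats1; apply: knuth_trans (knuth_catl a (knuth_bump_right pb xy)) _.
have -> : a ++ [:: y, x & b] = (a ++ [:: y; x]) ++ b by rewrite -catA.
have -> : y :: a ++ x :: b = (y :: rcons a x) ++ b by rewrite /= cat_rcons.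
apply/knuth_catr/knuth_bump_left => //.
move: sr'; rewrite -cat_rcons !(sorted_pairwise ltn_trans) pairwise_cat.
by case/and3P.
Qed.

Lemma knuth_insert t x : all (sorted ltn) t -> uniq (flatten t ++ [:: x]) ->
  knuth (rcons (reading t) x) (reading (insert t x)).
Proof.
elim: t x => [|r t IHt] x; first by move=> *; apply: knuth_refl.
move=> /andP[sr st] ut; rewrite insert_cons !reading_cons rcons_cat.
have xr : x \notin r.
  by move: ut; rewrite /= -catA cat_uniq has_cat /= orbF !negb_or => /and3P[_ /andP[]].
have k := knuth_row_insert sr xr; have p := row_insert_perm r x.
case: (row_insert r x) k p => r' [y|] /= k p; last exact: knuth_catl.
apply: knuth_trans (knuth_catl _ k) _; rewrite -cat_rcons.
apply/knuth_catr/IHt => //.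
have e : perm_eq (r' ++ (flatten t ++ [:: y])) ((r ++ flatten t) ++ [:: x]).
  apply/permP => a; have := permP p a; rewrite /= !count_cat /=; lia.
by move: ut; rewrite /= -(perm_uniq e) cat_uniq => /and3P[].
Qed.

(** Row insertion is a sequence of Knuth relations on the reading word. *)
Lemma knuth_reading w : uniq w -> knuth w (reading (Ptab w)).
Proof.
elim/last_ind: w => [|w x IHw] uw; first exact: knuth_refl.
have uw' : uniq w by move: uw; rewrite rcons_uniq => /andP[].
rewrite /Ptab foldl_rcons -/(Ptab w) -cats1.
apply: knuth_trans (knuth_catr [:: x] (IHw uw')) _; rewrite cats1.
apply: knuth_insert; first exact: Ptab_sorted.
rewrite cats1 (perm_uniq (s2 := rcons w x)) // -!cats1 perm_cat2r.
exact: Ptab_perm.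
Qed.

Lemma PtabP w w' : uniq w -> uniq w' -> Ptab w = Ptab w' <-> knuth w w'.
Proof.
move=> uw uw'; split=> [e|k]; last exact: knuth_Ptab.
apply: knuth_trans (knuth_reading uw) _; rewrite e.
exact/knuth_sym/knuth_reading.
Qed.

(** The condition that the columns through two consecutive rows increase, as in
    the definition of tableaux. *)
Definition dominates r s : bool :=
  (size s <= size r) && all2 ltn (take (size s) r) s.

Lemma dominatesP r s : reflect
  (size s <= size r /\ forall i, i < size s -> nth 0 r i < nth 0 s i)
  (dominates r s).
Proof.
rewrite /dominates; apply: (iffP andP) => -[srs h]; split=> //.
  move=> i is_; elim: s r i srs h is_ => // y s IHs [|x r] // [|i] /= srs /andP[xy h] is_ //.
  exact: IHs.
elim: s r srs h => [|y s IHs] [|x r] //= srs h.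
by rewrite (h 0) //= IHs // => i is_; apply: (h i.+1).
Qed.

(** The letter [y] bumped from column p of [r] enters [s] in a column at most p,
    since the entry of [s] below [y] is larger than [y]; there it stands below a
    smaller entry. *)
Lemma dominates_insert r s x y r' : sorted ltn r -> dominates r s ->
  row_insert r x = (r', Some y) -> dominates r' (row_insert s y).1.
Proof.
move=> sr /dominatesP[srs drs]; rewrite /row_insert.
set p := find _ r; case: eqP => // /eqP np [<- <-].
have pr : p < size r by rewrite ltn_neqAle np find_size.
have xy : x < nth 0 r p by apply: (nth_find 0); rewrite has_find.
have mono i j : i < j < size r -> nth 0 r i < nth 0 r j.
  by move=> /andP[ij jr]; apply: (sorted_ltn_nth ltn_trans 0 sr) => //; rewrite inE // (ltn_trans ij).
set p2 := find _ s.
(* the column where y enters s is not to the right of the column it left *)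
have p2p : p2 <= p.
  case: (leqP (size s) p) => sp; first exact: leq_trans (find_size _ _) sp.
  by rewrite leqNgt; apply/negP => /(before_find 0); rewrite drs.
have r'_le i : i < size r -> nth 0 (set_nth 0 r p x) i <= nth 0 r i.
  by move=> ir; rewrite nth_set_nth /=; case: eqP => [->|//]; apply: ltnW.
have r'_p2 : nth 0 (set_nth 0 r p x) p2 < nth 0 r p.
  rewrite nth_set_nth /=; case: eqP => [//|/eqP ne].
  by apply: mono; rewrite ltn_neqAle ne p2p pr.
have sr' : size (set_nth 0 r p x) = size r by rewrite size_set_nth; apply/maxn_idPr.
case: eqP => [e|/eqP ne] /=; apply/dominatesP; rewrite sr'.
  rewrite size_rcons; split=> [|i]; first by rewrite -e; apply: leq_ltn_trans p2p pr.
  rewrite ltnS nth_rcons leq_eqVlt => /predU1P[->|is_].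
    by rewrite ltnn eqxx -e.
  by rewrite is_; apply: leq_ltn_trans (r'_le i _) (drs i is_); apply: leq_trans is_ srs.
have p2s : p2 < size s by rewrite ltn_neqAle ne find_size.
have ss' : size (set_nth 0 s p2 (nth 0 r p)) = size s.
  by rewrite size_set_nth; apply/maxn_idPr.
rewrite ss'; split=> // i is_; rewrite [X in _ < X]nth_set_nth /=.
case: eqP => [->|_]; first by [].
by apply: leq_ltn_trans (r'_le i _) (drs i is_); apply: leq_trans is_ srs.
Qed.

Lemma dominates_rcons r s x : dominates r s -> dominates (rcons r x) s.
Proof.
move=> /dominatesP[srs d]; apply/dominatesP; rewrite size_rcons; split; first exact: leqW.
by move=> i is_; rewrite nth_rcons (leq_trans is_ srs) d.
Qed.

Lemma path_dominates_insert r t x y r' : all (sorted ltn) (r :: t) ->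
  path dominates r t -> row_insert r x = (r', Some y) ->
  path dominates r' (insert t y).
Proof.
elim: t r x y r' => [|s t IHt] r x y r' /andP[sr st] pt e.
  have r_nil : dominates r [::] by apply/dominatesP.
  by rewrite /= andbT; have := dominates_insert sr r_nil e.
have /andP[drs pst] := pt.
rewrite insert_cons /= (dominates_insert sr drs e) /=.
case es : (row_insert s y) => [s' [z|]] /=; first exact: IHt es.
case: t {IHt} st pst pt => // s2 t _ /andP[d pt2] _; apply/andP; split=> //.
by move: es; rewrite /row_insert; case: eqP => // _ [<-]; apply: dominates_rcons.
Qed.

Lemma sorted_dominates_insert t x : all (sorted ltn) t -> sorted dominates t ->
  sorted dominates (insert t x).
Proof.
case: t => // r t st pt; rewrite insert_cons.
case e : (row_insert r x) => [r' [y|]]; first exact: path_dominates_insert e.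
case: t pt st => // s t /andP[d pt2] _; apply/andP; split=> //.
by move: e; rewrite /row_insert; case: eqP => // _ [<-]; apply: dominates_rcons.
Qed.

Lemma insert_nonempty t x : all (fun r => r != [::]) t ->
  all (fun r => r != [::]) (insert t x).
Proof.
elim: t x => // r t IHt x /andP[r0 t0]; rewrite insert_cons.
rewrite /row_insert; case: ifP => _; apply/andP; split=> //; try exact: IHt.
  by rewrite -size_eq0 size_rcons.
by rewrite -size_eq0 size_set_nth -lt0n leq_max.
Qed.

Lemma Ptab_shape w : uniq w ->
  all (fun r => r != [::]) (Ptab w) /\ sorted dominates (Ptab w).
Proof.
elim/last_ind: w => // w x IHw; rewrite rcons_uniq => /andP[_ uw].
have [n d] := IHw uw; rewrite /Ptab foldl_rcons -/(Ptab w); split.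
  exact: insert_nonempty.
by apply: sorted_dominates_insert => //; apply: Ptab_sorted.
Qed.

Lemma is_syt_Ptab w : is_perm w -> is_syt (Ptab w).
Proof.
move=> pw; have uw := perm_uniqP pw; have [n d] := Ptab_shape uw.
apply/and3P; split.
- rewrite /is_perm (perm_size (Ptab_perm w)).
  exact: perm_trans (Ptab_perm w) pw.
- have := Ptab_sorted uw; elim: (Ptab w) n {d} => //= r t IHt /andP[-> /IHt h].
  by case/andP=> -> /h.
- exact: d.
Qed.

Lemma row_inserts_dominates r1 r2 s2 : sorted ltn (r1 ++ r2) ->
  dominates r2 s2 -> row_inserts (r1 ++ s2) r2 = (r1 ++ r2, s2).
Proof.
elim: r2 r1 s2 => [|x r2 IHr] r1 s2.
  by rewrite cats0 => _ /dominatesP[/=]; rewrite leqn0 size_eq0 => /eqP ->; rewrite cats0.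
move=> sr d.
have h1 : all (fun y => y <= x) r1.
  apply/allP => y yr1; move: sr; rewrite (sorted_pairwise ltn_trans) pairwise_cat.
  case/andP=> /allrelP h _; apply: ltnW; apply: h => //; exact: mem_head.
rewrite -cat_rcons in sr.
case: s2 d => [|y s2] d.
  rewrite cats0 /= row_insert_last //= -[rcons r1 x]cats0 IHr //.
    by rewrite cat_rcons.
  by apply/dominatesP.
have [xy d'] : x < y /\ dominates r2 s2.
  by move: d; rewrite /dominates /= ltnS => /andP[-> /andP[]].
by rewrite /= row_insert_bump //= -cat_rcons IHr // cat_rcons.
Qed.

(** Inserting a dominating row bumps the whole first row, which bumps the second
    one, and so on. *)
Lemma inserts_dominates t r : all (fun s => s != [::]) (r :: t) ->
  all (sorted ltn) (r :: t) -> path dominates r t -> foldl insert t r = r :: t.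
Proof.
elim: t r => [|s t IHt] r /= /andP[r0 nt] /andP[sr st].
  case: r r0 sr => // x r _ sr _ /=; rewrite inserts_cons.
  by rewrite (@row_inserts_dominates [:: x] r [::]) //; apply/dominatesP.
case/andP=> d pt; rewrite inserts_cons (@row_inserts_dominates [::]) //=.
by rewrite IHt.
Qed.

Lemma Ptab_reading t : all (fun s => s != [::]) t -> all (sorted ltn) t ->
  sorted dominates t -> Ptab (reading t) = t.
Proof.
elim: t => // r t IHt nt st pt.
rewrite reading_cons /Ptab foldl_cat -/(Ptab _) IHt ?inserts_dominates //.
- by case/andP: nt.
- by case/andP: st.
- exact: path_sorted pt.
Qed.

End Tableaux.

(** * The Hopf algebra of tableaux *)

Section Relabel.
Local Open Scope nat_scope.
Implicit Types a b u : seq nat.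

(** The rearrangement of [u] that turns [a], the standardization of [u], into [a']. *)
Definition relabel a a' u : seq nat := [seq nth 0 u (index x a) | x <- a'].

Lemma relabel_mono a u : uniq u -> st_seq u = a ->
  exists g : nat -> nat, [/\ {in a &, {homo g : x y / x < y}}, u = map g a &
    forall a', relabel a a' u = map g a'].
Proof.
move=> uu ea; exists (fun x => nth 0 u (index x a)).
have sua : size a = size u by rewrite -ea size_st.
have ua : uniq a by rewrite -ea; exact: perm_uniqP (is_perm_st u).
have [_ ord] : same_order u a by rewrite -ea; apply: same_order_st.
split=> //; last first.
  apply: (@eq_from_nth _ 0) => [|i iu]; first by rewrite size_map sua.
  by rewrite (nth_map 0) ?sua // index_uniq ?sua.
move=> x y xa ya xy.
have ix : index x a < size u by rewrite -sua index_mem.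
have iy : index y a < size u by rewrite -sua index_mem.
case: (ltngtP (index x a) (index y a)) => lt.
- have := ord (index x a) (index y a); rewrite lt iy => /(_ isT).
  rewrite !nth_index // (ltnW xy) ltn_neqAle => ->; rewrite andbT nth_uniq //.
  by rewrite neq_ltn lt.
- have := ord (index y a) (index x a); rewrite lt ix => /(_ isT).
  by rewrite !nth_index // [y <= x]leqNgt xy ltnNge => /= ->.
- by move: xy; rewrite -(nth_index 0 xa) -(nth_index 0 ya) lt ltnn.
Qed.

(** [u] is a monotone relabelling of [a], hence its rearrangement is the same
    relabelling of [a'], and Knuth equivalence is preserved by monotone
    relabelling. *)
Lemma relabelP a a' u : uniq u -> st_seq u = a -> knuth a a' ->
  [/\ knuth u (relabel a a' u), st_seq (relabel a a' u) = st_seq a' &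
      relabel a' a (relabel a a' u) = u].
Proof.
move=> uu ea k; have [g [mg eu er]] := relabel_mono uu ea.
have p := knuth_perm k.
have mg' : {in a' &, {homo g : x y / x < y}}.
  by move=> x y; rewrite -!(perm_mem p); apply: mg.
rewrite er; split.
- by rewrite {1}eu; apply: knuth_map.
- apply/esym/eq_st/same_order_map => x y xa ya.
  case: (ltngtP x y) => [/mg' h|/mg' h|->]; last by rewrite leqnn.
    by rewrite ltnW // h.
  by apply/negbTE; rewrite -ltnNge h.
rewrite /relabel [RHS]eu; apply/eq_in_map => x xa.
have xa' : x \in a' by rewrite -(perm_mem p).
by rewrite (nth_map 0) ?index_mem // nth_index.
Qed.

End Relabel.

Section PlacticAlgebra.
Variables (k : comPzRingType) (q p : k).
Hypothesis pq : p * q = 1.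

Definition tableau (w : permword) : syt := Sub (Ptab (val w)) (is_syt_Ptab (valP w)).

Lemma is_perm_reading (T : syt) : is_perm (reading (val T)).
Proof.
have /and3P[pT _ _] := valP T.
rewrite /is_perm (perm_size (reading_perm _)).
exact: perm_trans (reading_perm _) pT.
Qed.

Definition reading_word (T : syt) : permword := Sub (reading (val T)) (is_perm_reading T).

Lemma tableau_reading T : tableau (reading_word T) = T.
Proof.
apply: val_inj; have /and3P[_ rT dT] := valP T.
apply: Ptab_reading => //.
  by apply: sub_all rT => r /andP[].
by apply: sub_all rT => r /andP[].
Qed.

Lemma tableauP w w' : tableau w = tableau w' <-> knuth (val w) (val w').
Proof.
have h := PtabP (uniq_permword w) (uniq_permword w'); split=> [e|/h e].
  by apply/h; apply: (congr1 val e).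
exact: val_inj.
Qed.

Lemma knuth_reading_word w : knuth (val w) (val (reading_word (tableau w))).
Proof. exact: knuth_reading (uniq_permword w). Qed.

Lemma size_tableau w : size (flatten (val (tableau w))) = size (val w).
Proof. exact: perm_size (Ptab_perm (val w)). Qed.

Lemma c_tab_coef T w : (c_tab q T)@_w = (tableau w == T)%:R * q ^+ inversions (val w).
Proof.
rewrite (coef_big_bas _ (fun w : permword => q ^+ inversions (val w))) ?permwords_uniq //.
rewrite mem_permwords -[tableau w == T]val_eqE.
rewrite -[Ptab (val w) == _]/(val (tableau w) == val T).
by case: (val (tableau w) =P val T) => [<-|_]; rewrite ?andbF // size_tableau eqxx.
Qed.

Lemma PR'_incl_linear : linear (PR'_incl q).
Proof. exact: lext_linear. Qed.

Lemma PR'_incl_bas T : PR'_incl q (bas k T) = c_tab q T.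
Proof. exact: lext_bas. Qed.

Lemma PR'_incl_coef x w :
  (PR'_incl q x)@_w = q ^+ inversions (val w) * x@_(tableau w).
Proof.
rewrite lext_coef [RHS]mulrC -(sum_pick x (tableau w) (fun=> q ^+ inversions (val w))).
by apply: eq_bigr => T _; rewrite c_tab_coef eq_sym.
Qed.

(** Reads the coefficient on c_q(T) at the reading word of T. *)
Definition PR'_retract : freemod k permword -> freemod k syt :=
  lext (fun w => (w == reading_word (tableau w))%:R *: (p ^+ inversions (val w) *: bas k (tableau w))).

Lemma PR'_retract_linear : linear PR'_retract.
Proof. exact: lext_linear. Qed.

Lemma PR'_retract_coef x T : (PR'_retract x)@_T =
  p ^+ inversions (val (reading_word T)) * x@_(reading_word T).
Proof.
rewrite lext_coef [RHS]mulrC.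
rewrite -(sum_pick x (reading_word T) (fun w : permword => p ^+ inversions (val w))).
apply: eq_bigr => w _; rewrite !fcoefZ fcoef_bas; congr (_ * _).
rewrite mulrCA [RHS]mulrC -natrM mulnb; congr (_ * (nat_of_bool _)%:R).
apply/andP/eqP => [[/eqP e /eqP eT]|->]; first by rewrite e eT.
by rewrite tableau_reading !eqxx.
Qed.

Let pqX n : p ^+ n * q ^+ n = 1.
Proof. by rewrite -exprMn pq expr1n. Qed.

Lemma PR'_inclK : cancel (PR'_incl q) PR'_retract.
Proof.
move=> x; apply: fcoefP => T; rewrite PR'_retract_coef PR'_incl_coef.
by rewrite tableau_reading mulrA pqX mul1r.
Qed.

Lemma PR'_incl_triangular :
  triangular (fun T => PR'_incl q (bas k T)) reading_word (fun=> 0%N).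
Proof.
split=> [T|T T']; rewrite PR'_incl_coef tableau_reading fcoef_bas.
  by exists (p ^+ inversions (val (reading_word T))); rewrite eqxx mulr1 pqX.
by case: (T =P T') => [->|_]; [left | rewrite mulr0 eqxx].
Qed.

Lemma PR'_incl_injective : injective (PR'_incl q).
Proof. exact: can_inj PR'_inclK. Qed.

(** Constancy on Knuth classes of the coefficients rescaled by q^(-l), written
    without inverses. *)
Definition plactic_invariant (x : freemod k permword) : Prop :=
  forall w w', knuth (val w) (val w') ->
    q ^+ inversions (val w') * x@_w = q ^+ inversions (val w) * x@_w'.

Lemma PR'_retractK x : plactic_invariant x -> PR'_incl q (PR'_retract x) = x.
Proof.
move=> hx; apply: fcoefP => w; rewrite PR'_incl_coef PR'_retract_coef.
rewrite mulrCA -(hx _ _ (knuth_reading_word w)) mulrA pqX mul1r.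
by [].
Qed.

(** The exponents of the product and of the two factors add up to the length, so
    the rescaled product does not involve q. *)
Lemma hmul_c_tab_coef T T' z : (hmul (MR' q) (c_tab q T) (c_tab q T'))@_z =
  q ^+ inversions (val z) * \sum_(i < (size (val z)).+1)
    (tableau (perm_restr i z) == T)%:R *
    (tableau (st [seq x <- val z | (i < x)%N]) == T')%:R.
Proof.
rewrite hmul_MR'_coef big_distrr; apply: eq_bigr => i _.
rewrite !c_tab_coef mulrACA [q ^+ inv_at _ _ * _]mulrCA [RHS]mulrC -!exprD.
congr (_ * _ ^+ _).
by rewrite (inversions_restr i (val z)) addnC stE inversions_st.
Qed.

Lemma plactic_mul T T' : plactic_invariant (hmul (MR' q) (c_tab q T) (c_tab q T')).
Proof.
move=> z z' kz; rewrite !hmul_c_tab_coef mulrCA; congr (_ * (_ * _)).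
rewrite (perm_size (knuth_perm kz)); apply: eq_bigr => i _.
have -> : tableau (perm_restr i z) = tableau (perm_restr i z').
  apply/tableauP; rewrite !perm_restrE; apply: knuth_filter kz => x y t /andP[xy yt] _.
  by move=> ti; apply: leq_trans (ltnW yt) ti.
have -> // : tableau (st [seq x <- val z | (i < x)%N]) = tableau (st [seq x <- val z' | (i < x)%N]).
apply/tableauP; rewrite !stE !st_restr_gt.
apply: knuth_map => [x y|].
  by rewrite !mem_filter => /andP[ix _] /andP[iy _] xy; lia.
apply: knuth_filter kz => x y t /andP[xy yt] ix _.
exact: ltn_trans ix xy.
Qed.

Lemma copr_coef x a b : (copr (MR' q) x)@_(a, b) =
  \sum_(w <- permwords (size (val a) + size (val b)) |
     (st (take (size (val a)) (val w)) == a) &&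
     (st (drop (size (val a)) (val w)) == b)) x@_w.
Proof.
set N := (_ + _)%N.
pose P (w : permword) := (st (take (size (val a)) (val w)) == a) &&
     (st (drop (size (val a)) (val w)) == b).
have E w : (bcopr (MR' q) w)@_(a, b) = ((w \in permwords N) && P w)%:R.
  rewrite mem_permwords fcoef_sum (sum_pick_ord (m := size (val a)) (F := fun i =>
     (bas k (st (take i (val w)), st (drop i (val w))))@_(a, b))).
    rewrite fcoef_bas xpair_eqE /P; case: leqP => aw.
      have [eb|ne] := eqVneq (st (drop (size (val a)) (val w))) b; rewrite ?andbF //.
      by rewrite /N -eb stE size_st size_drop subnKC // eqxx andbT.
    by rewrite /N ltn_eqF // (leq_trans aw) // leq_addr.
  move=> i iw ne; rewrite fcoef_bas xpair_eqE; case: eqP => //= e.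
  by case/eqP: ne; rewrite -e stE size_st size_takel.
rewrite lext_coef; under eq_bigr do rewrite E.
have E' w : ((w \in permwords N) && P w)%:R =
    \sum_(w' <- permwords N | P w') ((w == w')%:R * 1 : k).
  rewrite -[LHS]mulr1 -(coef_big_bas P (fun=> 1 : k) w (permwords_uniq N)) fcoef_sum.
  by apply: eq_bigr => w' _; rewrite fcoefZ fcoef_bas mulrC eq_sym.
under eq_bigr do rewrite E' big_distrr.
rewrite exchange_big; apply: eq_bigr => w' _.
by rewrite -[RHS]mulr1; apply: (sum_pick x w' (fun=> 1)).
Qed.

(** The coefficient at (a, b) is the sum over the permutations cut into words
    that standardize to a and b. Relabelling both parts is a bijection onto the
    corresponding set for (a', b'); it preserves Knuth classes and the
    inversions between the two parts. *)
Lemma plactic_copr x a b a' b' : plactic_invariant x ->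
  knuth (val a) (val a') -> knuth (val b) (val b') ->
  q ^+ (inversions (val a') + inversions (val b')) * (copr (MR' q) x)@_(a, b) =
  q ^+ (inversions (val a) + inversions (val b)) * (copr (MR' q) x)@_(a', b').
Proof.
move=> hx ka kb.
pose i := size (val a); pose N := (size (val a) + size (val b))%N.
have sa' : size (val a') = i by rewrite -(perm_size (knuth_perm ka)).
have sb' : size (val b') = size (val b) by rewrite -(perm_size (knuth_perm kb)).
pose S (c d : permword) := [seq w <- permwords N | (st (take i (val w)) == c) && (st (drop i (val w)) == d)].
(* st only retypes the word, which is a permutation for w in S c d *)
pose h (c d c' d' w : permword) : permword :=
  st (relabel (val c) (val c') (take i (val w)) ++ relabel (val d) (val d') (drop i (val w))).
have hP c d c' d' w : size (val c) = i -> knuth (val c) (val c') -> knuth (val d) (val d') ->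
    w \in S c d -> [/\ h c d c' d' w \in S c' d', h c' d' c d (h c d c' d' w) = w,
      knuth (val w) (val (h c d c' d' w)),
      perm_eq (take i (val w)) (take i (val (h c d c' d' w))) &
      perm_eq (drop i (val w)) (drop i (val (h c d c' d' w)))].
  move=> sc kc kd; rewrite mem_filter mem_permwords => /andP[/andP[/eqP ec /eqP ed] /eqP sw].
  have iw : (i <= size (val w))%N by rewrite sw leq_addr.
  have ut : uniq (take i (val w)) by rewrite take_uniq ?uniq_permword.
  have ud : uniq (drop i (val w)) by rewrite drop_uniq ?uniq_permword.
  have [k1 s1 r1] := relabelP ut (congr1 val ec) kc.
  have [k2 s2 r2] := relabelP ud (congr1 val ed) kd.
  rewrite /h; set u1 := relabel _ _ (take _ _) in k1 s1 r1 *.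
  set u2 := relabel _ _ (drop _ _) in k2 s2 r2 *.
  have kw : knuth (val w) (u1 ++ u2).
    rewrite -(cat_take_drop i (val w)).
    exact: knuth_trans (knuth_catr _ k1) (knuth_catl _ k2).
  have pw : is_perm (u1 ++ u2).
    rewrite /is_perm -(perm_size (knuth_perm kw)).
    apply: perm_trans (valP w); rewrite perm_sym; exact: knuth_perm.
  have ew : val (st (u1 ++ u2)) = u1 ++ u2 by rewrite stE st_perm.
  have su1 : size u1 = i by rewrite -(perm_size (knuth_perm k1)) size_takel.
  rewrite ew take_size_cat // drop_size_cat // r1 r2 cat_take_drop st_val.
  split=> //; try exact: knuth_perm.
  rewrite mem_filter mem_permwords ew take_size_cat // drop_size_cat //.
  rewrite -(perm_size (knuth_perm kw)) sw eqxx andbT.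
  by rewrite -!val_eqE !stE s1 s2 !st_perm ?(valP c') ?(valP d') ?eqxx.
have hS c d c' d' : size (val c) = i -> size (val c') = i ->
    knuth (val c) (val c') -> knuth (val d) (val d') ->
    perm_eq (S c' d') (map (h c d c' d') (S c d)).
  move=> sc sc' kc kd; apply: uniq_perm.
  - by rewrite filter_uniq ?permwords_uniq.
  - rewrite map_inj_in_uniq ?filter_uniq ?permwords_uniq // => w w' wS w'S e.
    have [_ <- _ _ _] := hP _ _ _ _ _ sc kc kd wS.
    by have [_ <- _ _ _] := hP _ _ _ _ _ sc kc kd w'S; rewrite e.
  move=> w; apply/idP/mapP => [wS|[w' w'S ->]]; last first.
    by have [] := hP _ _ _ _ _ sc kc kd w'S.
  have [wS' e _ _ _] := hP _ _ _ _ _ sc' (knuth_sym kc) (knuth_sym kd) wS.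
  by exists (h c' d' c d w).
rewrite !copr_coef sa' sb' -[X in _ * X = _]big_filter -[X in _ = _ * X]big_filter.
rewrite -/(S a b) -/(S a' b').
rewrite (perm_big _ (hS a b a' b' erefl sa' ka kb)) big_map !big_distrr.
apply: eq_big_seq => w wS /=.
have [w'S _ kw pt pd] := hP _ _ _ _ _ erefl ka kb wS.
have inv_S c d v : v \in S c d -> inversions (val v) =
    (inversions (val c) + inversions (val d) + cross_inversions (take i (val v)) (drop i (val v)))%N.
  rewrite mem_filter => /andP[/andP[/eqP <- /eqP <-] _].
  by rewrite !stE !inversions_st -inversions_cat cat_take_drop.
have := hx _ _ kw; rewrite (inv_S _ _ _ wS) (inv_S _ _ _ w'S).
rewrite -(cross_inversions_perml _ pt) -(cross_inversions_permr _ pd).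
set n := cross_inversions _ _; rewrite !(exprD _ _ n) -!mulrA ![_ * (q ^+ n * _)]mulrCA.
move/(congr1 (fun c => p ^+ n * c)); by rewrite !mulrA pqX !mul1r.
Qed.

(** An element that is invariant in both tensor factors is recovered from its
    coefficients at pairs of reading words. *)
Lemma plactic_tmap x : plactic_invariant x ->
  tmap (PR'_incl q) (PR'_incl q) (tmap PR'_retract PR'_retract (copr (MR' q) x)) =
  copr (MR' q) x.
Proof.
move=> hx; rewrite tmap_comp; do ?exact: PR'_incl_linear.
set z := copr _ _; apply: fcoefP => -[a b].
pose f c := q ^+ inversions (val c) * p ^+ inversions (val (reading_word (tableau c))).
have E w c : (PR'_incl q (PR'_retract (bas k w)))@_c =
    (w == reading_word (tableau c))%:R * f c.
  rewrite PR'_incl_coef PR'_retract_coef fcoef_bas mulrA mulrC; congr (_ * _).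
pose ra := reading_word (tableau a); pose rb := reading_word (tableau b).
have -> : (tmap (fun y => PR'_incl q (PR'_retract y))
    (fun y => PR'_incl q (PR'_retract y)) z)@_(a, b) = z@_(ra, rb) * (f a * f b).
  rewrite lext_coef -(sum_pick z (ra, rb) (fun=> f a * f b)).
  apply: eq_bigr => -[w w'] _; congr (_ * _).
  by rewrite tens_coef !E mulrACA -natrM mulnb xpair_eqE.
have := plactic_copr hx (knuth_reading_word a) (knuth_reading_word b).
rewrite -/ra -/rb -/z => e.
have : p ^+ (inversions (val ra) + inversions (val rb)) *
   (q ^+ (inversions (val a) + inversions (val b)) * z@_(ra, rb)) = z@_(a, b).
  by rewrite -e mulrA pqX mul1r.
move=> <-; rewrite /f -/ra -/rb mulrACA -!exprD [LHS]mulrC.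
by rewrite [q ^+ _ * p ^+ _]mulrC -mulrA.
Qed.

Lemma plactic_c_tab T : plactic_invariant (c_tab q T).
Proof.
move=> w w' kw; rewrite !c_tab_coef mulrCA [RHS]mulrCA.
by rewrite (tableauP w w').2 // [q ^+ _ * _]mulrC.
Qed.

Definition empty_syt : syt := tableau perm0.

(** The operations of MR' read on the basis c_q(T); that nothing is lost is
    [plactic_mul] and [plactic_copr]. *)
Definition PR' : qhopf k syt := {|
  qalg := {|
    bdeg := fun T => size (flatten (val T));
    bmul := fun T T' => PR'_retract (hmul (MR' q) (c_tab q T) (c_tab q T'));
    gone := bas k empty_syt
  |};
  bcopr := fun T => tmap PR'_retract PR'_retract (copr (MR' q) (c_tab q T));
  bcoun := fun T => (T == empty_syt)%:R
|}.

Lemma syt_size0 T : size (flatten (val T)) = 0%N -> T = empty_syt.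
Proof.
rewrite -{1 2}(tableau_reading T) size_tableau => e; congr tableau.
exact: size_permword0.
Qed.

Lemma c_tab_empty : c_tab q empty_syt = bas k perm0.
Proof.
apply: fcoefP => w; rewrite c_tab_coef fcoef_bas eq_sym.
case: (perm0 =P w) => [<-|ne]; first by rewrite eqxx mul1r.
case: eqP => [e|_]; last by rewrite mul0r.
by case: ne; apply/esym/size_permword0; rewrite -size_tableau -e size_tableau.
Qed.

Lemma PR'_incl_morph : qhopf_morph PR' (MR' q) (PR'_incl q).
Proof.
apply: qhopf_morph_bas.
- exact: PR'_incl_linear.
- move=> T; rewrite PR'_incl_bas; apply: in_degree_sum => w.
  rewrite mem_permwords => /eqP sw _; apply: in_degreeZ.
  rewrite -[bdeg _ _]sw; exact: (@in_degree_bas k _ (fun w : permword => size (val w))).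
- by move=> T T'; rewrite !PR'_incl_bas PR'_retractK //; apply: plactic_mul.
- by rewrite PR'_incl_bas c_tab_empty.
- by move=> T; rewrite PR'_incl_bas plactic_tmap //; apply: plactic_c_tab.
- move=> T; rewrite PR'_incl_bas (@coun_unit _ _ (MR' q) perm0) //.
  by rewrite c_tab_coef mulr1 eq_sym.
Qed.

Lemma PR'_is_PR' : is_PR' q PR'.
Proof.
split; last exact: PR'_incl_injective; last exact: PR'_incl_morph.
apply: (qHopf_of_injective PR'_incl_morph PR'_incl_triangular syt_size0) => //.
exact: MR'_qHopf pq.
Qed.

Lemma theta_id_perm n : theta q (bas k (id_perm n)) = bas k (id_perm n).
Proof.
rewrite theta_bas inversions_sorted ?iota_sorted // expr0 scale1r; congr bas.
rewrite [LHS]sorted_permword ?size_perm_inv ?size_id_perm //.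
apply/(sortedP 0%N) => i; rewrite size_perm_inv size_id_perm => iN.
rewrite /= -[map _ _]/(val (perm_inv (id_perm n))) !nth_perm_inv ?size_id_perm ?(ltnW iN) //.
have idx j : (j < n)%N -> index j.+1 (iota 1 n) = j.
  by move=> jn; rewrite -[j.+1]add1n -(nth_iota 0 1 jn) index_uniq ?size_iota ?iota_uniq.
by rewrite /= !idx // ltnW.
Qed.

Lemma plactic_id_perm n : plactic_invariant (bas k (id_perm n)).
Proof.
move=> w w' /knuth_sorted[/val_inj->|[nw nw']] //.
have ne v : ~~ sorted ltn (val v) -> (bas k (id_perm n))@_v = 0.
  by rewrite fcoef_bas; case: eqP => // <-; rewrite iota_ltn_sorted.
by rewrite !ne // !mulr0.
Qed.

(** The fixed elements of the retraction form a subalgebra, and it contains the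
    images of the generators. *)
Lemma theta_iota_in_PR' x :
  PR'_incl q (PR'_retract (theta q (iota_map x))) = theta q (iota_map x).
Proof.
have lF : linear (fun x => theta q (iota_map x)).
  exact: lin_comp (@theta_linear k q) (@iota_linear k).
move: x; apply: lin_eq => [||b].
- apply: (lin_comp PR'_incl_linear); exact: lin_comp PR'_retract_linear lF.
- exact: lF.
case: b; elim=> [|n s IHs] cs.
  rewrite (_ : exist _ _ _ = comp0); last exact: val_inj.
  rewrite iota_one theta_one PR'_retractK // -c_tab_empty; exact: plactic_c_tab.
have cs' : is_comp s by case/andP: cs.
rewrite (comp_cons cs cs') (iota_cat q) theta_mul iota_part theta_id_perm.
rewrite -[in LHS](IHs cs') -{1}(PR'_retractK (@plactic_id_perm n)).
rewrite -(qm_mul PR'_incl_morph) PR'_inclK (qm_mul PR'_incl_morph).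
by rewrite PR'_retractK ?IHs //; apply: plactic_id_perm.
Qed.

Lemma NSym_to_PR' : exists j : freemod k composition -> freemod k syt,
  [/\ qhopf_morph (NSym q) PR' j, injective j &
    forall x, PR'_incl q (j x) = theta q (iota_map x)].
Proof.
exists (fun x => PR'_retract (theta q (iota_map x))); split.
- apply: (qhopf_morph_factor PR'_incl_morph PR'_incl_triangular _ _ theta_iota_in_PR').
    apply: qhopf_morph_comp (iota_morph _) (theta_morph q).
    by exists p.
  apply: (lin_comp PR'_retract_linear).
  exact: lin_comp (@theta_linear k q) (@iota_linear k).
- move=> x y /(congr1 (PR'_incl q)); rewrite !theta_iota_in_PR'.
  have [_ [g [_ gK _]]] := theta_iso pq.
  by move/(can_inj gK)/iota_injective.
- exact: theta_iota_in_PR'.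
Qed.

End PlacticAlgebra.

Theorem proposition4p4 (k : comPzRingType) (q : k)
    (hq : exists p : k, p * q = 1) :
  [/\ graded_qHopf q (NSym q), graded_qHopf q (MR q), graded_qHopf q (MR' q),
      graded_qHopf q (QSym q) & QSym_in_Aq q] /\
  [/\ qhopf_morph (NSym q) (MR q) (@iota_map k), injective (@iota_map k),
      qhopf_iso (MR q) (MR' q) (theta q),
      qhopf_morph (MR' q) (QSym q) (@pi' k)
    & forall y : freemod k composition, exists x, pi' x = y] /\
  (exists PR : qhopf k syt, is_PR' q PR /\
     exists j : freemod k composition -> freemod k syt,
       [/\ qhopf_morph (NSym q) PR j, injective j
         & forall x, PR'_incl q (j x) = theta q (iota_map x)]) /\
  (forall x : freemod k composition,
     pi' (theta q (iota_map x)) = Sym_incl (phi q x)).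
Proof.
have [p pq] := hq; split; last split; last split.
- split.
  + exact: NSym_qHopf.
  + exact: MR_qHopf pq.
  + exact: MR'_qHopf pq.
  + exact: QSym_qHopf.
  + exact: QSym_in_AqP.
- split.
  + exact: iota_morph.
  + exact: iota_injective.
  + exact: theta_iso pq.
  + exact: pi'_morph.
  + exact: pi'_surjective.
- exists (PR' q p); split; first exact: PR'_is_PR'.
  exact: NSym_to_PR'.
- exact: pi'_theta_iota.
Qed.
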